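(* Suppose a finitely generated group $G$ acts on a $\delta$-hyperbolic space $X$ and $G$ is not virtually cyclic. Let $D(\epsilon)$ be a function for WPD. Assume that there exists a constant $M$ such that if $S$ is a finite generating set of $G$, then $S^M$ contains a hyperbolic element that is $D$-WPD. Assume that $G$ is equationally Noetherian. Then for any $\rho\in\xi(G)$, up to the action of $\mathrm{Aut}(G)$, there are at most finitely many finite generating sets $S$ of $G$ such that $e(G,S)=\rho$.
   Context: Conventions. Groups act by isometries; $\delta>0$. A $\delta$-hyperbolic space is a geodesic space that is $\delta$-hyperbolic in the sense of Gromov; by the paper's convention it is taken to be a connected graph with unit-length edges, acted on by graph automorphisms, so that infima such as $L(g)$ below are attained. Distance is written $|x-y|$. Growth. Generating sets are always symmetric, $S=S^{-1}$. $S^n=B_n(G,S)$ is the set of elements of $G$ of word length at most $n$ with respect to $S$, $e(G,S)=\lim_{n\to\infty}|B_n(G,S)|^{1/n}$, and $\xi(G)=\{e(G,S) : S \text{ a finite generating set of } G\}\subset\mathbb{R}$. Hyperbolic isometries and axes. For $g\in G$ put $L(g)=\inf_{x\in X}|x-g(x)|$ and $\lambda(g)=\lim_{n\to\infty}|x-g^n(x)|/n$ (independent of $x$). The element $g$ is hyperbolic (on $X$) if $\lambda(g)>0$. A $10\delta$-axis of a hyperbolic $g$ is the bi-infinite path obtained as follows: if $L(g)\ge10\delta$, take a point $x$ where $L(g)$ is attained and let the axis be the union of the $\langle g\rangle$-translates of a geodesic $[x,g(x)]$; if $L(g)<10\delta$, take $n>0$ with $L(g^n)\ge10\delta$ and apply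 this construction to $g^n$. For any two points $x,y$ on a $10\delta$-axis, the Hausdorff distance between the part of the axis between $x,y$ and a geodesic $[x,y]$ is at most $10\delta$. WPD. A function for WPD is a function $D$ assigning to each $\epsilon>0$ a number $D(\epsilon)>0$, assumed without loss of generality to be non-decreasing and to satisfy $D(100\delta)\ge50$. A hyperbolic element $g\in G$ is $D$-WPD if there is a $10\delta$-axis $\gamma$ of $g$ such that for any $\epsilon>0$ and any $x,y\in\gamma$ with $|x-y|\ge D(\epsilon)\lambda(g)$, the set $\{h\in G : |h(x)-x|\le\epsilon,\ |h(y)-y|\le\epsilon\}$ has at most $D(\epsilon)$ elements. Equationally Noetherian. For a subset $S$ of the free group $F(x_1,\dots,x_\ell)$ let $V_G(S)=\{(g_1,\dots,g_\ell)\in G^\ell : s(g_1,\dots,g_\ell)=1 \text{ for all } s\in S\}$. $G$ is equationally Noetherian if for every $\ell\ge1$ and every subset $S\subset F(x_1,\dots,x_\ell)$ there is a finite subset $S_0\subset S$ with $V_G(S_0)=V_G(S)$. *)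

(* Defs.v *)
From HB Require Import structures.
From mathcomp Require Import all_boot all_order all_algebra finmap.
From mathcomp Require Import all_classical all_reals all_analysis.

Set Implicit Arguments.
Unset Strict Implicit.
Unset Printing Implicit Defensive.

Import Order.TTheory GRing.Theory Num.Theory.
Import numFieldNormedType.Exports.

Local Open Scope classical_set_scope.
Local Open Scope ring_scope.

Section Groups.
Context {G : groupType}.
Implicit Types (S : set G) (g c : G) (n : nat).

(* The ball S^n: products of at most n letters of S (the empty product is 1). *)
Definition word_ball S n : set G :=
  [set g | exists w : seq G, [/\ (size w <= n)%N,
     forall s, s \in w -> S s & g = (\prod_(s <- w) s)%g]].

(* Generating sets are symmetric, so words in the letters of S suffice. *)
Definition fin_gen_set S : Prop :=
  [/\ finite_set S, forall s, S s -> S (s^-1)%g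
    & forall g, exists n, word_ball S n g].

(* e(G, S); the limit exists for every finite S by submultiplicativity. *)
Definition growth_rate (R : realType) S : R :=
  limn (fun n => (#|` fset_set (word_ball S n)|)%:R `^ (n%:R^-1) : R).

Definition cyclic_subgroup c : set G :=
  [set h | exists n, h = (c ^+ n)%g \/ h = (c ^- n)%g].

Definition automorphism (phi : G -> G) : Prop :=
  bijective phi /\ forall g h, phi (g * h)%g = (phi g * phi h)%g.

Definition aut_orbit S : set (set G) :=
  [set T | exists2 phi, automorphism phi & T = phi @` S].

End Groups.

Definition growth_spectrum (R : realType) (G : groupType) : set R :=
  [set growth_rate R S | S in [set S : set G | fin_gen_set S]].

Arguments growth_spectrum : clear implicits.

Definition finitely_generated (G : groupType) : Prop :=
  exists S : set G, fin_gen_set S.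

(* Some cyclic subgroup has finitely many left cosets. *)
Definition virtually_cyclic (G : groupType) : Prop :=
  exists c : G,
    finite_set (range (fun g => [set (g * h)%g | h in cyclic_subgroup c])).

(* The letter (i, true) stands for x_i and (i, false) for x_i^-1; the elements
   of the free group on l generators are the freely reduced words. *)
Definition reduced (l : nat) (w : seq ('I_l * bool)) : bool :=
  sorted (fun p q => ~~ ((p.1 == q.1) && (p.2 != q.2))) w.

Definition free_group (l : nat) : Type :=
  {w : seq ('I_l * bool) | reduced w}.

Definition word_eval (G : groupType) (l : nat) (a : 'I_l -> G)
    (w : free_group l) : G :=
  (\prod_(p <- sval w) (if p.2 then a p.1 else (a p.1)^-1))%g.

Definition solution_set (G : groupType) (l : nat) (S : set (free_group l)) :
    set ('I_l -> G) :=
  [set a | forall w, S w -> word_eval a w = 1%g].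

Definition equationally_noetherian (G : groupType) : Prop :=
  forall l : nat, (0 < l)%N -> forall S : set (free_group l),
    exists S0 : set (free_group l),
      [/\ finite_set S0, S0 `<=` S
        & solution_set (G := G) S0 = solution_set (G := G) S].

Section Spaces.
Context {R : realType} {X : metricType R}.
Implicit Types (x y z w : X) (delta : R).

(* sigma is the image of a geodesic from x to y. *)
Definition geodesic_segment (sigma : set X) x y : Prop :=
  exists c : R -> X, [/\ c 0 = x, c (mdist x y) = y,
    forall s t, 0 <= s <= mdist x y -> 0 <= t <= mdist x y ->
      mdist (c s) (c t) = `|s - t|
    & sigma = c @` [set t | 0 <= t <= mdist x y]].

Definition gromov_product x y w : R :=
  (mdist x w + mdist y w - mdist x y) / 2.

(* A string of segments, each inside one closed edge, from x to y; the last
   argument is its total length. *)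
Inductive edge_string (E : Type) (edge : E -> R -> X) : X -> X -> R -> Prop :=
| edge_string_nil x : edge_string edge x x 0
| edge_string_cons i s t y len : 0 <= s <= 1 -> 0 <= t <= 1 ->
    edge_string edge (edge i t) y len ->
    edge_string edge (edge i s) y (`|s - t| + len).

(* X is the geometric realization of a connected graph with vertex set V and
   with one edge of length 1, parametrized by edge i on [0, 1], for each i : E
   (values outside [0, 1] are irrelevant); loops and multiple edges are allowed.
   As in Bridson-Haefliger I.1.9, the metric is the induced path metric. *)
Definition unit_metric_graph (V : set X) (E : Type) (edge : E -> R -> X) :
    Prop :=
  [/\ forall i, V (edge i 0) /\ V (edge i 1),
      forall i t, 0 < t < 1 -> ~ V (edge i t),
      forall i j s t, 0 < s < 1 -> 0 < t < 1 -> edge i s = edge j t ->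
        i = j /\ s = t,
      forall x, V x \/ exists i t, 0 < t < 1 /\ x = edge i t
    & forall x y, (exists len, edge_string edge x y len) /\
        mdist x y = inf [set len | edge_string edge x y len]].

End Spaces.

Definition geodesic_space (R : realType) (X : metricType R) : Prop :=
  forall x y : X, exists sigma, geodesic_segment sigma x y.

(* Gromov's four-point inequality in a geodesic space. *)
Definition hyperbolic_space (R : realType) (X : metricType R) (delta : R) :
    Prop :=
  geodesic_space X /\
  forall x y z w : X,
    Num.min (gromov_product x y w) (gromov_product y z w) - delta
      <= gromov_product x z w.

Section Actions.
Context {R : realType} {G : groupType} {X : metricType R}.
Variable act : G -> X -> X.
Implicit Types (g h : G) (x y : X) (delta : R) (gamma : set X) (D : R -> R).

Definition isometric_action : Prop :=
  [/\ forall x, act 1%g x = x,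
      forall g h x, act (g * h)%g x = act g (act h x)
    & forall g x y, mdist (act g x) (act g y) = mdist x y].

Definition acts_by_graph_automorphisms (V : set X) (E : Type)
    (edge : E -> R -> X) : Prop :=
  (forall g v, V v -> V (act g v)) /\
  (forall g i, exists j,
     (forall t, 0 <= t <= 1 -> act g (edge i t) = edge j t) \/
     (forall t, 0 <= t <= 1 -> act g (edge i t) = edge j (1 - t))).

(* L(g) *)
Definition min_displacement g : R := inf (range (fun x => mdist x (act g x))).

(* lambda(g): the common value, for all x, of the limit. *)
Definition translation_length g : R :=
  get [set l : R | forall x,
    (fun n : nat => mdist x (act (g ^+ n)%g x) / n%:R) @ \oo --> l].

Definition hyperbolic_element g : Prop := 0 < translation_length g.

(* gamma is the union of the <h>-translates of a geodesic [x, h x], where x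
   realizes L(h). *)
Definition translates_axis h gamma : Prop :=
  exists x sigma, [/\ mdist x (act h x) = min_displacement h,
    geodesic_segment sigma x (act h x)
    & gamma = \bigcup_(u in cyclic_subgroup h) (act u @` sigma)].

(* The 10delta-axis of g as a subset of X. *)
Definition axis delta g gamma : Prop :=
  (10 * delta <= min_displacement g /\ translates_axis g gamma) \/
  (min_displacement g < 10 * delta /\
   exists n : nat, [/\ (0 < n)%N, 10 * delta <= min_displacement (g ^+ n)%g
     & translates_axis (g ^+ n)%g gamma]).

Definition WPD_element delta D g : Prop :=
  hyperbolic_element g /\
  exists2 gamma, axis delta g gamma &
    forall eps, 0 < eps -> forall x y, gamma x -> gamma y ->
      D eps * translation_length g <= mdist x y ->
      let A := [set h | mdist (act h x) x <= eps /\ mdist (act h y) y <= eps] in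
      finite_set A /\ (#|` fset_set A|)%:R <= D eps.

End Actions.

Definition WPD_function (R : realType) (delta : R) (D : R -> R) : Prop :=
  [/\ forall eps, 0 < eps -> 0 < D eps,
      forall eps1 eps2, 0 < eps1 -> eps1 <= eps2 -> D eps1 <= D eps2
    & 50 <= D (100 * delta)].

(* Main.v *)
Require Import Defs.
From HB Require Import structures.
From mathcomp Require Import all_boot all_order all_algebra finmap.
From mathcomp Require Import ring lra zify.
From mathcomp Require Import all_classical all_reals all_analysis.

(* Let S range over the generating sets of growth rho. Uniformly in S, a ball S^c
   contains three elements A_i whose six directions diverge such that few elements
   almost fix both ends of A_i, at the scale of the displacement of the letters.
   Inserting a suitable A_i between two words gives
   |S^n|^2 <= C n |S^(2n+c)|, hence rho^n <= |S^n| <= C n rho^n. So |S| is bounded,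
   and infinitely many Aut(G)-orbits yield markings a_n of G by the free group on l
   letters with distinct kernels. Along an ultrafilter they have a limit kernel N;
   by the Noetherian property N is contained in ker a_n for almost all n, and
   strictly for some n_0. If ker a_n0 / N were finite, the preimage under a_n0 of a
   largest finite normal subgroup of G would map under some a_n to a larger one.
   So some relation u of a_n0 has, for almost all n, an image under a_n that moves
   the directions of the A_i, and a long periodic word f is built from u. Let
   x_i = p_i f p_i^-1, where p_i is a prefix of a geodesic word w of a_n0. The
   elements x_i x_j w equal w under a_n0, and under a_n they are distinct for about
   m^2 pairs (i, j), where m = |w|: a coincidence is a loop in the tree-like space
   in which some f is traced by another side. Thus |S_n^m| >= c m^2 rho^m, which
   contradicts the upper bound. *)

(** [WPD_element] controls the elements that almost fix a piece of one axis at a fixed scale,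
    whereas the letters of S may move every point arbitrarily far. The constants c and D of
    [separators] must not depend on S, so thinness is needed at the scale of the longest letter s.
    It is reached through an element h that contains s: whatever moves two distant points of the
    axis of h by at most the length of h nearly commutes with powers of h; a pigeonhole argument
    makes it commute with one of them, and a detour off the axis then forces its translation to be
    small. In the insertion step w is geodesic for a_n0, but its path under a_n may fold back on
    itself. What survives is a label: short relations of a_n are relations of a_n0, so an element
    given by a short word under a_n has a well-defined image under a_n0, which names the position of
    w that it belongs to. Each chord from 1 to a vertex of w may trace about |w| translates of f,
    yet all chords together trace only O(|w|) of them ([chord_hull]). Hence most positions meet few
    such traces, and only these are used. *)

Set Implicit Arguments.
Unset Strict Implicit.
Unset Printing Implicit Defensive.

Import Order.TTheory GRing.Theory Num.Theory.
Import numFieldNormedType.Exports.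

Local Open Scope classical_set_scope.
Local Open Scope ring_scope.

(** * Gromov products *)

Section HypDist.
Context {R : realType} {T : Type}.

(** Distinct points may have distance 0, because the main instances are distances of a space pulled
    back to the group along an orbit map. [hd4] says that the two largest of the three sums of
    opposite distances differ by at most 2 dl. *)
Record hyp_dist (dl : R) (d : T -> T -> R) : Prop := HypDist {
  hd0 : forall x, d x x = 0;
  hdC : forall x y, d x y = d y x;
  hdT : forall x y z, d x z <= d x y + d y z;
  hd4 : forall a b c e, d a b + d c e <= d a c + d b e + 2 * dl \/
                        d a b + d c e <= d a e + d b c + 2 * dl }.

Definition gp (d : T -> T -> R) (w x y : T) : R := (d w x + d w y - d x y) / 2.

End HypDist.

(* Puts the symmetry equations of the six pairs among four points in context. *)
Ltac dsym4 H a b c e :=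
  let E := fresh in have E := hdC H a b; let E := fresh in have E := hdC H a c;
  let E := fresh in have E := hdC H a e; let E := fresh in have E := hdC H b c;
  let E := fresh in have E := hdC H b e; let E := fresh in have E := hdC H c e.
Ltac dsym3 H a b c :=
  let E := fresh in have E := hdC H a b; let E := fresh in have E := hdC H a c;
  let E := fresh in have E := hdC H b c.
Ltac dtri3 H a b c :=
  dsym3 H a b c;
  let E := fresh in have E := hdT H a b c; let E := fresh in have E := hdT H b c a;
  let E := fresh in have E := hdT H c a b.

Section HypDistTheory.
Context {R : realType} {T : Type} {dl : R} {d : T -> T -> R}.
Hypothesis H : hyp_dist dl d.
Local Notation gp := (gp d).

Lemma hd_ge0 x y : 0 <= d x y.
Proof. have := hdT H x y x; rewrite (hd0 H) (hdC H y x); lra. Qed.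

Lemma dl_ge0 (x : T) : 0 <= dl.
Proof. have := hd4 H x x x x; rewrite !(hd0 H); case; lra. Qed.

Lemma gpC w x y : gp w x y = gp w y x.
Proof. rewrite /gp (hdC H x y); lra. Qed.

Lemma gp_ge0 w x y : 0 <= gp w x y.
Proof. dtri3 H w x y; rewrite /gp; lra. Qed.

Lemma gp_lel w x y : gp w x y <= d w x.
Proof. dtri3 H w x y; rewrite /gp; lra. Qed.

Lemma gp_ler w x y : gp w x y <= d w y.
Proof. dtri3 H w x y; rewrite /gp; lra. Qed.

Lemma gpxx w x : gp w x x = d w x.
Proof. rewrite /gp (hd0 H); lra. Qed.

Lemma gp_base w y : gp w w y = 0.
Proof. rewrite /gp (hd0 H); lra. Qed.

Lemma gpK w x y : gp w x y + gp x w y = d w x.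
Proof. dsym3 H w x y; rewrite /gp; lra. Qed.

Lemma gpKr w x y : gp w x y + gp y w x = d w y.
Proof. dsym3 H w x y; rewrite /gp; lra. Qed.

Lemma gp_or w x y z : gp w x y <= gp w x z + dl \/ gp w y z <= gp w x z + dl.
Proof.
rewrite /gp; case: (hd4 H w y x z) => h; dsym4 H w x y z; [right|left]; lra.
Qed.

Lemma gp_lip w w' x z : gp w x z <= gp w' x z + d w w'.
Proof. rewrite /gp; dtri3 H w w' x; dtri3 H w w' z; lra. Qed.

(** The long edge from y to z excludes one alternative of the four-point condition: the two small
    turns cannot fold onto each other. This is the basic passage from local to global estimates. *)
Lemma local_geodesic x y z w a a' : gp y x z <= a -> gp z y w <= a' -> a + a' + dl < d y z ->
  gp y x w <= a + dl /\ gp z x w <= a' + dl.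
Proof.
rewrite /gp => h1 h2 h3; dsym4 H x y z w.
case: (hd4 H x z y w) => h; split; lra.
Qed.

(** Points close to the segment from P to Q are located by their distance to P alone. *)
Lemma line_dist P Q z w r : gp z P Q <= r -> gp w P Q <= r ->
  d z w <= `|d P z - d P w| + 2 * r + 2 * dl.
Proof.
rewrite /gp => h1 h2.
have h3 := ler_norm (d P z - d P w); have := ler_norm (- (d P z - d P w)).
rewrite normrN => h4; dsym4 H P Q z w.
by case: (hd4 H z w P Q) => h; lra.
Qed.

(** Since z and w share more than r seen from P, the sum d P P' + d z w is smaller than the other
    two sums of opposite distances, which therefore agree up to 2 dl. With P' a translate of P, this
    compares the shifts caused by a group element at z and at w. *)
Lemma busemann P P' z w r : d P P' <= r -> r < gp P z w ->
  `|(d P z - d P' z) - (d P w - d P' w)| <= 2 * dl.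
Proof.
rewrite /gp => h1 h2; dsym4 H P P' z w; dtri3 H P P' w; dtri3 H P P' z.
rewrite ler_norml; apply/andP; split.
  by case: (hd4 H P' z P w) => h; lra.
by case: (hd4 H P z P' w) => h; lra.
Qed.

End HypDistTheory.

Section GroupDist.
Context {R : realType} {G : groupType} {dl : R} {d : G -> G -> R}.
Hypothesis H : hyp_dist dl d.
Hypothesis dM : forall t g h, d (t * g)%g (t * h)%g = d g h.
Local Notation gp := (gp d).
Local Notation e := (1%g : G).

Lemma gpM t w x y : gp (t * w)%g (t * x)%g (t * y)%g = gp w x y.
Proof. by rewrite /gp !dM. Qed.

Lemma dist_mulr x y : d x (x * y)%g = d e y.
Proof. by rewrite -{1}[x]mulg1 dM. Qed.

Lemma dVl g h : d e (g^-1 * h)%g = d g h.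
Proof. by rewrite -(dM g) mulg1 mulVKg. Qed.

Lemma dV g : d e g^-1%g = d e g.
Proof. by rewrite -(dM g) mulg1 mulgV (hdC H). Qed.

Lemma gp_at g x y : gp g x y = gp e (g^-1 * x)%g (g^-1 * y)%g.
Proof. by rewrite -(gpM g^-1) mulVg. Qed.

Lemma gp_at1 g y : gp g e (g * y)%g = gp e g^-1%g y.
Proof. by rewrite gp_at mulg1 mulKg. Qed.

Section Chains.
Context (a : R).
Implicit Types us vs : seq G.
Definition chain us : bool := sorted (fun u v => gp e u^-1%g v <= a) us.
(** The threshold is what [local_geodesic] needs in [chain_cat], where both turns are only known up
    to a + dl. *)
Definition long us : bool := all (fun u => 2 * a + 3 * dl < d e u) us.
Local Notation prd us := (\prod_(u <- us) u)%g.

Lemma chain_left u us : chain (u :: us) -> long us -> 0 <= a ->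
  gp e u^-1%g (prd us) <= a + dl.
Proof.
move=> + + a0; have dl0 := dl_ge0 H e.
elim: us u => [|v us IH] u /=; first by rewrite big_nil (gpC H) (gp_base H); lra.
case/andP=> huv hv /andP[lv lus]; rewrite big_cons.
have /(_ v hv lus) h := IH.
have h' : gp v e (v * prd us)%g <= a + dl by rewrite gp_at1.
have [] // := local_geodesic H huv h'; lra.
Qed.

Lemma chain_right v us : chain (rcons us v) -> long us -> 0 <= a ->
  gp e (prd us)^-1%g v <= a + dl.
Proof.
move=> + + a0; have dl0 := dl_ge0 H e.
elim/last_ind: us v => [|us u IH] v.
  by rewrite big_nil invg1 (gp_base H); lra.
rewrite /chain /long -!cats1 -catA /= all_cat /= andbT => hc /andP[lus lu].
have [hc1 huv] : chain (rcons us u) /\ gp e u^-1%g v <= a.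
  case: us hc {IH lus} => [|w us] /=; first by case/andP.
  rewrite !cat_path /= => /and4P[h1 h2 h3 _].
  by rewrite /chain /= -cats1 cat_path /= h1 h2 h3.
have h := IH _ hc1 lus.
rewrite big_cat big_seq1 /=.
have h' : gp u^-1%g (prd us * u)^-1%g e <= a + dl.
  by rewrite gp_at invgK mulg1 invgM mulVKg.
have [] := local_geodesic H h' huv; first by rewrite -(dV u) (hdC H) in lu; lra.
by move=> _; rewrite (gpC H).
Qed.

Lemma chain_cat us vs : chain (us ++ vs) -> long (us ++ vs) -> 0 <= a ->
  gp e (prd us)^-1%g (prd vs) <= a + 2 * dl.
Proof.
move=> + + a0; have dl0 := dl_ge0 H e.
case: vs => [|v vs]; first by rewrite big_nil (gpC H) (gp_base H); lra.
rewrite /long all_cat /= => hc /and3P[lus lv lvs].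
have h1 : gp e (prd us)^-1%g v <= a + dl.
  apply: chain_right => //; move: hc; rewrite /chain -cat_rcons.
  by case/cat_sorted2.
have h2 : gp e v^-1%g (prd vs) <= a + dl.
  by apply: chain_left => //; move: hc; rewrite /chain; case/cat_sorted2.
rewrite big_cons.
have h2' : gp v e (v * prd vs)%g <= a + dl by rewrite gp_at1.
have [] := local_geodesic H h1 h2'; lra.
Qed.

End Chains.

Lemma expg_prod (f : G) k : (f ^+ k)%g = (\prod_(u <- nseq k f) u)%g.
Proof. by elim: k => [|k IH]; rewrite ?big_nil // expgS IH big_cons. Qed.

Lemma gp_pow a f m n : gp e f^-1%g f <= a -> 2 * a + 3 * dl < d e f ->
  gp e (f ^- m)%g (f ^+ n)%g <= a + 2 * dl.
Proof.
move=> h1 h2; have a0 : 0 <= a by apply: le_trans h1; exact: gp_ge0 H _ _ _.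
rewrite !expg_prod; apply: chain_cat => //; rewrite -nseqD.
  by case: (m + n)%N => //= k; rewrite /chain /=; elim: k => //= k ->; rewrite h1.
by rewrite /long all_nseq h2 orbT.
Qed.

Lemma pow_dist_le f n : d e (f ^+ n)%g <= n%:R * d e f.
Proof.
elim: n => [|n IH]; first by rewrite mul0r expg0 (hd0 H).
have := hdT H e f (f ^+ n.+1)%g; rewrite expgS dist_mulr.
by rewrite -natr1 mulrDl mul1r; move: IH; lra.
Qed.

Section Powers.
Context {a : R} {f : G}.
Hypothesis fa : forall m n, gp e (f ^- m)%g (f ^+ n)%g <= a.

Lemma pow_mid i n : (i <= n)%N -> gp (f ^+ i)%g e (f ^+ n)%g <= a.
Proof.
move=> hi; rewrite gp_at mulg1.
have -> : ((f ^+ i)^-1 * f ^+ n = f ^+ (n - i))%g.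
  by rewrite -{1}(subnKC hi) expgnDr mulKg.
exact: fa.
Qed.

Lemma pow_len r n : r + 2 * a <= d e f -> n%:R * r <= d e (f ^+ n)%g.
Proof.
move=> hr; elim: n => [|n IH]; first by rewrite mul0r (hd_ge0 H).
have := pow_mid (leqnSn n); rewrite /gp (hdC H _ e) expgSr dist_mulr.
have -> : n.+1%:R * r = n%:R * r + r by rewrite -[n.+1%:R]natr1 mulrDl mul1r.
by move: IH; lra.
Qed.

Lemma pow_far r x : 1 <= r -> r + 2 * a <= d e f ->
  exists K, forall n, (K <= n)%N -> x < d e (f ^+ n)%g.
Proof.
move=> r1 hr; exists (Num.trunc `|x|).+1 => n hn; apply: (lt_le_trans _ (pow_len n hr)).
have /andP[_ h1] := truncn_itv (normr_ge0 x); have h2 := ler_norm x.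
move: hn; rewrite -(ler_nat R) => h3.
have : n%:R <= n%:R * r by rewrite ler_peMr // ler0n.
by move: h1 h2 h3; lra.
Qed.

End Powers.

End GroupDist.

(** * Counting with duplicate-free lists *)

Section AtMost.
Implicit Types (A B : eqType).

(** In this form a bound can be transported along maps before the set is known to be finite. *)
Definition atmost A (n : nat) (P : A -> Prop) : Prop :=
  forall l : seq A, uniq l -> (forall x, x \in l -> P x) -> (size l <= n)%N.

Lemma atmost_sub A n m (P Q : A -> Prop) : (n <= m)%N ->
  (forall x, P x -> Q x) -> atmost n Q -> atmost m P.
Proof. by move=> nm PQ HQ l ul Pl; apply: leq_trans nm; apply: HQ => // x /Pl/PQ. Qed.

Lemma atmost_fiber A B k m (P : A -> Prop) (Q : B -> Prop) (f : A -> B) :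
  (forall x, P x -> Q (f x)) -> atmost m Q ->
  (forall b, atmost k (fun x => P x /\ f x = b)) -> atmost (k * m) P.
Proof.
move=> PQ HQ Hk l ul Pl.
have hs : (size (undup (map f l)) <= m)%N.
  apply: HQ; first exact: undup_uniq.
  by move=> b; rewrite mem_undup => /mapP[x xl ->]; apply/PQ/Pl.
apply: (@leq_trans (k * size (undup (map f l)))%N); last by rewrite leq_mul2l hs orbT.
have : forall x, x \in l -> f x \in undup (map f l).
  by move=> x xl; rewrite mem_undup map_f.
move: (undup (map f l)) {hs} => s; elim: s l ul Pl => [|b s IH] l ul Pl sl.
  by case: l ul Pl sl => // x l _ _ /(_ x); rewrite mem_head => /(_ isT).
rewrite -(count_predC (fun x => f x == b)) mulnS leq_add //.
  rewrite -size_filter; apply: (Hk b); first exact: filter_uniq.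
  by move=> x; rewrite mem_filter => /andP[/= /eqP fx /Pl Px].
rewrite -size_filter; apply: IH; first exact: filter_uniq.
  by move=> x; rewrite mem_filter => /andP[_ /Pl].
move=> x; rewrite mem_filter => /andP[/= fxb /sl].
by rewrite inE (negPf fxb).
Qed.

Lemma atmost_inj A B m (P : A -> Prop) (Q : B -> Prop) (f : A -> B) :
  (forall x, P x -> Q (f x)) -> (forall x y, P x -> P y -> f x = f y -> x = y) ->
  atmost m Q -> atmost m P.
Proof.
move=> PQ fi HQ l ul Pl; rewrite -(size_map f); apply: HQ.
  by rewrite map_inj_in_uniq // => x y /Pl Px /Pl Py; apply: fi.
by move=> _ /mapP[x /Pl/PQ ? ->].
Qed.

Lemma atmost_seq A (s : seq A) : atmost (size s) (fun x => x \in s).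
Proof. by move=> l ul ls; apply: uniq_leq_size. Qed.

Lemma atmost_lt n : atmost n (fun i => i < n)%N.
Proof.
move=> l ul ln; rewrite -(size_iota 0 n); apply: uniq_leq_size => // x /ln.
by rewrite mem_iota.
Qed.

Lemma atmost_or A n m (P Q : A -> Prop) : atmost n P -> atmost m Q ->
  atmost (n + m) (fun x => P x \/ Q x).
Proof.
move=> HP HQ l ul Pl; rewrite -(count_predC (fun x => `[< P x >])) leq_add //.
  rewrite -size_filter; apply: HP; first exact: filter_uniq.
  by move=> x; rewrite mem_filter => /andP[/asboolP].
rewrite -size_filter; apply: HQ; first exact: filter_uniq.
move=> x; rewrite mem_filter => /andP[/= nP /Pl[] //].
by move=> /asboolP; rewrite (negPf nP).
Qed.

End AtMost.

Section AtMostFinite.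
Variable (T : choiceType).

Lemma finite_enum (A : set T) : finite_set A -> exists l : seq T,
  [/\ uniq l, forall x, A x <-> x \in l & size l = #|` fset_set A|].
Proof.
move=> fA; exists (fset_set A); split; first exact: fset_uniq.
  by move=> x; rewrite in_fset_set // inE.
by [].
Qed.

Lemma finite_atmost (A : set T) : finite_set A -> atmost #|` fset_set A| A.
Proof.
move=> /finite_enum[l [ul lA <-]].
by apply: atmost_sub (leqnn _) _ (@atmost_seq _ l) => x /lA.
Qed.

Lemma atmost_finite n (A : set T) : atmost n A ->
  finite_set A /\ (#|` fset_set A| <= n)%N.
Proof.
move=> h; suff fA : finite_set A.
  by split=> //; have [l [ul lA <-]] := finite_enum fA; apply: h => // x /lA.
have [l [ul lA lmax]] : exists l, [/\ uniq l, forall x, x \in l -> A x &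
    forall x, A x -> x \in l].
  pose Q k := `[< exists l, [/\ uniq l, (forall x, x \in l -> A x) & size l = k] >].
  have exQ : exists k, Q k by exists 0%N; apply/asboolP; exists [::].
  have ub k : Q k -> (k <= n)%N by move=> /asboolP[l [ul lA <-]]; exact: h.
  case: (ex_maxnP exQ ub) => k /asboolP[l [ul lA lk]] kmax.
  exists l; split=> // x Ax; apply: contraT => xl.
  have : Q k.+1.
    apply/asboolP; exists (x :: l); split => /=; [by rewrite xl| |by rewrite lk].
    by move=> y; rewrite inE => /predU1P[->|/lA].
  by move=> /kmax; rewrite ltnn.
apply/finite_seqP; exists l; apply/seteqP; split => x /=; [exact: lmax|exact: lA].
Qed.

End AtMostFinite.

(** * Segments followed by a geodesic *)

Section Traces.
Context {R : realType} {G : groupType} {d : G -> G -> R}.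
Local Notation gp := (gp d).
Local Notation e := (1%g : G).

Definition thin (D : nat) (th : R) (f : G) : Prop :=
  atmost D (fun t => d e t <= th /\ d f (t * f)%g <= th).

(* The segment from q to q f is followed by a geodesic from x to y. *)
Definition traced (r : R) (f x y q : G) : Prop :=
  gp q x (q * f)%g <= r /\ gp (q * f)%g q y <= r.

Hypothesis dM : forall t g h, d (t * g)%g (t * h)%g = d g h.

Lemma tracedM r f x y q t :
  traced r f (t * x)%g (t * y)%g (t * q)%g <-> traced r f x y q.
Proof. by rewrite /traced -!mulgA !gpM. Qed.

Section General.
Context {dl : R}.
Hypothesis H : hyp_dist dl d.

Lemma traced_line r f x y q : traced r f x y q -> 2 * r + dl < d e f ->
  gp q x y <= r + dl /\ gp (q * f)%g x y <= r + dl.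
Proof.
move=> [h1 h2] h3; apply: local_geodesic H _ _ _ _ _ _ h1 h2 _.
by rewrite -(dM q) mulg1 in h3; lra.
Qed.

(** Both segments lie along the geodesic from x to y, so [line_dist] applies at their two ends. The
    second bound is weaker because the distance from x to q f is known from that to q only up to 2
    r. *)
Lemma traced_close r f x y q1 q2 : traced r f x y q1 -> traced r f x y q2 ->
  2 * r + dl < d e f ->
  d q1 q2 <= `|d x q1 - d x q2| + 2 * r + 4 * dl /\
  d (q1 * f)%g (q2 * f)%g <= `|d x q1 - d x q2| + 4 * r + 4 * dl.
Proof.
move=> t1 t2 h.
have [a1 b1] := traced_line t1 h; have [a2 b2] := traced_line t2 h.
have := line_dist H a1 a2; have := line_dist H b1 b2.
have f1 : d q1 (q1 * f)%g = d e f by rewrite -{1}[q1]mulg1 dM.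
have f2 : d q2 (q2 * f)%g = d e f by rewrite -{1}[q2]mulg1 dM.
move: t1 t2 => [+ _] [+ _].
have := gp_ge0 H q1 x (q1 * f)%g; have := gp_ge0 H q2 x (q2 * f)%g.
rewrite /gp f1 f2 (hdC H q1 x) (hdC H q2 x) => g1 g2 g3 g4.
have n1 := ler_norm (d x q1 - d x q2).
have n2 := ler_norm (- (d x q1 - d x q2)); rewrite normrN in n2.
move=> l1 l2; split; first lra.
apply: (le_trans l1).
suff : `|d x (q1 * f)%g - d x (q2 * f)%g| <= `|d x q1 - d x q2| + 2 * r by lra.
by rewrite ler_norml; apply/andP; split; lra.
Qed.

End General.

Hypothesis H : hyp_dist (1 / 1000) d.

(** Two traced positions at nearly the same distance from x differ by an element that almost fixes 1
    and f, and [thin] counts these. The bucket width 1/2 plus the errors of [traced_close] stays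
    below 9/10. *)
Lemma traced_bucket D f r x y b : thin D (9 / 10) f -> r <= 1 / 20 ->
  1 / 2 < d e f -> atmost D (fun q => traced r f x y q /\ Num.trunc (2 * d x q) = b).
Proof.
move=> thf hr lf.
have hl : 2 * r + 1 / 1000 < d e f by lra.
move=> l ul ql; case: l ul ql => [|q0 l] // ul ql.
have [t0 b0] := ql q0 (mem_head _ _).
rewrite -(size_map (fun q => q0^-1 * q)%g); apply: thf.
  by rewrite map_inj_uniq //; exact: mulgI.
move=> _ /mapP[q ql1 ->].
have [tq bq] := ql q ql1.
have e0 : 0 <= 2 * d x q0 by have := hd_ge0 H x q0; lra.
have e1 : 0 <= 2 * d x q by have := hd_ge0 H x q; lra.
have /andP[u0 v0] := truncn_itv e0; have /andP[u1 v1] := truncn_itv e1.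
have [] := traced_close H t0 tq hl.
have hh : `|d x q0 - d x q| <= 1 / 2.
  move: u0 v0 u1 v1; rewrite b0 bq -[b.+1%:R]natr1 => *.
  by rewrite ler_norml; apply/andP; split; lra.
by rewrite (dVl dM) -(dM q0 f) -mulgA mulVKg; split; lra.
Qed.

Lemma traced_count D f r x y n : thin D (9 / 10) f -> r <= 1 / 20 ->
  1 / 2 < d e f -> d x y <= n%:R -> atmost (D * (2 * n + 1)) (traced r f x y).
Proof.
move=> thf hr lf dn.
have hl : 2 * r + 1 / 1000 < d e f by lra.
apply: (@atmost_fiber _ _ _ _ _ (fun i => i < 2 * n + 1)%N
  (fun q => Num.trunc (2 * d x q))).
- move=> q tq; have [h _] := traced_line H tq hl.
  rewrite truncn_lt_nat; last by have := hd_ge0 H x q; lra.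
  rewrite natrD natrM; move: h; rewrite /gp (hdC H q x).
  by have := hdT H x y q; have := hd_ge0 H x q; have := hd_ge0 H q y; rewrite (hdC H y q); lra.
- exact: atmost_lt.
by move=> b; exact: traced_bucket.
Qed.

End Traces.

(** * Growth of balls and separating elements *)

Section Balls.
Context {G : groupType}.
Implicit Types (S : set G) (g h : G).

Lemma word_ball1 S n : word_ball S n 1%g.
Proof. by exists [::]; split=> //; rewrite big_nil. Qed.

Lemma word_ball_gen S g : S g -> word_ball S 1 g.
Proof.
by move=> Sg; exists [:: g]; rewrite big_seq1; split=> // s; rewrite inE => /eqP->.
Qed.

Lemma word_ballW S m n g : (m <= n)%N -> word_ball S m g -> word_ball S n g.
Proof. by move=> mn [w [sw Sw ->]]; exists w; split=> //; exact: leq_trans mn. Qed.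

Lemma word_ballM S m n g h : word_ball S m g -> word_ball S n h ->
  word_ball S (m + n) (g * h)%g.
Proof.
move=> [v [sv Sv ->]] [w [sw Sw ->]]; exists (v ++ w); split.
- by rewrite size_cat leq_add.
- by move=> s; rewrite mem_cat => /orP[/Sv|/Sw].
- by rewrite big_cat.
Qed.

Lemma word_ballX S n k g : word_ball S n g -> word_ball S (k * n) (g ^+ k)%g.
Proof.
move=> Sg; elim: k => [|k IH]; first exact: word_ball1.
by rewrite mulSn expgS; exact: word_ballM.
Qed.

Lemma word_ballS S n g : word_ball S n.+1 g ->
  g = 1%g \/ exists s h, [/\ S s, word_ball S n h & g = (s * h)%g].
Proof.
move=> [[|s w] [sw Sw ->]]; first by left; rewrite big_nil.
right; exists s, (\prod_(s <- w) s)%g; split; last by rewrite big_cons.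
  by apply: Sw; rewrite mem_head.
by exists w; split=> // x xw; apply: Sw; rewrite inE xw orbT.
Qed.

Lemma word_ball_finite S n : finite_set S -> finite_set (word_ball S n).
Proof.
move=> fS; elim: n => [|n IH].
  apply: sub_finite_set (finite_set1 1%g) => g [[|s w] [//= _ _ ->]].
  by rewrite big_nil.
pose f (p : G * G) := (p.1 * p.2)%g.
apply: (@sub_finite_set _ _ ([set 1%g] `|` (f @` (S `*` word_ball S n)))).
  move=> g /word_ballS[->|[s [h [Ss Bh ->]]]]; first by left.
  by right; exists (s, h).
by rewrite finite_setU; split; [exact: finite_set1|apply/finite_image/finite_setX].
Qed.

Definition ball_size S n : nat := #|` fset_set (word_ball S n)|.

Lemma ball_size_gt0 S n : finite_set S -> (0 < ball_size S n)%N.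
Proof.
move=> /(word_ball_finite n) fB; rewrite /ball_size cardfs_gt0.
by apply/fset0Pn; exists 1%g; rewrite in_fset_set // inE; exact: word_ball1.
Qed.

Lemma ball_sizeD S m n : finite_set S ->
  (ball_size S (m + n) <= ball_size S m * ball_size S n)%N.
Proof.
move=> fS; rewrite mulnC; apply: (atmost_finite _).2.
have split_word g : word_ball S (m + n) g -> exists p : G * G,
    [/\ word_ball S m p.1, word_ball S n p.2 & g = (p.1 * p.2)%g].
  move=> [w [sw Sw ->]].
  exists (\prod_(s <- take m w) s, \prod_(s <- drop m w) s)%g; split=> /=.
  - exists (take m w); split=> //; last by move=> s /mem_take/Sw.
    by rewrite size_take_min geq_minl.
  - exists (drop m w); split=> //; last by move=> s /mem_drop/Sw.
    by rewrite size_drop leq_subLR.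
  - by rewrite -big_cat cat_take_drop.
have /choice[f fP] : forall g, exists p : G * G, word_ball S (m + n) g ->
    [/\ word_ball S m p.1, word_ball S n p.2 & g = (p.1 * p.2)%g].
  move=> g; have [/split_word[p hp]|nB] := pselect (word_ball S (m + n) g).
    by exists p.
  by exists (1, 1)%g.
apply: (@atmost_fiber _ _ _ _ _ _ (fun g => (f g).1) _
  (finite_atmost (word_ball_finite m fS))) => [g /fP[]//|b].
apply: (@atmost_inj _ _ _ _ _ (fun g => (f g).2) _ _
  (finite_atmost (word_ball_finite n fS))) => [g [/fP[]]//|g h].
by move=> [/fP[_ _ eg] gb] [/fP[_ _ eh] hb] fgh; rewrite [LHS]eg [RHS]eh gb hb fgh.
Qed.

End Balls.

Section Growth.
Context {R : realType} {G : groupType}.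
Implicit Types (S : set G).
Local Notation la S n := (ln (ball_size S n)%:R : R).

Lemma ln_ball_ge0 S n : finite_set S -> 0 <= la S n.
Proof. by move=> fS; rewrite ln_ge0 // ler1n ball_size_gt0. Qed.

Lemma ln_ballD S m n : finite_set S -> la S (m + n) <= la S m + la S n.
Proof.
move=> fS; rewrite -lnM ?posrE ?ltr0n ?ball_size_gt0 // -natrM.
by rewrite ler_ln ?posrE ?ltr0n ?muln_gt0 ?ball_size_gt0 // ler_nat ball_sizeD.
Qed.

(** Fekete's lemma with the infimum of b n / n as limit. The infimum gives the lower bound for every
    n without an error term, which the later comparison with C n rho^n relies on. *)
Lemma fekete (b : nat -> R) : (forall n, 0 <= b n) ->
  (forall m n, b (m + n)%N <= b m + b n) -> exists be : R, [/\ 0 <= be,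
  forall n, n%:R * be <= b n &
  forall eps, 0 < eps -> exists N : nat, forall n, (N <= n)%N -> b n <= n%:R * (be + eps)].
Proof.
move=> b0 bD; pose E := [set b n.+1 / n.+1%:R | n in setT].
have lbE : lbound E 0 by move=> _ [n _ <-]; rewrite divr_ge0 ?b0.
have hE : has_inf E by split; [exists (b 1%N / 1%:R); exists 0%N|exists 0].
have bM k m : b (k * m)%N <= k%:R * b m + b 0%N.
  elim: k => [|k IH]; first by rewrite mul0n mul0r add0r.
  rewrite mulSn -[in leRHS]addn1 natrD mulrDl mul1r.
  by have := bD m (k * m)%N; lra.
exists (inf E); split.
- by apply: lb_le_inf => //; exact: hE.1.
- move=> [|n]; first by rewrite mul0r.
  rewrite mulrC -ler_pdivlMr ?ltr0n //.
  by apply: ge_inf; [exact: hE.2|exists n].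
move=> eps e0; have [_ [n _ <-] hn] := inf_adherent (divr_gt0 e0 (ltr0n _ 2)) hE.
set m := n.+1 in hn; pose B := b 0%N + \sum_(r < m) b r.
have B0 : 0 <= B by rewrite addr_ge0 // sumr_ge0.
have hr r : (r < m)%N -> b r <= \sum_(r < m) b r.
  move=> rm; rewrite (bigD1 (Ordinal rm)) //= lerDl sumr_ge0 //.
exists (Num.trunc (B / (eps / 2))).+1 => N hN.
have m0 : 0 < m%:R :> R by rewrite ltr0n.
have h1 : b N <= (N %/ m)%:R * b m + B.
  rewrite {1}(divn_eq N m); apply: (le_trans (bD _ _)).
  have := bM (N %/ m)%N m; have := hr _ (ltn_pmod N (ltn0Sn n)); rewrite /B; lra.
have h2 : (N %/ m)%:R * m%:R <= N%:R :> R by rewrite -natrM ler_nat leq_trunc_div.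
have h3 : b m <= m%:R * (inf E + eps / 2).
  by rewrite mulrC -ler_pdivrMr // ltW.
have h4 : B <= N%:R * (eps / 2).
  rewrite -ler_pdivrMr; last lra.
  apply: ltW; apply: lt_le_trans (truncnS_gt _) _; by rewrite ler_nat.
have h5 : 0 <= inf E + eps / 2 by have := lb_le_inf hE.1 lbE; lra.
have h6 := ler_wpM2l (ler0n R (N %/ m)) h3.
have h7 := ler_wpM2r h5 h2.
rewrite mulrA in h6; lra.
Qed.

Lemma growth_rate_spec S : finite_set S -> exists be : R, [/\ 0 <= be,
  growth_rate R S = expR be, forall n, n%:R * be <= la S n &
  forall eps, 0 < eps -> exists N : nat, forall n, (N <= n)%N ->
    la S n <= n%:R * (be + eps)].
Proof.
move=> fS; have [be [be0 lb ub]] :=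
  fekete (fun n => ln_ball_ge0 n fS) (fun m n => ln_ballD m n fS).
exists be; split=> //; rewrite /growth_rate; apply/cvg_lim => //.
have hc : (fun n : nat => la S n / n%:R) @ \oo --> be.
  apply/cvgrPdist_le => eps e0; have [N hN] := ub _ e0.
  near=> n; have n0 : (0 < n)%N by near: n; exists 1%N.
  have n0' : 0 < n%:R :> R by rewrite ltr0n.
  have h1 := lb n; have /hN h2 : (N <= n)%N by near: n; exists N.
  have h3 : be <= la S n / n%:R by rewrite ler_pdivlMr // mulrC.
  have h4 : la S n / n%:R <= be + eps by rewrite ler_pdivrMr // mulrC.
  by rewrite ler_norml; apply/andP; split; lra.
have hh := continuous_cvg _ (@continuous_expR R be) hc.
refine (cvg_trans _ (hh _)); apply: near_eq_cvg; near=> n.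
rewrite /powR pnatr_eq0 -/(ball_size S n) gtn_eqF ?ball_size_gt0 //=.
by rewrite mulrC.
Unshelve. all: by end_near.
Qed.

End Growth.

Section Separators.
Context {R : realType} {G : groupType}.
Implicit Types (S : set G).
Local Notation e := (1%g : G).

Definition signed_direction (A : 'I_3 -> G) (x : 'I_3 * bool) : G :=
  if x.2 then A x.1 else (A x.1)^-1%g.

(* After rescaling, the letters of S move the base point by at most 1, while
   the hyperbolicity constant is at most 1/1000. *)
Record separators (c D : nat) S (d : G -> G -> R) (A : 'I_3 -> G) : Prop :=
  Separators {
  sep_hyp : hyp_dist (1 / 1000) d;
  sep_inv : forall t g h, d (t * g)%g (t * h)%g = d g h;
  sep_gen : forall s, S s -> d e s <= 1;
  sep_ball : forall i, word_ball S c (A i);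
  sep_long : forall i, 1 <= d e (A i);
  sep_gp : forall x y, x != y -> gp d e (signed_direction A x) (signed_direction A y) <= 1 / 1000;
  sep_thin : forall i, thin (d := d) D 1 (A i) }.

Arguments sep_thin {c D S d A} _ i _ _ _.
Context {c D : nat} {S : set G} {d : G -> G -> R} {A : 'I_3 -> G}.
Hypothesis sep : separators c D S d A.
Local Notation gp := (gp d).
Let H := sep_hyp sep.
Let dM := sep_inv sep.

Lemma sep_word n g : word_ball S n g -> d e g <= n%:R.
Proof.
move=> [w [sw Sw ->]]; apply: (@le_trans _ _ (size w)%:R); last by rewrite ler_nat.
elim: w {sw} Sw => [|s w IH] Sw; first by rewrite big_nil (hd0 H).
rewrite big_cons [size _]/= -add1n natrD.
have h1 : d e s <= 1 by apply/(sep_gen sep)/Sw; rewrite mem_head.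
have h2 : d e (\prod_(j <- w) j)%g <= (size w)%:R.
  by apply: IH => x xw; apply: Sw; rewrite inE xw orbT.
have := hdT H e s (s * \prod_(j <- w) j)%g.
have -> : d s (s * \prod_(j <- w) j)%g = d e (\prod_(j <- w) j)%g.
  by rewrite -{1}[s]mulg1 dM.
by move=> h3; apply: le_trans h3 _; apply: lerD.
Qed.

(** The reason for taking three elements: each of the two ends rules out at most one index. *)
Lemma ord3_avoid (P Q : pred 'I_3) :
  (forall i j, P i -> P j -> i = j) -> (forall i j, Q i -> Q j -> i = j) ->
  exists i, ~~ P i && ~~ Q i.
Proof.
move=> hP hQ; apply/existsP; apply: contraT; rewrite negb_exists => /forallP h.
have hPQ k : P k \/ Q k by have := h k; rewrite negb_and !negbK => /orP.
have [] : [/\ inord 0 <> inord 1 :> 'I_3, inord 0 <> inord 2 :> 'I_3 &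
  inord 1 <> inord 2 :> 'I_3].
  by split=> /(congr1 val); rewrite /= !inordK.
have [p0|q0] := hPQ (inord 0); have [p1|q1] := hPQ (inord 1);
  have [p2|q2] := hPQ (inord 2) => n01 n02 n12;
  by [case: n01; exact: hP|case: n02; exact: hP|case: n12; exact: hP|
      case: n01; exact: hQ|case: n02; exact: hQ|case: n12; exact: hQ].
Qed.

Lemma sep_dir z (b : bool) i j : 1 / 500 < gp e z (signed_direction A (i, b)) ->
  1 / 500 < gp e z (signed_direction A (j, b)) -> i = j.
Proof.
move=> hi hj; apply: contraTeq hi => ij; rewrite -leNgt.
have hij : gp e (signed_direction A (i, b)) (signed_direction A (j, b)) <= 1 / 1000.
  by apply: (sep_gp sep); apply: contra ij => /eqP[->].
by case: (gp_or H e (signed_direction A (i, b)) z (signed_direction A (j, b))); rewrite ?(gpC H e _ z); lra.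
Qed.

Lemma sep_avoid z z' : exists i,
  gp e z (A i) <= 1 / 500 /\ gp e (A i)^-1%g z' <= 1 / 500.
Proof.
have [i /andP[h1 h2]] := @ord3_avoid (fun i => 1 / 500 < gp e z (signed_direction A (i, true)))
  (fun i => 1 / 500 < gp e z' (signed_direction A (i, false)))
  (fun i j => @sep_dir z true i j) (fun i j => @sep_dir z' false i j).
exists i; rewrite -leNgt in h1; rewrite -leNgt in h2; split=> //.
by rewrite (gpC H).
Qed.

Lemma thinW th th' D' f : th <= th' -> thin (d := d) D' th' f -> thin (d := d) D' th f.
Proof.
move=> hth; apply: atmost_sub (leqnn _) _ => t [h1 h2].
by split; apply: le_trans hth.
Qed.

(** Between g and h insert an A_i that neither cancels into g nor into h. For a given i and a given
    product, g is a position at which the geodesic from 1 to the product traces A_i, and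
    [traced_count] bounds the number of these positions linearly in n. *)
Lemma ball_square n : finite_set S ->
  (ball_size S n ^ 2 <=
   D * (2 * (2 * n + c) + 1) * 3 * ball_size S (2 * n + c))%N.
Proof.
move=> fS.
have [l [ul lB ls]] := finite_enum (word_ball_finite n fS).
rewrite {1}/ball_size -ls.
have /choice[i iP] : forall p : G * G, exists i,
    gp e p.1^-1%g (A i) <= 1 / 500 /\ gp e (A i)^-1%g p.2 <= 1 / 500.
  by move=> p; exact: sep_avoid.
pose f p := (p.1 * A (i p) * p.2)%g.
suff key : atmost (D * (2 * (2 * n + c) + 1) * (3 * ball_size S (2 * n + c)))
    (fun p : G * G => word_ball S n p.1 /\ word_ball S n p.2).
  rewrite -mulnA -mulnn.
  suff -> : (size l * size l = size (allpairs pair l l))%N.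
    apply: key; first by apply: allpairs_uniq => // -[? ?] [? ?].
    by move=> _ /allpairsP[[g h] [/= gl hl ->]] /=; split; apply/lB.
  by rewrite size_allpairs.
apply: (@atmost_fiber _ _ _ _ _
  (fun q : 'I_3 * G => word_ball S (2 * n + c) q.2) (fun p => (i p, f p))).
- move=> [g h] [/= Bg Bh]; apply: (@word_ballW _ _ (n + c + n)); first lia.
  by apply: word_ballM => //; apply: word_ballM => //; exact: (sep_ball sep).
- rewrite [(3 * _)%N]mulnC.
  apply: (@atmost_fiber _ _ _ _ _ (fun i => i \in enum 'I_3) fst).
  + by move=> q _; rewrite mem_enum.
  + by have := @atmost_seq _ (enum 'I_3); rewrite size_enum_ord.
  move=> j; apply: (@atmost_inj _ _ _ _ _ snd _ _
    (finite_atmost (word_ball_finite (2 * n + c) fS))) => [q []//|].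
  by move=> [j1 x1] [j2 x2] [/= _ e1] [/= _ e2] /= e3; rewrite e1 e2 e3.
move=> [j x].
have [Bx|nB] := pselect (word_ball S (2 * n + c) x); last first.
  move=> [|p l'] // _ hp; case: nB.
  have [[Bg Bh] [_ <-]] := hp p (mem_head _ _).
  apply: (@word_ballW _ _ (n + c + n)); first lia.
  by apply: word_ballM => //; apply: word_ballM => //; exact: (sep_ball sep).
have th := @traced_count R G d dM H D (A j) (1 / 500) e x (2 * n + c) _ _ _ (sep_word Bx).
apply: (@atmost_inj _ _ _ _ _ fst _ _ (th _ _ _)).
- move=> p [_ [ij fp]]; have [h1 h2] := iP p; rewrite ij in h1 h2; split.
    by rewrite (gp_at1 dM).
  by rewrite -fp /f ij (gp_at dM) invgM -!mulgA mulVg mulg1 !mulKg.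
- move=> [g h] [g' h'] [_ [/= eij ef]] [_ [/= eij' ef']] eg; rewrite -{}eg in eij' ef' *.
  congr pair; move: ef; rewrite -ef' /f /= eij eij'.
  by move=> /mulgI.
- by apply: (thinW _ (sep_thin sep j)); lra.
- lra.
- have := sep_long sep j; lra.
Qed.

End Separators.
Arguments sep_thin {R G c D S d A} _ i _ _ _.

(** The substitution of 2 m + c for m doubles m + c, so k steps lead from n to 2^k (n + c) - c. The
    extra factor on the left absorbs the growth of C (m + c + 1) along the iteration and closes the
    induction. *)
Lemma square_iter (a : nat -> nat) (C c n k : nat) : (0 < C)%N ->
  (forall m, a m ^ 2 <= C * (m + c + 1) * a (2 * m + c))%N ->
  (a n ^ (2 ^ k) * (C * (n + c + 1) * 2 ^ k.+1) <=
   (2 * (C * (n + c + 1))) ^ (2 ^ k) * a (2 ^ k * (n + c) - c))%N.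
Proof.
move=> C0 ha; set X := (C * (n + c + 1))%N.
have X0 : (0 < X)%N by rewrite muln_gt0 C0 addn1.
elim: k => [|k IH]; first by rewrite expn0 !expn1 mul1n addnK; lia.
set r := (2 ^ k * (n + c) - c)%N in IH *.
have rE : (2 ^ k.+1 * (n + c) - c = 2 * r + c)%N.
  have : (c <= 2 ^ k * (n + c))%N.
    by rewrite -[leqLHS]mul1n leq_mul ?expn_gt0 // leq_addl.
  by rewrite /r expnS; lia.
have p0 : (0 < X * 2 ^ k)%N by rewrite muln_gt0 X0 expn_gt0.
rewrite rE -(leq_pmul2l p0).
have h1 : ((a n ^ 2 ^ k * (X * 2 ^ k.+1)) ^ 2 <=
           ((2 * X) ^ 2 ^ k * a r) ^ 2)%N by rewrite leq_exp2r.
have h2 : (a r ^ 2 <= X * 2 ^ k * a (2 * r + c))%N.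
  apply: leq_trans (ha r) _; rewrite leq_mul2r; apply/orP; right.
  have : (r + c + 1 <= (n + c + 1) * 2 ^ k)%N.
    have : (c <= 2 ^ k * (n + c))%N.
      by rewrite -[leqLHS]mul1n leq_mul ?expn_gt0 // leq_addl.
    have : (0 < 2 ^ k)%N by rewrite expn_gt0.
    by rewrite /r; nia.
  by rewrite /X -mulnA leq_mul2l => ->; rewrite orbT.
rewrite expnMn in h1; rewrite [in leqRHS]expnMn in h1.
have h3 := leq_trans h1 (leq_mul (leqnn _) h2).
move: h3; rewrite -!expnM -[(2 ^ k * 2)%N]mulnC -expnS.
rewrite (_ : (X * 2 ^ k.+1) ^ 2 = (X * 2 ^ k) * (X * 2 ^ k.+2))%N; last first.
  by rewrite !expnS; nia.
by rewrite mulnCA [leqRHS]mulnCA.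
Qed.

Section BallUpper.
Context {R : realType} {G : groupType} {c D : nat} {S : set G}
  {d : G -> G -> R} {A : 'I_3 -> G}.

(** Take logarithms in [square_iter], divide by 2^k and let k tend to infinity: of all the factors
    only 24 D (n + c + 1) survives. Here 24 is 2 * 12, where 12 D (n + c + 1) bounds the factor in
    [ball_square]. *)
Lemma ball_upper (be : R) n : finite_set S -> separators c D S d A -> 0 <= be ->
  (forall eps, 0 < eps -> exists N : nat, forall n, (N <= n)%N ->
    ln (ball_size S n)%:R <= n%:R * (be + eps)) ->
  ln (ball_size S n)%:R <= ln (24 * D * (n + c + 1))%:R + (n + c)%:R * be.
Proof.
move=> fS sep be0 ub.
have D0 : (0 < D)%N.
  apply: (sep_thin sep ord0 [:: 1%g]) => // t; rewrite inE => /eqP->.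
  by rewrite mul1g !(hd0 (sep_hyp sep)).
have hsq m : (ball_size S m ^ 2 <=
    12 * D * (m + c + 1) * ball_size S (2 * m + c))%N.
  by apply: leq_trans (ball_square sep m fS) _; rewrite leq_mul2r; nia.
set X := (24 * D * (n + c + 1))%N.
have X0 : (0 < X)%N by rewrite /X; nia.
have step k : ln (ball_size S n)%:R <= ln X%:R +
    ln (ball_size S (2 ^ k * (n + c) - c))%:R / (2 ^ k)%:R :> R.
  have := @square_iter (ball_size S) (12 * D) c n k _ hsq.
  have -> : (2 * (12 * D * (n + c + 1)) = X)%N by rewrite /X; nia.
  move=> /(_ _) h; have {h} h : (ball_size S n ^ 2 ^ k <=
     X ^ 2 ^ k * ball_size S (2 ^ k * (n + c) - c))%N.
    apply: leq_trans (h _); last nia.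
    rewrite leq_pmulr // !muln_gt0 expn_gt0 D0 /=; nia.
  have k0 : 0 < (2 ^ k)%:R :> R by rewrite ltr0n expn_gt0.
  rewrite -(ler_pM2l k0) mulrDr [_ * (_ / _)]mulrC divfK ?gt_eqF //.
  have b0 := ball_size_gt0 n fS; have b1 := ball_size_gt0 (2 ^ k * (n + c) - c) fS.
  rewrite ![(2 ^ k)%:R * _]mulr_natl -!lnXn ?ltr0n // -lnM ?posrE ?exprn_gt0 ?ltr0n //.
  by rewrite ler_ln ?posrE ?mulr_gt0 ?exprn_gt0 ?ltr0n // -!natrX -natrM ler_nat.
apply/ler_addgt0Pl => eps e0.
set m := (n + c)%N; have m0 : 0 < m%:R + 1 :> R by rewrite ltr_wpDl.
have [N hN] := ub _ (divr_gt0 e0 m0).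
(* For n = c = 0 the iteration does not move, but then the ball is a single element. *)
have [m00|mpos] := posnP m.
  have := step 0%N; rewrite -/m m00 muln0 sub0n expn0 divr1 mul0r addr0 => h.
  move: m00; rewrite /m => /eqP; rewrite addn_eq0 => /andP[/eqP n0 _].
  rewrite n0 (_ : ball_size S 0 = 1)%N ?ln1; last first.
    apply/eqP; rewrite eqn_leq ball_size_gt0 // andbT.
    apply: (atmost_finite _).2 => l ul hl.
    apply: (@uniq_leq_size _ l [:: 1%g]) => // x /hl[[|? ?] [//= _ _ ->]].
    by rewrite big_nil mem_seq1.
  have lX : 0 <= ln X%:R :> R by rewrite ln_ge0 // ler1n.
  have e0' : (0 : R) < eps := e0; lra.
have [k hk] : exists k, (N + c <= 2 ^ k)%N by exists (N + c)%N; rewrite ltnW // ltn_expl.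
have hr : (N <= 2 ^ k * m - c)%N.
  have hm : (2 ^ k <= 2 ^ k * m)%N by rewrite leq_pmulr.
  by move: hm hk; lia.
have h := hN _ hr; apply: (le_trans (step k)).
have k0 : 0 < (2 ^ k)%:R :> R by rewrite ltr0n expn_gt0.
have : ln (ball_size S (2 ^ k * m - c))%:R / (2 ^ k)%:R <= m%:R * (be + eps / (m%:R + 1)).
  rewrite ler_pdivrMr //; apply: (le_trans h).
  rewrite mulrAC -natrM ler_wpM2r //; last by rewrite ler_nat mulnC leq_subr.
  by rewrite addr_ge0 // divr_ge0 // ltW.
have : m%:R * (eps / (m%:R + 1)) <= eps.
  by rewrite mulrC -mulrA ler_piMr ?(ltW e0) // mulrC ler_pdivrMr // mul1r lerDl.
rewrite -/m; lra.
Qed.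

End BallUpper.

(** * Traces of periodic elements *)

Section Frink.
Context {R : realType} {T : Type} {d : T -> T -> R}.
Hypothesis H : hyp_dist (1 / 1000) d.
Local Notation gp := (gp d).

(** The rate 250 is chosen so that two uses of the four-point condition, with total loss 1/500, cost
    at most the factor expR (1 / 2) <= 2; this is the constant that Frink's argument tolerates. *)
Definition visual (t : R) : R := expR (- (250 * t)).

Lemma visual_le s t : s <= t -> visual t <= visual s.
Proof. by move=> st; rewrite /visual ler_expR; lra. Qed.

Lemma visual_gt0 t : 0 < visual t. Proof. exact: expR_gt0. Qed.

Lemma visual_gp A x z t S : t <= gp A x z + 1 / 500 -> visual t <= S ->
  visual (gp A x z) <= 2 * S.
Proof.
move=> h hS; have e2 : expR (1 / 2) <= 2 :> R.
  have h1 := expR_ge1Dx (- (1 / 2) : R); rewrite expRN in h1.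
  have E0 := expR_gt0 (1 / 2 : R).
  have := ler_wpM2r (ltW E0) h1; rewrite mulVf ?gt_eqF //; lra.
apply: (@le_trans _ _ (visual t * 2)); last by rewrite mulrC; lra.
apply: (@le_trans _ _ (visual t * expR (1 / 2))).
  by rewrite /visual -expRD ler_expR; lra.
by apply: ler_wpM2l => //; exact/ltW/visual_gt0.
Qed.

Lemma visual3 A x y z w S : visual (gp A x y) <= S -> visual (gp A y z) <= S ->
  visual (gp A z w) <= S -> visual (gp A x w) <= 2 * S.
Proof.
move=> h1 h2 h3; case: (gp_or H A x y w) => k1.
  by apply: visual_gp h1; lra.
case: (gp_or H A y z w) => k2; first by apply: visual_gp h2; lra.
by apply: visual_gp h3; lra.
Qed.

(* Frink's metrization argument for the visual quasi-metric based at A. *)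
Lemma frink (x : nat -> T) A n : (0 < n)%N ->
  visual (gp A (x 0%N) (x n)) <=
  2 * \sum_(0 <= j < n) visual (gp A (x j) (x j.+1)).
Proof.
elim/ltn_ind: n x => n IH x n0.
set F := fun j => visual (gp A (x j) (x j.+1)).
have F0 j : 0 < F j by exact: visual_gt0.
have Fs m p : 0 <= \sum_(m <= j < p) F j by apply: sumr_ge0 => j _; exact/ltW.
set S := \sum_(0 <= j < n) F j.
have hcat k : (k <= n)%N -> S = \sum_(0 <= j < k) F j + \sum_(k <= j < n) F j.
  by move=> kn; rewrite -big_cat_nat.
have FS j : (j < n)%N -> F j <= S.
  move=> jn; rewrite (hcat j (ltnW jn)) [X in _ <= _ + X]big_ltn //.
  by have := Fs 0%N j; have := Fs j.+1 n; lra.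
have S0 : 0 < S by apply: lt_le_trans (F0 0%N) (FS _ n0).
have ex : exists k, S / 2 < \sum_(0 <= j < k.+1) F j.
  by exists n.-1; rewrite prednK // -/S; lra.
case: (ex_minnP ex) => k hk kmin.
have kn : (k < n)%N.
  rewrite -(prednK n0) ltnS; apply: kmin; rewrite prednK // -/S; lra.
have hk' : \sum_(0 <= j < k) F j <= S / 2.
  case: k kmin {hk kn} => [|k] kmin; first by rewrite big_geq //; lra.
  by rewrite leNgt; apply/negP => /kmin; rewrite ltnn.
have hE := hcat k.+1 kn.
apply: (@visual3 A (x 0%N) (x k) (x k.+1) (x n) S); last 1 first.
- have [kn1|] := ltnP k.+1 n.
    have := IH (n - k.+1)%N _ (fun j => x (j + k.+1)%N).
    rewrite add0n subnK // subn_gt0 => h.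
    apply: (le_trans (h _ kn1)); first by rewrite ltn_subrL.
    move: hE; rewrite -{2}[k.+1]add0n big_addn /F => hE; lra.
  move=> nk; have {nk} -> : n = k.+1 by apply/eqP; rewrite eqn_leq nk kn.
  apply: le_trans (FS k kn); apply: visual_le.
  by rewrite (gpxx H); exact: (gp_ler H).
- have [->|k0] := posnP k.
    by apply: le_trans (FS 0%N n0); apply: visual_le; rewrite (gpxx H); exact: (gp_lel H).
  apply: (le_trans (IH k kn x k0)); rewrite -/F; lra.
- exact: FS.
Qed.

End Frink.

Section FivePoints.
Context {R : realType} {T : Type} {d : T -> T -> R}.
Hypothesis H : hyp_dist (1 / 1000) d.
Local Notation gp := (gp d).

Lemma five_points z0 z1 z2 z3 z4 x y :
  9 / 10 <= d z0 z1 -> 9 / 10 <= d z1 z2 -> 9 / 10 <= d z3 z4 ->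
  gp z1 z0 z2 <= 3 / 500 -> gp z1 z0 z4 <= 3 / 500 -> gp z2 z0 z4 <= 3 / 500 ->
  gp z2 z1 z4 <= 3 / 500 -> gp z3 z1 z4 <= 3 / 500 -> gp z3 z2 z4 <= 3 / 500 ->
  gp z0 x z4 <= 7 / 1000 -> gp z4 z0 y <= 7 / 1000 ->
  [/\ gp z0 x z1 <= 1 / 125, gp z1 z0 y <= 1 / 125, gp z2 z1 y <= 7 / 1000 &
      gp z1 x z2 <= 7 / 1000].
Proof.
move=> l01 l12 l34 c012 c014 c024 c124 c134 c234 h1 h2.
have a1 : gp z0 x z1 <= 1 / 125.
  by move: (gpK H z0 z1 z4) l01 c014 h1; case: (gp_or H z0 x z1 z4); clear; lra.
have far u : gp z3 u z4 <= 3 / 500 -> gp u z0 z4 <= 3 / 500 ->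
    9 / 10 - 3 / 250 <= d u z4 /\ gp z4 u y <= 1 / 125.
  move=> c3 cu; have du : 9 / 10 - 3 / 250 <= d u z4.
    move: (hd_ge0 H u z3) c3 l34; rewrite /gp (hdC H z3 u); clear; lra.
  split=> //; move: (gpKr H u z0 z4) cu du h2; rewrite (gpC H z4 u y) (gpC H z4 z0 y).
  by case: (gp_or H z4 y u z0); clear; lra.
have [d1 f1] := far z1 c134 c014; have [d2 f2] := far z2 c234 c024.
split=> //.
- by have [|h _] := local_geodesic H c014 f1; [move: d1; clear; lra|move: h; clear; lra].
- by have [|h _] := local_geodesic H c124 f2; [move: d2; clear; lra|move: h; clear; lra].
- by have [|_ h] := local_geodesic H a1 c012; [move: l01; clear; lra|move: h; clear; lra].
Qed.

End FivePoints.

Section Periodic.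
Context {R : realType} {G : groupType} {d : G -> G -> R}.
Hypothesis H : hyp_dist (1 / 1000) d.
Hypothesis dM : forall t g h, d (t * g)%g (t * h)%g = d g h.
Local Notation gp := (gp d).
Local Notation e := (1%g : G).

Lemma thinV D th f : thin (d := d) D th f -> thin (d := d) D th f^-1%g.
Proof.
apply: (@atmost_inj _ _ _ _ _ (fun t => f * t * f^-1)%g) => [t [h1 h2]|t t' _ _].
  split; last by rewrite -!mulgA mulVg mulg1 -{1}[f]mulg1 dM.
  by rewrite -(dM f) mulgV mulgA in h2.
by move=> /mulIg /mulgI.
Qed.

Section Element.
Context (f : G).
Hypothesis ff : gp e f^-1%g f <= 1 / 250.
Hypothesis lf : 9 / 10 <= d e f.

Lemma step_dist q l : d (q * f ^+ l)%g (q * f ^+ l.+1)%g = d e f.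
Proof. by rewrite dM expgSr -{1}[(f ^+ l)%g]mulg1 dM. Qed.

Lemma col3 q i j k : (i <= j <= k)%N ->
  gp (q * f ^+ j)%g (q * f ^+ i)%g (q * f ^+ k)%g <= 3 / 500.
Proof.
move=> /andP[ij jk]; rewrite (gpM dM) (gp_at dM).
have -> : ((f ^+ j)^-1 * f ^+ i = f ^- (j - i))%g.
  by rewrite -{1}(subnKC ij) expgnDr invgM mulgVK.
have -> : ((f ^+ j)^-1 * f ^+ k = f ^+ (k - j))%g.
  by rewrite -{1}(subnKC jk) expgnDr mulKg.
apply: (le_trans (gp_pow H dM (j - i) (k - j) ff _)); last lra.
by apply: lt_le_trans lf; lra.
Qed.

(** Tracing four periods leaves room inside: the geodesic also follows the first period, and its two
    ends are controlled along the second, where [chord_hull_weight] bases its visual metric. *)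
Lemma traced4_points x y q : traced (d := d) (7 / 1000) (f ^+ 4)%g x y q ->
  [/\ gp q x (q * f)%g <= 1 / 125, gp (q * f)%g q y <= 1 / 125,
      gp (q * f ^+ 2)%g (q * f)%g y <= 7 / 1000 &
      gp (q * f)%g x (q * f ^+ 2)%g <= 7 / 1000].
Proof.
move=> [h1 h2]; have z0 : (q * f ^+ 0)%g = q by rewrite mulg1.
have s0 := step_dist q 0; have s1 := step_dist q 1; have s3 := step_dist q 3.
have C i j k := @col3 q i j k.
rewrite -[X in gp X x _]z0 in h1; rewrite -[X in gp _ X y]z0 in h2.
have := five_points H _ _ _ (C 0 1 2 isT) (C 0 1 4 isT) (C 0 2 4 isT)
  (C 1 2 4 isT) (C 1 3 4 isT) (C 2 3 4 isT) h1 h2.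
by rewrite s0 s1 s3 z0 expg1; apply.
Qed.

(* Going around a loop that starts beyond f^(5 N) and ends before f^0, some
   side must run backwards along four consecutive translates of f. *)
Lemma polygon_trace q (v : nat -> G) N :
  gp q (v N) (q * f)%g <= 1 / 50 ->
  1 / 50 < gp (q * f ^+ (5 * N))%g (v 0%N) (q * f ^+ (5 * N).+1)%g ->
  exists j l, [/\ (j < N)%N, (l < 5 * N)%N &
    traced (d := d) (7 / 1000) (f ^+ 4)%g (v j.+1) (v j) (q * f ^+ l.+1)%g].
Proof.
move=> hN h0; apply: contrapT => nex.
(* [bef l x] says that x projects to the axis no later than q f^l. If one vertex lies before q f^l
   and the next one beyond q f^(l + 5), the side between them traverses the four periods from q f^(l
   + 1) on; hence the factor 5. *)
pose bef l x := gp (q * f ^+ l)%g x (q * f ^+ l.+1)%g <= 1 / 50.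
suff hb i : (i <= N)%N -> bef (5 * i)%N (v (N - i)%N).
  by have := hb N (leqnn _); rewrite subnn /bef leNgt h0.
elim: i => [|i IH] iN; first by rewrite /bef muln0 subn0 mulg1 expg1.
have {IH} IH := IH (ltnW iN).
set l := (5 * i)%N in IH; set j := (N - i.+1)%N.
have ej : (N - i)%N = j.+1 by move: iN; rewrite /j; clear; lia.
rewrite ej in IH; have -> : (5 * i.+1)%N = l.+4.+1 by rewrite /l; clear; lia.
rewrite /bef leNgt; apply/negP => hv; apply: nex; exists j, l.
split; [by move: iN; rewrite /j; clear; lia|by move: iN; rewrite /l; clear; lia|].
have C i' j' k' := @col3 q i' j' k'.
have s0 := step_dist q l; have s4 := step_dist q l.+4.
have c1 : gp (q * f ^+ l.+1)%g (q * f ^+ l)%g (q * f ^+ l.+4.+1)%g <= 3 / 500.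
  by apply: C; clear; lia.
have c2 : gp (q * f ^+ l.+4.+1)%g (q * f ^+ l.+1)%g (q * f ^+ l.+4.+2)%g <= 3 / 500.
  by apply: C; clear; lia.
have E : (q * f ^+ l.+1 * f ^+ 4 = q * f ^+ l.+4.+1)%g.
  by rewrite -mulgA -expgnDr addn4.
rewrite /traced E; split.
  by have [|_ h] := local_geodesic H IH c1; [rewrite s0; move: lf|move: h]; clear - H dM ff lf; lra.
move: hv c2; case: (gp_or H (q * f ^+ l.+4.+1)%g (q * f ^+ l.+1)%g (v j)
  (q * f ^+ l.+4.+2)%g); clear - H dM ff lf; lra.
Qed.

Lemma dist_pow n : (0 < n)%N -> 1 / 2 < d e (f ^+ n)%g.
Proof.
case: n => // n _; have := @col3 e 0 1 n.+1 isT; rewrite !mul1g expg1 /gp (hdC H f e).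
have l0 : 9 / 10 <= d e f := lf; change (f ^+ 0)%g with e.
move: (hd_ge0 H f (f ^+ n.+1)%g) l0; clear - H dM ff lf; lra.
Qed.

Lemma pow_inj m n : (f ^+ m = f ^+ n)%g -> m = n.
Proof.
wlog mn : m n / (m <= n)%N => [hw|] h.
  by case: (leqP m n) => [/hw|/ltnW /hw hh]; [exact|rewrite hh].
move: mn; rewrite leq_eqVlt => /predU1P[//|mn].
have nm : (0 < n - m)%N by rewrite subn_gt0.
have E : (f ^+ (n - m))%g = e.
  by rewrite -[LHS](mulKg (f ^+ m)%g) -expgnDr subnKC ?(ltnW mn) // h mulVg.
by have := dist_pow nm; rewrite E (hd0 H) ltNge divr_ge0.
Qed.

End Element.
End Periodic.

Section Hull.
Context {R : realType}.

Lemma sum_buckets (A : eqType) (l : seq A) (b : A -> nat) (D : nat) :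
  (forall k, count (fun q => b q == k) l <= D)%N ->
  \sum_(q <- l) (1 / 2 : R) ^+ b q <= 2 * D%:R.
Proof.
move=> hD; pose B := (\max_(q <- l) b q).+1.
have hB q : q \in l -> (b q < B)%N by move=> ql; rewrite ltnS leq_bigmax_seq.
have -> : \sum_(q <- l) (1 / 2 : R) ^+ b q =
    \sum_(q <- l) \sum_(k < B) (b q == k)%:R * (1 / 2) ^+ k.
  apply: eq_big_seq => q ql; rewrite (bigD1 (Ordinal (hB q ql))) //= eqxx [X in _ = X + _]mul1r.
  rewrite big1 ?addr0 // => k kb; rewrite (_ : b q == k = false) ?mul0r //.
  by apply/negP => /eqP h; move/eqP: kb; apply; apply: val_inj; rewrite /= h.
rewrite exchange_big /=.
have geo n : \sum_(k < n) (1 / 2 : R) ^+ k = 2 - 2 * (1 / 2) ^+ n.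
  elim: n => [|n IH]; first by rewrite big_ord0 expr0; lra.
  by rewrite big_ord_recr IH exprS /=; lra.
have pow0 n : 0 <= (1 / 2 : R) ^+ n by apply: exprn_ge0; lra.
apply: (@le_trans _ _ (\sum_(k < B) D%:R * (1 / 2 : R) ^+ k)).
  apply: ler_sum => k _; rewrite -mulr_suml; apply: ler_wpM2r => //.
  by rewrite -natr_sum ler_nat -[leqLHS]big_mkcond sum1_count hD.
rewrite -mulr_sumr geo mulrC; apply: ler_wpM2r; first exact: ler0n.
by have := pow0 B; lra.
Qed.

Lemma visual_bucket (t : R) : 0 <= t -> visual t <= (1 / 2) ^+ Num.trunc (2 * t).
Proof.
move=> t0; have h2 : 0 <= 2 * t by lra.
have /andP[h _] := truncn_itv h2.
have e125 : expR (- 125) <= 1 / 2 :> R.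
  have h1 := expR_ge1Dx (125 : R); have E0 := expR_gt0 (- 125 : R).
  have := ler_wpM2l (ltW E0) h1; rewrite expRN mulVf ?gt_eqF ?expR_gt0 // => h3.
  by rewrite -expRN in h3 *; lra.
apply: (@le_trans _ _ (expR (- 125) ^+ Num.trunc (2 * t))).
  by rewrite -expRM_natr /visual ler_expR; lra.
by apply: lerXn2r => //; rewrite nnegrE ?expR_ge0 //; lra.
Qed.

(** The quotient of the two estimates of a double count: weight at most 2 D per vertex of the path,
    and at least visual (1 / 125 + L + 1) / 2 per traced translate. *)
Definition chord_hull_bound (D L : nat) : nat :=
  (Num.trunc (2 * D%:R / (visual (1 / 125 + L%:R + 1 : R) / 2))).+1.

Context {G : groupType} {d : G -> G -> R}.
Hypothesis H : hyp_dist (1 / 1000) d.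
Hypothesis dM : forall t g h, d (t * g)%g (t * h)%g = d g h.
Local Notation gp := (gp d).
Local Notation e := (1%g : G).
Context (f : G).
Hypothesis ff : gp e f^-1%g f <= 1 / 250.
Hypothesis lf : 9 / 10 <= d e f.

Lemma tracedV r x y q : traced (d := d) r f x y q ->
  traced (d := d) r f^-1%g y x (q * f)%g.
Proof. by move=> [h1 h2]; split; rewrite mulgK (gpC H). Qed.

(** Let p_j0 be the last vertex up to p_i that projects before q f. Then p_j0 and p_i lie on
    different sides of q f^2, so their visual distance seen from there is bounded below, and [frink]
    gives the steps between them a definite total visual length. A step is visually small unless it
    passes near q f, and all vertices after p_j0 up to p_i end chords that trace f at q. *)
Lemma chord_hull_weight (L m : nat) (p : nat -> G) i q : d e f <= L%:R ->
  (forall j, (j < m)%N -> d (p j) (p j.+1) <= 1) -> (i <= m)%N ->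
  traced (d := d) (7 / 1000) (f ^+ 4)%g (p 0%N) (p i) q ->
  visual (1 / 125 + L%:R + 1 : R) / 2 <= \sum_(0 <= j < m.+1)
    `[< traced (d := d) (1 / 125) f (p 0%N) (p j) q >]%:R *
    visual (d (p j) (q * f)%g).
Proof.
move=> fL pm im tq; have [a0 a1 a2 a3] := traced4_points H dM ff lf tq.
pose bef j := (gp (q * f)%g (p j) (q * f ^+ 2)%g <= 1 / 50).
have b0 : bef 0%N by move: a3; rewrite /bef; clear - H dM ff lf; lra.
have d12 : d (q * f)%g (q * f ^+ 2)%g = d e f.
  by have := @step_dist _ _ d dM f q 1%N; rewrite expg1.
have bi : ~~ bef i.
  rewrite /bef -ltNge; have := gpKr H (q * f)%g (p i) (q * f ^+ 2)%g.
  by move: a2 lf; rewrite d12 (gpC H (q * f ^+ 2)%g); clear - H dM ff lf; lra.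
have ex : exists j, (j <= i)%N && bef j by exists 0%N.
have [j0 /andP[j0i bj0] jmax] := ex_maxnP ex (fun j h => proj1 (andP h)).
have j0i' : (j0 < i)%N.
  by rewrite ltn_neqAle j0i andbT; apply: contraNneq bi => <-.
have act j : (j0 < j <= i)%N -> traced (d := d) (1 / 125) f (p 0%N) (p j) q.
  move=> /andP[h1 h2]; split=> //.
  have nb : 1 / 50 < gp (q * f)%g (p j) (q * f ^+ 2)%g.
    by rewrite ltNge; apply/negP => hb; have := jmax j; rewrite h2 /bef hb leqNgt h1 => /(_ isT).
  have c012 : gp (q * f)%g q (q * f ^+ 2)%g <= 3 / 500.
    by have := @col3 _ _ d H dM f ff lf q 0 1 2 isT; rewrite expg1 expg0 mulg1.
  by move: nb c012; case: (gp_or H (q * f)%g q (p j) (q * f ^+ 2)%g); clear - H dM ff lf; lra.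
have fr : visual (gp (q * f ^+ 2)%g (p j0) (p i)) <=
    2 * \sum_(j0 <= j < i) visual (gp (q * f ^+ 2)%g (p j) (p j.+1)).
  have := @frink _ _ _ H (fun k => p (k + j0)%N) (q * f ^+ 2)%g (i - j0).
  rewrite add0n subnK // subn_gt0 => /(_ j0i') h; apply: (le_trans h).
  by rewrite -[X in _ <= _ * \big[_/_]_(X <= _ < _) _]add0n big_addn.
have gji : gp (q * f ^+ 2)%g (p j0) (p i) <= 1 / 125.
  have [|_ h] := local_geodesic H bj0 a2; last by move: h; clear - H dM ff lf; lra.
  by rewrite d12; move: lf; clear - H dM ff lf; lra.
have step j : (j0 <= j < i)%N -> visual (gp (q * f ^+ 2)%g (p j) (p j.+1)) <=
    expR (250 * (L%:R + 1)) * visual (d (p j.+1) (q * f)%g).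
  move=> /andP[_ ji]; rewrite /visual -expRD ler_expR.
  have pj := pm j (leq_trans ji im).
  have := hdT H (p j.+1) (q * f ^+ 2)%g (q * f)%g.
  have := hdT H (q * f ^+ 2)%g (p j) (p j.+1).
  rewrite (hdC H (q * f ^+ 2)%g (q * f)%g) d12 (hdC H (p j.+1) (q * f ^+ 2)%g) /gp.
  by move: pj fL; clear - H dM ff lf; lra.
pose F j : R := `[< traced (d := d) (1 / 125) f (p 0%N) (p j) q >]%:R *
    visual (d (p j) (q * f)%g).
rewrite -[X in _ <= X]/(\sum_(0 <= j < m.+1) F j).
have S0 j : 0 <= F j by rewrite mulr_ge0 // ltW // visual_gt0.
have hs : \sum_(j0 <= j < i) visual (gp (q * f ^+ 2)%g (p j) (p j.+1)) <=
    expR (250 * (L%:R + 1)) * \sum_(0 <= j < m.+1) F j.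
  apply: (@le_trans _ _ (expR (250 * (L%:R + 1)) * \sum_(j0 <= j < i) F j.+1)).
    rewrite mulr_sumr !big_nat; apply: ler_sum => j hj; apply: (le_trans (step j hj)).
    rewrite /F; move/andP: hj => [h1 h2].
    by rewrite (asboolT (act j.+1 _)) ?mul1r // ltnS h1.
  apply: ler_wpM2l; first exact: expR_ge0.
  rewrite (@big_cat_nat _ _ _ j0.+1 0 m.+1) //=; last by rewrite ltnS (leq_trans j0i).
  rewrite (@big_cat_nat _ _ _ i.+1 j0.+1 m.+1) //=.
  rewrite (big_add1 _ _ j0 i.+1) /=.
  have P u v : 0 <= \sum_(u <= j < v) F j by apply: sumr_ge0.
  by have := P 0%N j0.+1; have := P i.+1 m.+1; clear - H dM ff lf; lra.
have h1 : visual (1 / 125) <= 2 * (expR (250 * (L%:R + 1)) * \sum_(0 <= j < m.+1) F j).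
  apply: le_trans (visual_le gji) _; apply: (le_trans fr); move: hs; clear - H dM ff lf; lra.
have -> : visual (1 / 125 + L%:R + 1 : R) =
    visual (1 / 125) * expR (- (250 * (L%:R + 1))).
  by rewrite /visual -expRD; congr expR; clear - H dM ff lf; lra.
have E0 := expR_gt0 (- (250 * (L%:R + 1)) : R).
have WV : expR (- (250 * (L%:R + 1))) * expR (250 * (L%:R + 1)) = 1 :> R.
  by rewrite -expRD addNr expR0.
move: (ler_wpM2l (ltW E0) h1) WV; clear - H dM ff lf.
set W := expR _; set V := expR _; set S := \sum_(_ <= _ < _) _; set v := visual _.
move=> h WV; have : W * (2 * (V * S)) = 2 * S.
  by rewrite -[in RHS](mul1r S) -WV; ring.
by move: h => /[swap] ->; lra.
Qed.

(** Double counting of pairs of a translate q and a vertex p_j, weighted by the visual size of their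
    distance. For fixed j the translates traced by the single chord from p_0 to p_j contribute a
    geometric series. So the bound is linear in m although there are m + 1 chords of length up to
    m. *)
Lemma chord_hull (D L m : nat) (p : nat -> G) : d e f <= L%:R ->
  thin (d := d) D (9 / 10) f ->
  (forall j, (j < m)%N -> d (p j) (p j.+1) <= 1) ->
  atmost (chord_hull_bound D L * m.+1) (fun q => exists2 i, (i <= m)%N &
    traced (d := d) (7 / 1000) (f ^+ 4)%g (p 0%N) (p i) q).
Proof.
move=> fL thf pm l ul hl.
set c1 := visual (1 / 125 + L%:R + 1 : R) / 2.
have c10 : 0 < c1 by rewrite divr_gt0 // visual_gt0.
pose F j q : R := `[< traced (d := d) (1 / 125) f (p 0%N) (p j) q >]%:R *
    visual (d (p j) (q * f)%g).
have h1 : (size l)%:R * c1 <= \sum_(0 <= j < m.+1) \sum_(q <- l) F j q.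
  rewrite exchange_big /= -sum1_size natr_sum mulr_suml !big_seq.
  apply: ler_sum => q /hl[i im tq]; rewrite mul1r; exact: chord_hull_weight fL pm im tq.
have h2 j : \sum_(q <- l) F j q <= 2 * D%:R.
  pose l' := [seq q <- l | `[< traced (d := d) (1 / 125) f (p 0%N) (p j) q >]].
  pose b q := Num.trunc (2 * d (p j) (q * f)%g).
  apply: (@le_trans _ _ (\sum_(q <- l') (1 / 2 : R) ^+ b q)).
    rewrite big_filter [X in _ <= X]big_mkcond /=; apply: ler_sum => q _; rewrite /F.
    case: asbool; last by rewrite mul0r.
    by rewrite [X in X <= _]mul1r; exact: visual_bucket (hd_ge0 H _ _).
  apply: sum_buckets => k; rewrite -size_filter -(size_map (fun q => q * f)%g).
  have hb := @traced_bucket _ _ d dM H D f^-1%g (1 / 125) (p j) (p 0%N) k.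
  apply: hb.
  - exact: (thinV dM).
  - lra.
  - rewrite (dV H dM); move: lf; clear - H dM ff lf; lra.
  - rewrite map_inj_uniq ?filter_uniq //; exact: mulIg.
  move=> _ /mapP[q + ->]; rewrite !mem_filter => /and3P[/= /eqP bq /asboolP tq _].
  by split=> //; exact: tracedV.
have h3 : (size l)%:R * c1 <= m.+1%:R * (2 * D%:R).
  apply: (le_trans h1).
  apply: (@le_trans _ _ (\sum_(0 <= j < m.+1) (2 * D%:R))).
    by apply: ler_sum => j _; exact: h2.
  by rewrite sumr_const_nat subn0 [leRHS]mulr_natl.
have h4 := truncnS_gt (2 * D%:R / c1 : R).
rewrite -(ler_nat R) natrM; rewrite -ler_pdivlMr // in h3; apply: (le_trans h3).
rewrite -mulrA mulrC; apply: ler_wpM2r; first exact: ler0n.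
exact: ltW.
Qed.

End Hull.

(** The equations say that P', Q', x' are the images of P, Q, x under an isometry. A point near a
    segment moves hardly more than the ends of the segment. *)
Lemma conv_dist (R : realType) (T : Type) (dl k D : R) (d : T -> T -> R)
    (H : hyp_dist dl d) P Q x P' Q' x' :
  gp d x P Q <= k -> d P' Q' = d P Q -> d P' x' = d P x -> d Q' x' = d Q x ->
  d P P' <= D -> d Q Q' <= D -> d x x' <= D + 2 * k + 2 * dl.
Proof.
rewrite /gp => h1 h2 h3 h4 h5 h6.
have := hdT H x P P'; have := hdT H x Q Q'.
rewrite (hdC H x P) (hdC H x Q) in h1 *.
by case: (hd4 H x x' P' Q'); rewrite ?(hdC H x' Q') ?(hdC H x' P') h2 ?h3 ?h4; lra.
Qed.

(** * Elements preserving directions, and loops built from the others *)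

Section Tame.
Context {R : realType} {G : groupType} {c D : nat} {S : set G}
  {d : G -> G -> R} {A : 'I_3 -> G}.
Hypothesis sep : separators c D S d A.
Local Notation gp := (gp d).
Local Notation e := (1%g : G).
Let H := sep_hyp sep.
Let dM := sep_inv sep.

Definition bad_index (u : G) (i : 'I_3) : bool :=
  d e (A i) - 1 / 4 < gp e (A i)^-1%g (u * (A i)^-1)%g.

(* An element is tame if it, or its inverse, preserves two of the three
   directions A_i^-1. *)
Definition tame (u : G) : Prop := exists i j, i != j /\
  (bad_index u i && bad_index u j \/ bad_index u^-1%g i && bad_index u^-1%g j).

Let gpA i b j b' : (i, b) != (j, b') ->
  gp e (signed_direction A (i, b)) (signed_direction A (j, b')) <= 1 / 1000 := sep_gp sep (y := (j, b')).

(** Two diverging directions determine their branch point, so an element that preserves both almost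
    fixes 1, and then also the point A_i^-1. After conjugation by A_i such elements are counted by
    [sep_thin]. *)
Lemma bad_index2 u i j : i != j -> bad_index u i -> bad_index u j ->
  d e u <= 1 /\ d (A i)^-1%g (u * (A i)^-1)%g <= 1.
Proof.
rewrite /bad_index => ij hi hj; set a := (A i)^-1%g in hi *; set b := (A j)^-1%g in hj.
have la : 1 <= d e a by rewrite (dV H dM); exact: sep_long sep i.
have lb : 1 <= d e b by rewrite (dV H dM); exact: sep_long sep j.
have ea : d e (A i) = d e a by rewrite (dV H dM).
have eb : d e (A j) = d e b by rewrite (dV H dM).
rewrite {}ea in hi; rewrite {}eb in hj.
have gab : gp e a b <= 1 / 1000.
  by apply: (gpA (b := false) (b' := false)); apply: contra ij => /eqP[->].
have gu : gp u (u * a)%g (u * b)%g <= 1 / 1000.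
  by rewrite -{1}[u]mulg1 (gpM dM).
have dua : d u (u * a)%g = d e a by rewrite -{1}[u]mulg1 dM.
have dub : d u (u * b)%g = d e b by rewrite -{1}[u]mulg1 dM.
have g1 : gp e (u * a)%g b <= 1 / 500.
  by move: hi la gab; case: (gp_or H e a (u * a)%g b); lra.
have g2 : gp e (u * a)%g (u * b)%g <= 3 / 1000.
  move: hj lb g1; rewrite (gpC H e b).
  by case: (gp_or H e (u * a)%g (u * b)%g b); lra.
have gu' : gp u (u * a)%g (u * b)%g <= 3 / 1000 by move: gu; lra.
have h1 := line_dist H g2 gu'.
rewrite (hdC H (u * a)%g u) dua in h1.
have k1 : d e a - 1 / 4 < d (u * a)%g e.
  by rewrite (hdC H _ e); apply: lt_le_trans hi _; exact: gp_ler H _ _ _.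
have k2 : d (u * a)%g e < d e a + 1 / 4 + 1 / 125.
  have := gp_ler H e b (u * b)%g; move: g2 gu hj; rewrite /gp dua dub (hdC H _ e).
  by have := hdT H (u * a)%g u (u * b)%g; rewrite (hdC H _ u) dua dub; lra.
have h2 : d e u <= 1 / 4 + 3 / 100.
  apply: (le_trans h1); suff : `|d (u * a)%g e - d e a| <= 1 / 4 + 1 / 125 by lra.
  by rewrite ler_norml; apply/andP; split; lra.
split; first by lra.
by move: hi k2; rewrite /gp (hdC H _ e); lra.
Qed.

Lemma tame_atmost : atmost (6 * D) tame.
Proof.
pose Q u := exists i, d e u <= 1 /\ d (A i)^-1%g (u * (A i)^-1)%g <= 1.
have hQ : atmost (3 * D) Q.
  have [f fP] : exists f : G -> 'I_3, forall u, Q u ->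
      d e u <= 1 /\ d (A (f u))^-1%g (u * (A (f u))^-1)%g <= 1.
    have /choice[f fP] : forall u, exists i, Q u ->
        d e u <= 1 /\ d (A i)^-1%g (u * (A i)^-1)%g <= 1.
      by move=> u; have [[i hi]|nQ] := pselect (Q u); [exists i|exists ord0].
    by exists f.
  rewrite mulnC; apply: (@atmost_fiber _ _ _ _ _ (fun i => i \in enum 'I_3) f).
  - by move=> u _; rewrite mem_enum.
  - by have := @atmost_seq _ (enum 'I_3); rewrite size_enum_ord.
  move=> i; apply: (@atmost_inj _ _ _ _ _ (fun u => A i * u * (A i)^-1)%g _ _ (sep_thin sep i)).
    move=> u [/fP + <-] => -[h1 h2]; split; last by rewrite mulgVK -{1}[A (f u)]mulg1 dM.
    by rewrite -(dM (A (f u))^-1%g) mulg1 -mulgA mulKg.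
  by move=> u v _ _ /mulIg/mulgI.
apply: (@atmost_sub _ (3 * D + 3 * D) _ _ (fun u => Q u \/ Q u^-1%g)); first lia.
  move=> u [i [j [ij [/andP[h1 h2]|/andP[h1 h2]]]]]; [left|right]; exists i;
  exact: bad_index2 ij h1 h2.
apply: atmost_or => //; apply: (@atmost_inj _ _ _ _ _ (fun u => u^-1)%g _ _ hQ) => //.
by move=> u v _ _ /invg_inj.
Qed.

Let i0 : 'I_3 := inord 0.
Let i1 : 'I_3 := inord 1.

(** A product of two conjugates of u, hence a relation whenever u is one. The inner conjugation by
    A_i gives v = A_i u A_i^-1 a definite length; the outer ones, by two different elements, make
    the product move along an axis. *)
Definition loop_elt (i : 'I_3) (u : G) : G :=
  (\prod_(x <- [:: A i0; A i; u; (A i)^-1; (A i0)^-1; A i1; A i; u; (A i)^-1;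
    (A i1)^-1]) x)%g.

(** Some i is bad neither for u nor for its inverse. Then v and v^-1 both start along A_i for at
    least 1/4 and so diverge from all A_j^-1, and the six factors form a chain. Thinness is
    inherited from the first factor, which lies on the segment from 1 to f. *)
Lemma nontame_loop u : ~ tame u -> exists i, let f := loop_elt i u in
  [/\ gp e f^-1%g f <= 1 / 250, 9 / 10 <= d e f & thin (d := d) D (9 / 10) f].
Proof.
move=> nt.
have [i /andP[g1 g2]] : exists i, ~~ bad_index u i && ~~ bad_index u^-1%g i.
  by apply: ord3_avoid => i j hi hj; apply/eqP; apply: contraT => ij; case: nt;
  exists i, j; split=> //; [left|right]; rewrite hi hj.
exists i; cbv zeta; set v := (A i * u * (A i)^-1)%g.
have i01 : i0 != i1 by apply/eqP => /(congr1 val); rewrite /= !inordK.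
pose us := [:: A i0; v; (A i0)^-1; A i1; v; (A i1)^-1]%g.
have fE : loop_elt i u = (\prod_(x <- us) x)%g.
  by rewrite /loop_elt /us /v !(big_cons, big_nil) !mulg1 !mulgA.
have dv (w : G) : ~~ bad_index w i -> 1 / 4 <= gp e (A i * w * (A i)^-1)%g (A i).
  rewrite /bad_index -leNgt => h; rewrite (gpC H).
  have := gpK H e (A i) (A i * w * (A i)^-1)%g.
  have -> : gp (A i) e (A i * w * (A i)^-1)%g = gp e (A i)^-1%g (w * (A i)^-1)%g.
    by rewrite -mulgA (gp_at1 dM).
  by lra.
have v1 : 1 / 4 <= gp e v (A i) by exact: dv.
have v2 : 1 / 4 <= gp e v^-1%g (A i).
  by rewrite /v !invgM invgK mulgA; exact: dv.
have lv : 1 / 4 <= d e v by apply: le_trans v1 _; exact: gp_lel H _ _ _.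
have Av j (w : G) : 1 / 4 <= gp e w (A i) -> gp e (A j)^-1%g w <= 1 / 500.
  have hne : (j, false) != (i, true) by rewrite xpair_eqE andbF.
  move=> hw; have := gpA hne.
  by rewrite /signed_direction /=; case: (gp_or H e (A j)^-1%g w (A i)); lra.
have A01 : gp e (A i0) (A i1) <= 1 / 500.
  have := gpA (i := i0) (b := true) (j := i1) (b' := true).
  by rewrite /signed_direction /= => h; apply: (le_trans (h _)); [apply: contra i01 => /eqP[->]|lra].
have hc : chain (d := d) (1 / 500) (us ++ us).
  rewrite /chain /= !invgK !Av //= !(gpC H _ v^-1%g) !Av //= A01 (gpC H _ (A i1)) A01.
  by [].
have hl : long (dl := 1 / 1000) (d := d) (1 / 500) (us ++ us).
  have lA j : 1 / 4 <= d e (A j) by have := sep_long sep j; lra.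
  rewrite /long /us /= !(dV H dM).
  have hb (x : R) : 1 / 4 <= x -> 2 * (1 / 500) + 3 * (1 / 1000) < x by lra.
  by rewrite !hb.
have ff : gp e (loop_elt i u)^-1%g (loop_elt i u) <= 1 / 250.
  rewrite fE; apply: (le_trans (chain_cat H dM hc hl _)); lra.
have near : gp (A i0) e (loop_elt i u) <= 1 / 250.
  have E : us = [:: A i0] ++ behead us by [].
  have hc1 : chain (d := d) (1 / 500) ([:: A i0] ++ behead us).
    by move: hc; rewrite -E /chain => /cat_sorted2[].
  have hl1 : long (dl := 1 / 1000) (d := d) (1 / 500) ([:: A i0] ++ behead us).
    by move: hl; rewrite -E /long all_cat => /andP[].
  have := chain_cat H dM hc1 hl1; rewrite big_seq1 => h.
  rewrite fE E big_cat big_seq1 (gp_at1 dM).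
  by apply: (le_trans (h _)); lra.
split=> //.
  have := sep_long sep i0; move: near; rewrite /gp (hdC H _ e).
  by have := hd_ge0 H (A i0) (loop_elt i u); lra.
apply: atmost_sub (leqnn _) _ (sep_thin sep i0) => t [h1 h2]; split; first lra.
have := conv_dist H near (dM t _ _) (dM t _ _) (dM t _ _) (D := 9 / 10).
by rewrite mulg1 => /(_ h1 h2); lra.
Qed.

End Tame.

(** * Insertion of relations *)

Section Words.
Context {l : nat}.
Local Notation word := (seq ('I_l * bool)).

(** Words are not assumed reduced, which keeps concatenation and inversion simple; [reduced_form]
    restores the link with [free_group]. *)
Definition weval (G : groupType) (a : 'I_l -> G) (w : word) : G :=
  (\prod_(p <- w) (if p.2 then a p.1 else (a p.1)^-1))%g.

Definition winv (w : word) : word := [seq (p.1, ~~ p.2) | p <- rev w].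

Definition wpow (w : word) (k : nat) : word := flatten (nseq k w).

Lemma size_winv w : size (winv w) = size w.
Proof. by rewrite size_map size_rev. Qed.

Lemma size_wpow w k : size (wpow w k) = (k * size w)%N.
Proof. by elim: k => [|k IH] //; rewrite /wpow /= size_cat -/(wpow w k) IH mulSn. Qed.

Section Eval.
Context {G : groupType} (a : 'I_l -> G).

Lemma weval_cat v w : weval a (v ++ w) = (weval a v * weval a w)%g.
Proof. by rewrite /weval big_cat. Qed.

Lemma weval_inv w : weval a (winv w) = (weval a w)^-1%g.
Proof.
rewrite /weval /winv big_map -[in RHS](revK w) -prodgV.
by apply: eq_bigr => -[i []] _ //=; rewrite invgK.
Qed.

Lemma weval_pow w k : weval a (wpow w k) = (weval a w ^+ k)%g.
Proof.
elim: k => [|k IH]; first by rewrite /weval big_nil.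
by rewrite /wpow /= weval_cat -/(wpow w k) IH expgS.
Qed.

Lemma weval_ball S n w : (forall i, S (a i)) -> (forall s, S s -> S s^-1%g) ->
  (size w <= n)%N -> word_ball S n (weval a w).
Proof.
move=> Sa SV wn; exists [seq if p.2 then a p.1 else (a p.1)^-1%g | p <- w].
rewrite size_map big_map; split=> // s /mapP[[i []] _ ->] //=.
by apply: SV.
Qed.

Lemma ball_weval n g : word_ball (range a) n g ->
  exists w, (size w <= n)%N /\ weval a w = g.
Proof.
move=> [s [sn Ss ->]]; elim: s n sn Ss => [|x s IH] n sn Ss.
  by exists [::]; rewrite /weval !big_nil.
have [i _ ix] := Ss x (mem_head _ _).
case: n sn => // n sn; have [|w [wn ws]] := IH n sn; first by move=> y ys; apply: Ss; rewrite inE ys orbT.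
exists ((i, true) :: w); split=> //.
by rewrite /weval !big_cons /= -/(weval a w) ws ix.
Qed.

End Eval.
End Words.

Lemma not_atmost (A : eqType) n (P : A -> Prop) : ~ atmost n P ->
  exists s, [/\ uniq s, (n < size s)%N & forall x, x \in s -> P x].
Proof.
move=> h; apply: contrapT => hn; apply: h => s us sP; rewrite leqNgt; apply/negP => ns.
by apply: hn; exists s.
Qed.

Lemma pigeonhole (j : nat -> nat) (N K : nat) :
  (forall g, (g < N * K + 1)%N -> (j g < N)%N) ->
  exists s j0, [/\ uniq s, (K < size s)%N, (j0 < N)%N &
    forall g, g \in s -> (g < N * K + 1)%N /\ j g = j0].
Proof.
move=> jN; apply: contrapT => hn.
suff : atmost (K * N) (fun g => g < N * K + 1)%N.
  move=> /(_ (iota 0 (N * K + 1)) (iota_uniq _ _)).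
  rewrite size_iota => h; have : (N * K + 1 <= K * N)%N.
    by apply: h => g; rewrite mem_iota.
  by rewrite mulnC addn1 ltnn.
apply: (@atmost_fiber _ _ _ _ _ (fun i => i < N)%N j jN (@atmost_lt N)) => b.
apply: contrapT => /not_atmost[s [us Ks sP]]; apply: hn; exists s, b; split=> //.
case: s us Ks sP => // g s _ _ /(_ g (mem_head _ _))[/jN h <-].
exact: h.
Qed.

(** Greedy choice: each chosen index discards itself and at most D others. *)
Lemma independent_subset (conf : nat -> nat -> Prop) (D : nat) (s : seq nat) :
  uniq s -> (forall i, i \in s ->
    atmost D (fun j => j \in s /\ (conf i j \/ conf j i))) ->
  exists t, [/\ uniq t, {subset t <= s}, (size s <= D.+1 * size t)%N &
    forall i j, i \in t -> j \in t -> i != j -> ~ conf i j].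
Proof.
have [n] := ubnP (size s); elim: n s => // n IH [|x s] sn us hs.
  by exists [::].
pose c j := `[< conf x j \/ conf j x >].
have [|||t [ut ts st tc]] := IH [seq j <- s | ~~ c j].
- by rewrite size_filter (leq_ltn_trans (count_size _ _)) // -ltnS.
- by move: us => /= /andP[_ us]; exact: filter_uniq.
- move=> i; rewrite mem_filter => /andP[_ si].
  apply: atmost_sub (leqnn _) _ (hs i _); last by rewrite inE si orbT.
  by move=> j [+ hj]; rewrite mem_filter => /andP[_ js]; rewrite inE js orbT.
have xs : x \notin s by move: us => /= /andP[].
have ts' j : j \in t -> j \in s /\ ~ (conf x j \/ conf j x).
  by move=> /ts; rewrite mem_filter => /andP[/asboolPn].
exists (x :: t); split.
- by rewrite /= ut andbT; apply/negP => /ts'[xs']; rewrite xs' in xs.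
- by move=> j; rewrite !inE => /predU1P[->|/ts'[-> _]]; rewrite ?eqxx ?orbT.
- rewrite /= mulnS -(count_predC c s) -addSn leq_add //; last by rewrite -size_filter.
  rewrite ltnS -size_filter; apply: (hs x (mem_head _ _)).
    by move: us => /= /andP[_ us]; exact: filter_uniq.
  by move=> j; rewrite mem_filter inE => /andP[/asboolP hj ->]; rewrite orbT.
move=> i j; rewrite !inE => /predU1P[->|ti] /predU1P[->|tj]; rewrite ?eqxx //.
- by have [_ h] := ts' _ tj => _ hc; apply: h; left.
- by have [_ h] := ts' _ ti => _ hc; apply: h; right.
exact: tc.
Qed.

Section Bounds.
Context {R : realType}.

(** 16 is 2 * 8: there are at most 2 * [chord_hull_bound] * (n + 1) chord traces, both directions
    counted, and at most one position in eight may be heavy. *)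
Definition heavy_bound (D s : nat) : nat := 16 * @chord_hull_bound R D s.
(** The loops to be excluded have at most 11 sides, so among 11 K + 1 blocks of periods one side
    traces f^4 in more than K, where K is [heavy_bound]. A block of 60 periods has room for
    [polygon_trace], which reaches up to f^(5 * 11 + 1), and keeps traces in different blocks
    apart. *)
Definition insertion_count (D s : nat) : nat := 60 * (11 * heavy_bound D s + 1).
Definition insertion_len (D s : nat) : nat := insertion_count D s * s.
Definition insertion_trace_bound (D s : nat) : nat := 2 * (D * (2 * insertion_len D s + 1)).

End Bounds.

Section Insertion.
Context {R : realType} {G : groupType} {l : nat}.
Local Notation word := (seq ('I_l * bool)).
Context {d : G -> G -> R} (a a0 : 'I_l -> G) (fw w : word) (D : nat).
Hypothesis H : hyp_dist (1 / 1000) d.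
Hypothesis dM : forall t g h, d (t * g)%g (t * h)%g = d g h.
Hypothesis da : forall i, d 1%g (a i) <= 1.
Local Notation gp := (gp d).
Local Notation e := (1%g : G).
Local Notation h := (weval a).
Local Notation h0 := (weval a0).
Local Notation f := (h fw).
Hypothesis ff : gp e f^-1%g f <= 1 / 250.
Hypothesis lf : 9 / 10 <= d e f.
Hypothesis thf : thin (d := d) D (9 / 10) f.
Hypothesis f0 : h0 fw = 1%g.

Local Notation K := (@heavy_bound R D (size fw)).
Local Notation nr := (@insertion_count R D (size fw)).
Local Notation li := (@insertion_len R D (size fw)).
Local Notation D2 := (@insertion_trace_bound R D (size fw)).
Local Notation n := (size w).
Local Notation Fw := (wpow fw nr).
Local Notation F := (f ^+ nr)%g.
Local Notation f4 := (f ^+ 4)%g.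
Local Notation tr := (traced (d := d) (7 / 1000) f4).
Local Notation P i := (h (take i w)).
Local Notation R2 := (8 * (n + li))%N.

Hypothesis inj_path : forall i j, (i <= n)%N -> (j <= n)%N ->
  h0 (take i w) = h0 (take j w) -> i = j.
(* The relations of length at most 2 R2 of the marking a hold for a0. *)
Hypothesis good : forall v, (size v <= 2 * R2)%N -> h v = 1%g -> h0 v = 1%g.

(** The image under [a0] becomes a label of the elements that are short under [a]. The geometry
    below takes place under [a], and labels tell which position of w is meant. *)
Lemma good_label v v' : (size v <= R2)%N -> (size v' <= R2)%N -> h v = h v' ->
  h0 v = h0 v'.
Proof.
move=> sv sv' hv; have E : h0 (winv v ++ v') = 1%g.
  apply: good; first by rewrite size_cat size_winv; move: sv sv'; clear; lia.
  by rewrite weval_cat weval_inv hv mulVg.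
rewrite weval_cat weval_inv in E.
by rewrite -[LHS]mulg1 -E mulVKg.
Qed.

Lemma letter_dist (u : word) : d e (h u) <= (size u)%:R.
Proof.
elim: u => [|[i b] u IH]; first by rewrite /weval big_nil (hd0 H).
rewrite -cat1s weval_cat size_cat natrD.
have h1 : d e (h [:: (i, b)]) <= 1.
  by rewrite /weval big_seq1; case: b => //=; rewrite (dV H dM).
apply: (le_trans (hdT H _ (h [:: (i, b)]) _)); apply: lerD => //.
by rewrite -{1}[h [:: _]]mulg1 dM.
Qed.

Lemma path_step i : d (P i) (P i.+1) <= 1.
Proof.
have [ni|ni] := leqP n i.
  by rewrite !take_oversize ?(leqW ni) // (hd0 H); lra.
have x0 : 'I_l * bool by case: (w) ni => // x.
rewrite (take_nth x0 ni) -cats1 weval_cat -{1}[h (take i w)]mulg1 dM.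
exact: letter_dist [:: _].
Qed.

Lemma dist_f : d e f <= (size fw)%:R. Proof. exact: letter_dist. Qed.

(* The segments along which one of the chords from 1 to a vertex of w runs. *)
Definition chord_trace x : Prop :=
  exists2 i, (i <= n)%N & tr e (P i) x \/ tr (P i) e x.

Lemma chord_trace_atmost : atmost (2 * @chord_hull_bound R D (size fw) * n.+1) chord_trace.
Proof.
have ffV : gp e f^-1^-1%g f^-1%g <= 1 / 250 by rewrite invgK (gpC H).
have lfV : 9 / 10 <= d e f^-1%g by rewrite (dV H dM).
have fLV : d e f^-1%g <= (size fw)%:R by rewrite (dV H dM) dist_f.
have P0 : P 0%N = 1%g by rewrite take0 /weval big_nil.
have h1 := chord_hull H dM ff lf (m := n) dist_f thf (fun j _ => path_step j).
have h2 := chord_hull H dM ffV lfV (m := n) fLV (thinV dM thf) (fun j _ => path_step j).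
rewrite P0 in h1 h2.
have h3 : atmost (@chord_hull_bound R D (size fw) * n.+1)
    (fun x => exists2 i, (i <= n)%N & tr (P i) e x).
  apply: (@atmost_inj _ _ _ _ _ (fun x => x * f4)%g _ _ h2) => [x [i ni tx]|x y _ _ /mulIg //].
  by exists i => //; rewrite expVgn; exact: tracedV.
apply: (@atmost_sub _ _ _ _ _ _ _ (atmost_or h1 h3)); first lia.
by move=> x [i ni [tx|tx]]; [left|right]; exists i.
Qed.

Definition heavy (i : nat) : Prop := exists L : seq G, [/\ uniq L, (K < size L)%N &
  forall x, x \in L -> chord_trace x /\
    exists v, [/\ (size v <= R2)%N, h v = x & h0 v = h0 (take i w)]].

(** Traces that belong to different positions have different labels by [inj_path], so they are
    disjoint, and [chord_trace_atmost] bounds their union. *)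
Lemma heavy_atmost (s : seq nat) : uniq s ->
  (forall i, i \in s -> (i <= n)%N /\ heavy i) -> (8 * size s <= n.+1)%N.
Proof.
move=> us hs.
have /choice[L LP] : forall i, exists L : seq G, i \in s -> [/\ uniq L, size L = K.+1 &
    forall x, x \in L -> chord_trace x /\
      exists v, [/\ (size v <= R2)%N, h v = x & h0 v = h0 (take i w)]].
  move=> i; have [si|nsi] := boolP (i \in s); last by exists [::].
  have [_ [L [uL KL LP]]] := hs i si; exists (take K.+1 L) => _; split.
  - exact: take_uniq.
  - by rewrite size_take_min (minn_idPl KL).
  - by move=> x /mem_take /LP.
pose s2 := [seq (i, x) | i <- s, x <- L i].
have s2P i x : (i, x) \in s2 -> i \in s /\ x \in L i.
  by move=> /allpairsPdep[i' [x' [? ? [-> ->]]]].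
have us2 : uniq s2.
  apply: allpairs_uniq_dep => //; first by move=> i /LP[].
  by move=> [i x] [j y] _ _ /= [-> ->].
have sz : size s2 = (size s * K.+1)%N.
  rewrite size_allpairs_dep; move: (LP); clear -s; elim: s => // i s IH LP /=.
  rewrite mulSn IH; last by move=> j js; apply: LP; rewrite inE js orbT.
  by case: (LP i); rewrite ?mem_head // => _ ->.
have : (size s2 <= 2 * @chord_hull_bound R D (size fw) * n.+1)%N.
  apply: (@atmost_inj _ _ _ (fun p => p \in s2) _ snd _ _ chord_trace_atmost) => //.
    by move=> [i x] /s2P[/LP[_ _ hL] /hL[]].
  move=> [i x] [j y] /s2P[is_ ix] /s2P[js jy] /= exy; rewrite -{}exy in jy *.
  have [_ _ /(_ x ix)[_ [v [sv hv lv]]]] := LP i is_.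
  have [_ _ /(_ x jy)[_ [v' [sv' hv' lv']]]] := LP j js.
  congr pair; apply: inj_path; [exact: (hs i is_).1|exact: (hs j js).1|].
  by rewrite -lv -lv'; apply: good_label => //; rewrite hv hv'.
rewrite sz /heavy_bound; have : (0 < @chord_hull_bound R D (size fw))%N by [].
by move: (chord_hull_bound _ _) (size s) => x y; nia.
Qed.

(** The segment inserted at i traces, in one of its two directions, a copy of f^4 whose label places
    it at position j; everything is translated so that the segment runs from 1 to F. *)
Definition conflict (i j : nat) : Prop := exists v, [/\ (size v <= R2)%N,
  tr e F (h v) \/ tr F e (h v) & h0 v = ((h0 (take i w))^-1 * h0 (take j w))%g].

Lemma conflict_atmost i : (i <= n)%N ->
  atmost (2 * D2) (fun j => (j <= n)%N /\ (conflict i j \/ conflict j i)).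
Proof.
move=> ni; pose bars x := tr e F x \/ tr F e x.
have sF : d e F <= li%:R.
  by rewrite -weval_pow; apply: (le_trans (letter_dist _)); rewrite size_wpow.
have hT x y : d x y <= li%:R -> atmost (D * (2 * li + 1)) (tr x y).
  move=> sxy; have hc : atmost (D * (2 * li + 1)) (traced (d := d) (1 / 125) f x y).
    by apply: (traced_count dM H thf _ _ sxy); [lra|apply: lt_le_trans lf; lra].
  apply: atmost_sub (leqnn _) _ hc => q tq.
  by have [] := traced4_points H dM ff lf tq.
have hb : atmost D2 bars.
  rewrite /insertion_trace_bound mul2n -addnn; have hb1 := hT _ _ sF.
  by rewrite (hdC H) in sF; exact: atmost_or hb1 (hT _ _ sF).
have key (Q : nat -> nat -> Prop) (u : nat -> nat -> G) :
  (forall j k, (j <= n)%N -> (k <= n)%N -> u i j = u i k -> j = k) ->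
  (forall j, Q i j -> exists v, [/\ (size v <= R2)%N, bars (h v) & h0 v = u i j]) ->
  atmost D2 (fun j => (j <= n)%N /\ Q i j).
  move=> uinj hQ.
  have /choice[v vP] : forall j, exists v, Q i j ->
      [/\ (size v <= R2)%N, bars (h v) & h0 v = u i j].
    by move=> j; have [/hQ[v hv]|] := pselect (Q i j); [exists v|exists [::]].
  apply: (@atmost_inj _ _ _ _ _ (fun j => h (v j)) _ _ hb).
    by move=> j [_ /vP[]].
  move=> j k [nj /vP[s1 _ e1]] [nk /vP[s2 _ e2]] ejk; apply: uinj => //.
  by rewrite -e1 -e2; apply: good_label.
rewrite mul2n -addnn.
apply: (@atmost_sub _ _ _ _ _ _ _ (atmost_or
  (@key conflict (fun i j => (h0 (take i w))^-1 * h0 (take j w))%g _ _)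
  (@key (fun i j => conflict j i) (fun i j => (h0 (take j w))^-1 * h0 (take i w))%g _ _))) => //.
- by move=> j [nj [c|c]]; [left|right].
- by move=> j k nj nk /mulgI; exact: inj_path.
- by move=> j k nj nk /mulIg/invg_inj; exact: inj_path.
Qed.

(* A side of a polygon in G: a translate, by an element of the kernel of h0,
   of a chord from 1 to a vertex of w or of an inserted segment that does not
   conflict with the one at position i. *)
Definition side (i : nat) (x y : G) : Prop := exists u b,
  [/\ (size u <= 5 * n + 4 * li)%N, h0 u = 1%g, (b <= n)%N &
  let g := h u in
  [\/ (x, y) = (g, (g * P b)%g), (x, y) = ((g * P b)%g, g),
      ~ conflict b i /\ (x, y) = ((g * P b)%g, (g * P b * F)%g) |
      ~ conflict b i /\ (x, y) = ((g * P b * F)%g, (g * P b)%g)]].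

(** The loop is closed by the segment inserted at i. Each block of its periods is traced by some
    side, so one side traces more than K blocks. If that side is a chord, i is heavy; if it is a
    segment inserted at b, then b conflicts with i. *)
Lemma no_loop i N (v : nat -> G) : (i <= n)%N -> ~ heavy i -> (0 < N <= 11)%N ->
  v 0%N = (P i * F)%g -> v N = P i ->
  (forall j, (j < N)%N -> side i (v j) (v j.+1)) -> False.
Proof.
move=> ni nh /andP[N0 N11] v0 vN sv.
have pt g : exists p : nat * nat, (g < 11 * K + 1)%N ->
    [/\ (p.1 < N)%N, (p.2 < 60)%N & tr (v p.1.+1) (v p.1) (P i * f ^+ (60 * g + p.2))%g].
  have [gK|gK] := ltnP g (11 * K + 1); last by exists (0, 0)%N.
  have [||j [m [jN mN tm]]] := @polygon_trace _ _ d H dM f ff lf (P i * f ^+ (60 * g))%g v N.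
  - rewrite vN -mulgA -expgSr -{2}[P i]mulg1.
    apply: (@le_trans _ _ (3 / 500)); last by clear - H dM ff lf da thf f0 good; lra.
    by apply: (@col3 _ _ d H dM f ff lf (P i) 0 (60 * g) (60 * g).+1); rewrite leq0n leqnSn.
  - rewrite v0 -!mulgA -!expgnDr addnS.
    have c := @col3 _ _ d H dM f ff lf (P i) (60 * g + 5 * N) (60 * g + 5 * N).+1 nr.
    have {c} c : gp (P i * f ^+ (60 * g + 5 * N).+1)%g (P i * f ^+ (60 * g + 5 * N))%g
        (P i * F)%g <= 3 / 500.
      by apply: c; rewrite leqnSn /insertion_count /=; move: gK N11; clear; lia.
    have k := gpKr H (P i * f ^+ (60 * g + 5 * N))%g (P i * F)%g (P i * f ^+ (60 * g + 5 * N).+1)%g.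
    rewrite (step_dist dM) in k.
    by move: k c lf; clear -H dM ff lf da thf; lra.
  exists (j, m.+1) => _; split=> //=.
    by apply: leq_ltn_trans mN _; move: N11; clear; lia.
  by rewrite expgnDr mulgA.
have {pt} /choice[p pP] := pt.
have [|s [j0 [us Ks j0N sP]]] := @pigeonhole (fun g => (p g).1) 11 K.
  by move=> g /pP[h1 _ _]; apply: leq_trans N11.
have {j0N} j0N : (j0 < N)%N.
  by case: s us Ks sP => // g s _ _ /(_ g (mem_head _ _))[/pP[+ _ _] <-].
pose E g := (60 * g + (p g).2)%N.
have Einj g g' : g \in s -> g' \in s -> E g = E g' -> g = g'.
  move=> /sP[/pP[_ h1 _] _] /sP[/pP[_ h2 _] _]; rewrite /E.
  by move: h1 h2; move: (p g).2 (p g').2; clear; lia.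
have Elt g : g \in s -> (E g * size fw <= li)%N.
  move=> /sP[h1 _]; have [_ h2 _] := pP g h1; rewrite /insertion_len leq_mul2r; apply/orP; right.
  by rewrite /insertion_count /E; move: h1 h2; move: (p g).2; clear; lia.
have trE g : g \in s -> tr (v j0.+1) (v j0) (P i * f ^+ E g)%g.
  by move=> /sP[/pP[_ _ t] <-].
have [u [b [su u1 nb hside]]] := sv j0 j0N.
pose wd (z : word) g := winv z ++ take i w ++ wpow fw (E g).
have hwd z g : h (wd z g) = ((h z)^-1 * (P i * f ^+ E g))%g.
  by rewrite !weval_cat weval_inv weval_pow.
have h0wd z g : h0 (wd z g) = ((h0 z)^-1 * h0 (take i w))%g.
  rewrite !weval_cat weval_inv weval_pow f0.
  by rewrite expg1n mulg1.
(* The radius 8 (n + li) of [good_label] has room for the kernel element of a side, two prefixes of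
   w and a part of the inserted word: 7 n + 5 li in all. *)
have swd z g : g \in s -> (size z <= 6 * n + 4 * li)%N -> (size (wd z g) <= R2)%N.
  move=> gs sz; have := Elt g gs; rewrite /wd !size_cat size_winv size_wpow.
  have := size_take_min i w; have := geq_minl i n; have := geq_minr i n => m1 m2 ->.
  by move: sz m1; clear; lia.
have chord : (forall x, tr (v j0.+1) (v j0) x -> chord_trace ((h u)^-1 * x)%g) -> False.
  move=> hc; apply: nh; exists [seq h (wd u g) | g <- s]; split.
  - rewrite map_inj_in_uniq // => g g' gs gs'; rewrite !hwd => /mulgI/mulgI.
    by move=> /(pow_inj H dM ff lf); exact: Einj.
  - by rewrite size_map.
  move=> _ /mapP[g gs ->]; split; first by rewrite hwd; apply/hc/trE.
  exists (wd u g); split=> //; last by rewrite h0wd u1 invg1 mul1g.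
  by apply: swd => //; move: su; clear; lia.
have conf : (forall x, tr (v j0.+1) (v j0) x ->
     tr e F ((h u * P b)^-1 * x)%g \/ tr F e ((h u * P b)^-1 * x)%g) ->
    conflict b i.
  move=> hc; case: s Ks {us sP Einj Elt swd} trE (swd) => // g s _ trE sw.
  exists (wd (u ++ take b w) g); split.
  - apply: sw; rewrite ?mem_head // size_cat size_take_min.
    by have := geq_minr b n; move: su; clear; lia.
  - by rewrite hwd weval_cat; apply/hc/trE; rewrite mem_head.
  - by rewrite h0wd weval_cat u1 mul1g.
have trl z x y q : tr (z * x)%g (z * y)%g q -> tr x y (z^-1 * q)%g.
  by move=> h; apply/(tracedM (d := d) dM _ _ _ _ _ z); rewrite mulVKg.
case: hside => [[ex ey]|[ex ey]|[nc [ex ey]]|[nc [ex ey]]].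
- apply: chord => x; rewrite ex ey -{2}[h u]mulg1 => /trl t; exists b => //; by right.
- apply: chord => x; rewrite ex ey -{1}[h u]mulg1 => /trl t; exists b => //; by left.
- apply/nc/conf => x; rewrite ex ey -{2}[(h u * P b)%g]mulg1 => /trl t; by right.
- apply/nc/conf => x; rewrite ex ey -{1}[(h u * P b)%g]mulg1 => /trl t; by left.
Qed.

Definition conjugated_word (i : nat) : word := take i w ++ Fw ++ winv (take i w).
Local Notation X i := (P i * F * (P i)^-1)%g.

Lemma conjugated_wordE i : h (conjugated_word i) = X i.
Proof. by rewrite /conjugated_word weval_cat weval_cat weval_inv weval_pow mulgA. Qed.

Lemma conjugated_word0 i : h0 (conjugated_word i) = 1%g.
Proof.
by rewrite /conjugated_word weval_cat weval_cat weval_inv weval_pow f0 expg1n mul1g mulgV.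
Qed.

Lemma size_conjugated_word i : (size (conjugated_word i) <= 2 * n + li)%N.
Proof.
rewrite /conjugated_word 2!size_cat size_winv size_wpow -/li size_take_min.
by have := geq_minr i n; clear; lia.
Qed.

(** Both sides of the equation are paths of chords and inserted segments starting at 1. Following
    one forward and the other back, with the segment at i left out, gives a loop of 11 sides; if i =
    i', cancelling X i leaves a loop of 5 sides at j. *)
Lemma insertion_inj i j i' j' :
  (forall k, k \in [:: i; j; i'; j'] -> (k <= n)%N /\ ~ heavy k) ->
  (forall k m, k \in [:: i; j; i'; j'] -> m \in [:: i; j; i'; j'] -> k != m ->
    ~ conflict k m) ->
  i != j -> i != j' -> i' != j -> i' != j' ->
  (X i * X j = X i' * X j')%g -> i = i' /\ j = j'.
Proof.
move=> hn hc ij ij' i'j i'j' E.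
have XP k : (X k * P k = P k * F)%g by rewrite mulgVK.
have [ni nhi] := hn i (mem_head _ _).
have [nj nhj] : (j <= n)%N /\ ~ heavy j by apply: hn; rewrite !inE eqxx !orbT.
have [ni' _] : (i' <= n)%N /\ ~ heavy i' by apply: hn; rewrite !inE eqxx !orbT.
have [nj' _] : (j' <= n)%N /\ ~ heavy j' by apply: hn; rewrite !inE eqxx !orbT.
have sw0 : (@size ('I_l * bool) [::] <= 5 * n + 4 * li)%N by [].
have sw1 k : (size (conjugated_word k) <= 5 * n + 4 * li)%N.
  by apply: leq_trans (size_conjugated_word k) _; clear; lia.
have sw2 k m : (size (conjugated_word k ++ conjugated_word m) <= 5 * n + 4 * li)%N.
  rewrite size_cat; have := size_conjugated_word k; have := size_conjugated_word m; clear; lia.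
have h2 k m : h0 (conjugated_word k ++ conjugated_word m) = 1%g by rewrite weval_cat !conjugated_word0 mulg1.
have e2 k m : h (conjugated_word k ++ conjugated_word m) = (X k * X m)%g by rewrite weval_cat !conjugated_wordE.
have e0 : h [::] = 1%g by rewrite /weval big_nil.
have e00 : h0 [::] = 1%g by rewrite /weval big_nil.
have [ii|ii] := eqVneq i i'.
  split=> //; rewrite -{}ii in E *; move/mulgI: E => E.
  have [//|jj] := eqVneq j j'; exfalso.
  have ncj : ~ conflict j' j.
    by apply: hc; rewrite ?inE ?eqxx ?orbT // eq_sym.
  apply: (@no_loop j 5 (nth e [:: P j * F; X j; P j' * F; P j'; e; P j]%g)) => //.
  move=> [|[|[|[|[|//]]]]] _ /=.
  - exists (conjugated_word j), j; split=> //; first exact: conjugated_word0.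
    by apply: Or42; rewrite /= conjugated_wordE XP.
  - exists (conjugated_word j'), j'; split=> //; first exact: conjugated_word0.
    by apply: Or41; rewrite /= conjugated_wordE XP E.
  - by exists [::], j'; split=> //; apply: Or44; rewrite /= e0 mul1g.
  - by exists [::], j'; split=> //; apply: Or42; rewrite /= e0 mul1g.
  - by exists [::], j; split=> //; apply: Or41; rewrite /= e0 mul1g.
exfalso.
have nc1 : ~ conflict j i by apply: hc; rewrite ?inE ?eqxx ?orbT // eq_sym.
have nc2 : ~ conflict j' i by apply: hc; rewrite ?inE ?eqxx ?orbT // eq_sym.
have nc3 : ~ conflict i' i by apply: hc; rewrite ?inE ?eqxx ?orbT // eq_sym.
apply: (@no_loop i 11 (nth e [:: P i * F; X i; X i * P j; X i * P j * F; X i * X j;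
  X i' * P j' * F; X i' * P j'; X i'; P i' * F; P i'; e; P i]%g)) => //.
move=> [|[|[|[|[|[|[|[|[|[|[|//]]]]]]]]]]] _ /=.
- exists (conjugated_word i), i; split=> //; first exact: conjugated_word0.
  by apply: Or42; rewrite /= conjugated_wordE XP.
- exists (conjugated_word i), j; split=> //; first exact: conjugated_word0.
  by apply: Or41; rewrite /= conjugated_wordE.
- exists (conjugated_word i), j; split=> //; first exact: conjugated_word0.
  by apply: Or43; rewrite /= conjugated_wordE.
- exists (conjugated_word i ++ conjugated_word j), j; split=> //.
  by apply: Or42; rewrite /= e2 -[(X i * X j * P j)%g]mulgA XP [(X i * (P j * F))%g]mulgA.
- exists (conjugated_word i' ++ conjugated_word j'), j'; split=> //.
  by apply: Or41; rewrite /= e2 -[(X i' * X j' * P j')%g]mulgA XP [(X i' * (P j' * F))%g]mulgA E.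
- exists (conjugated_word i'), j'; split=> //; first exact: conjugated_word0.
  by apply: Or44; rewrite /= conjugated_wordE.
- exists (conjugated_word i'), j'; split=> //; first exact: conjugated_word0.
  by apply: Or42; rewrite /= conjugated_wordE.
- exists (conjugated_word i'), i'; split=> //; first exact: conjugated_word0.
  by apply: Or41; rewrite /= conjugated_wordE XP.
- by exists [::], i'; split=> //; apply: Or44; rewrite /= e0 mul1g.
- by exists [::], i'; split=> //; apply: Or42; rewrite /= e0 mul1g.
- by exists [::], i; split=> //; apply: Or41; rewrite /= e0 mul1g.
Qed.

Lemma good_positions : exists I : seq nat, [/\ uniq I, sorted leq I,
  forall i, i \in I -> (i <= n)%N /\ ~ heavy i,
  forall i j, i \in I -> j \in I -> i != j -> ~ conflict i j &
  (7 * n.+1 <= 8 * ((2 * D2).+1 * size I))%N].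
Proof.
pose s := iota 0 n.+1; pose hv i := `[< heavy i >].
have us : uniq s by exact: iota_uniq.
have sn i : i \in s -> (i <= n)%N by rewrite mem_iota add0n ltnS.
have [||I [uI Is sI cI]] := @independent_subset conflict (2 * D2) [seq i <- s | ~~ hv i].
- exact: filter_uniq.
- move=> i; rewrite mem_filter => /andP[_ /sn ni].
  apply: atmost_sub (leqnn _) _ (conflict_atmost ni) => j [].
  by rewrite mem_filter => /andP[_ /sn].
exists (sort leq I); split.
- by rewrite sort_uniq.
- by apply: sort_sorted; exact: leq_total.
- by move=> i; rewrite mem_sort => /Is; rewrite mem_filter => /andP[/asboolPn nh /sn].
- by move=> i j; rewrite !mem_sort; exact: cI.
rewrite size_sort; have := @heavy_atmost [seq i <- s | hv i].
rewrite filter_uniq // => /(_ isT) hs.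
have {hs} : (8 * size [seq i <- s | hv i] <= n.+1)%N.
  by apply: hs => i; rewrite mem_filter => /andP[/asboolP hi /sn].
have := count_predC hv s; rewrite size_iota; move: sI; rewrite !size_filter.
rewrite -/(predC hv) [count (fun _ => _) s](_ : _ = count (predC hv) s) //.
move: (size I) (count _ _) (count _ _) => x y z; clear; nia.
Qed.

Definition inserted_word (i j : nat) : word :=
  take i w ++ Fw ++ drop i (take j w) ++ Fw ++ drop j w.

Lemma inserted_wordE (b : 'I_l -> G) i j : (i <= j)%N -> weval b (inserted_word i j) =
  (weval b (take i w) * weval b Fw * (weval b (take i w))^-1 *
   (weval b (take j w) * weval b Fw * (weval b (take j w))^-1) * weval b w)%g.
Proof.
move=> ij; rewrite /inserted_word weval_cat weval_cat weval_cat weval_cat.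
have E1 : (weval b (drop i (take j w)) = (weval b (take i w))^-1 * weval b (take j w))%g.
  by rewrite -{2}(cat_take_drop i (take j w)) take_takel // weval_cat mulKg.
have E2 : (weval b (drop j w) = (weval b (take j w))^-1 * weval b w)%g.
  by rewrite -{3}(cat_take_drop j w) weval_cat mulKg.
by rewrite E1 E2 !mulgA.
Qed.

Lemma insertion_words (q : nat) : (16 * ((2 * D2).+1 * q) <= 7 * n.+1)%N ->
  exists T : seq word, [/\ (q * q <= size T)%N, uniq (map h T) &
    forall v, v \in T -> (size v <= n + 2 * li)%N /\ h0 v = h0 w].
Proof.
move=> hq; have [I [uI sI nI cI zI]] := good_positions.
have q2 : (2 * q <= size I)%N.
  have : (8 * ((2 * D2).+1 * (2 * q)) <= 8 * ((2 * D2).+1 * size I))%N.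
    by apply: leq_trans zI; move: hq; clear; lia.
  by rewrite leq_mul2l /= leq_mul2l.
(* With i from the first q positions and j from the others, i < j always holds and the two families
   stay disjoint, as [insertion_inj] requires. *)
pose I1 := take q I; pose I2 := drop q I.
have lI i j : i \in I1 -> j \in I2 -> (i <= j)%N /\ i != j.
  move=> i1 j2; split.
    have := sI; rewrite sorted_pairwise; last exact: leq_trans.
    rewrite -(cat_take_drop q I) pairwise_cat => /and3P[/allrelP hr _ _].
    exact: hr.
  apply/eqP => ij; have := uI; rewrite -(cat_take_drop q I) cat_uniq.
  by case/and3P=> _ /hasPn /(_ j j2) /negP + _; rewrite -ij; apply.
have m1 i : i \in I1 -> i \in I by move=> /mem_take.
have m2 i : i \in I2 -> i \in I by move=> /mem_drop.
have sz1 : size I1 = q by rewrite size_take_min (minn_idPl _) //; move: q2; clear; lia.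
exists [seq inserted_word i j | i <- I1, j <- I2]; split.
- rewrite size_allpairs sz1 size_drop leq_mul2l; apply/orP; right.
  by move: q2; clear; lia.
- rewrite map_allpairs; apply: allpairs_uniq.
  + exact: take_uniq.
  + exact: drop_uniq.
  move=> [i j] [i' j'] /allpairsP[[x y] [/= x1 y1 [-> ->]]].
  move=> /allpairsP[[x' y'] [/= x1' y1' [-> ->]]] {i j i' j'}.
  have [xy xyn] := lI x y x1 y1; have [xy' xyn'] := lI x' y' x1' y1'.
  have [_ n1] := lI x y' x1 y1'; have [_ n2] := lI x' y x1' y1.
  rewrite !inserted_wordE // !weval_pow => /mulIg hE.
  have hI k : k \in [:: x; y; x'; y'] -> k \in I.
    rewrite !inE => /or4P[] /eqP->; [exact: m1|exact: m2|exact: m1|exact: m2].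
  have [||||||-> ->] := insertion_inj _ _ _ _ _ _ hE => //.
  + by move=> k /hI/nI.
  + by move=> k k' /hI kI /hI kI'; exact: cI.
move=> _ /allpairsP[[i j] [/= i1 j2 ->]]; have [ij _] := lI i j i1 j2; split.
  rewrite /inserted_word 4!size_cat !size_wpow -/li size_drop !size_take_min size_drop.
  have [jn _] := nI j (m2 _ j2); rewrite (minn_idPl jn) (minn_idPl (leq_trans ij jn)).
  by move: ij jn; clear; lia.
have F1 : h0 Fw = 1%g.
  by rewrite weval_pow f0 expg1n.
by rewrite inserted_wordE // F1 !mulg1 !mulgV !mul1g.
Qed.

End Insertion.

Lemma map_uniq_inj (A B : eqType) (f : A -> B) (s : seq A) : uniq (map f s) ->
  {in s &, injective f}.
Proof.
elim: s => //= z s IH /andP[fz us] x y; rewrite !inE.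
move=> /predU1P[->|xs] /predU1P[->|ys] // E.
- by rewrite E map_f in fz.
- by rewrite -E map_f in fz.
exact: IH.
Qed.

(** * Lower bound for balls from inserted relations *)

Section Tightness.
Context {R : realType} {l : nat}.
Local Notation word := (seq ('I_l * bool)).

(** The inserted relation depends on the marking; only its length is bounded, by 8 c + 2 U, for
    eight factors A_i^(+-1) and two factors u. The maximum over all such lengths is a constant that
    can be fixed before the marking is chosen. *)
Definition tight_len (c D U : nat) : nat :=
  \max_(s < (8 * c + 2 * U).+1) @insertion_len R D s.

Definition tight_rate (c D U : nat) : nat :=
  16 * (2 * \max_(s < (8 * c + 2 * U).+1) @insertion_trace_bound R D s).+1.

Context {G : groupType} {c D U : nat} {S : set G} {d : G -> G -> R} {A : 'I_3 -> G}.
Context (a a0 : 'I_l -> G) (u : word).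
Hypothesis sep : separators c D S d A.
Hypothesis Sa : forall i, S (a i).
Hypothesis SV : forall s, S s -> S s^-1%g.
Hypothesis Sw : forall n g, word_ball S n g -> exists w, (size w <= n)%N /\ weval a w = g.
Hypothesis uU : (size u <= U)%N.
Hypothesis u0 : weval a0 u = 1%g.
Hypothesis ut : ~ tame (A := A) (d := d) (weval a u).

Lemma loop_word : exists fw : word, [/\ (size fw <= 8 * c + 2 * U)%N,
  weval a0 fw = 1%g, gp d 1%g (weval a fw)^-1%g (weval a fw) <= 1 / 250,
  9 / 10 <= d 1%g (weval a fw) & thin (d := d) D (9 / 10) (weval a fw)].
Proof.
have [i [ff lf thf]] := nontame_loop sep ut.
have /choice[v vP] : forall k, exists v : word, (size v <= c)%N /\ weval a v = A k.
  by move=> k; apply/Sw/(sep_ball sep).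
set i0 : 'I_3 := inord 0; set i1 : 'I_3 := inord 1.
pose fw := v i0 ++ v i ++ u ++ winv (v i) ++ winv (v i0) ++
           v i1 ++ v i ++ u ++ winv (v i) ++ winv (v i1).
have fE (b : 'I_l -> G) : weval b fw = (weval b (v i0) * weval b (v i) * weval b u *
    (weval b (v i))^-1 * (weval b (v i0))^-1 * weval b (v i1) * weval b (v i) *
    weval b u * (weval b (v i))^-1 * (weval b (v i1))^-1)%g.
  by rewrite /fw !weval_cat !weval_inv !mulgA.
have E : weval a fw = loop_elt (A := A) i (weval a u).
  rewrite fE /loop_elt !big_cons big_nil mulg1 -/i0 -/i1.
  by rewrite (vP i0).2 (vP i1).2 (vP i).2 !mulgA.
exists fw; rewrite E; split=> //.
  rewrite /fw !size_cat !size_winv.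
  by have := (vP i0).1; have := (vP i1).1; have := (vP i).1; move: uU; clear; lia.
by rewrite fE u0 !mulg1 !mulgK mulgV.
Qed.

(* The products x_i x_j w are separated by w under a0, since f is a relation of a0,
   and by (i, j) under a. *)
Lemma tight_ball (m n0 q : nat) (Ws : seq word) :
  (forall v, (size v <= 16 * (m + tight_len c D U))%N -> weval a v = 1%g ->
     weval a0 v = 1%g) ->
  uniq (map (weval a0) Ws) ->
  (forall w, w \in Ws -> (n0 <= size w <= m)%N /\
     forall i j, (i <= size w)%N -> (j <= size w)%N ->
       weval a0 (take i w) = weval a0 (take j w) -> i = j) ->
  (tight_rate c D U * q <= 7 * n0.+1)%N -> finite_set S ->
  (size Ws * (q * q) <= ball_size S (m + 2 * tight_len c D U))%N.
Proof.
move=> good uW hW hq fS.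
have [fw [sf f0 ff lf thf]] := loop_word.
have H := sep_hyp sep; have dM := sep_inv sep.
have da i : d 1%g (a i) <= 1 by apply: (sep_gen sep).
pose s0 : 'I_(8 * c + 2 * U).+1 := Ordinal (sf : (size fw < (8 * c + 2 * U).+1)%N).
have ll : (@insertion_len R D (size fw) <= tight_len c D U)%N.
  exact: (@leq_bigmax _ (fun s : 'I_(8 * c + 2 * U).+1 => @insertion_len R D s) s0).
have lb : (@insertion_trace_bound R D (size fw) <=
    \max_(s < (8 * c + 2 * U).+1) @insertion_trace_bound R D s)%N.
  exact: (@leq_bigmax _ (fun s : 'I_(8 * c + 2 * U).+1 => @insertion_trace_bound R D s) s0).
have /choice[T TP] : forall w, exists T : seq word, w \in Ws ->
    [/\ (q * q <= size T)%N, uniq (map (weval a) T) &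
    forall v, v \in T -> (size v <= m + 2 * tight_len c D U)%N /\ weval a0 v = weval a0 w].
  move=> w; have [wW|nW] := boolP (w \in Ws); last by exists [::].
  have [/andP[n0w wm] inj] := hW w wW.
  have [||T [T1 T2 T3]] := @insertion_words R G l d a a0 fw w D H dM da ff lf thf f0 inj _ q.
  - move=> v sv; apply: good; apply: leq_trans sv _.
    by move: wm ll; clear; move: (insertion_len _ _) (tight_len _ _ _) (size w) => x y z; lia.
  - apply: leq_trans (leq_trans hq _); last by rewrite leq_mul2l.
    rewrite /tight_rate mulnA leq_mul2r leq_mul2l ltnS leq_mul2l lb.
    by rewrite !orbT.
  exists T => _; split=> // v /T3[sv ->]; split=> //.
  apply: leq_trans sv _; move: wm ll; clear.
  by move: (insertion_len _ _) (tight_len _ _ _) (size w) => x y z; lia.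
pose T' w := take (q * q) (T w).
pose l2 := [seq (w, v) | w <- Ws, v <- T' w].
have l2P w v : (w, v) \in l2 -> w \in Ws /\ v \in T w.
  by move=> /allpairsPdep[w' [v' [? /mem_take ? [-> ->]]]].
have uWs : uniq Ws := map_uniq uW.
have sz : size l2 = (size Ws * (q * q))%N.
  rewrite size_allpairs_dep; move: TP; rewrite /T'; clear; elim: Ws => // w Ws IH TP /=.
  rewrite mulSn IH; last by move=> v vs; apply: TP; rewrite inE vs orbT.
  by case: (TP w); rewrite ?mem_head // => h _ _; rewrite size_take_min (minn_idPl h).
rewrite -sz; have fB := finite_atmost (word_ball_finite (m + 2 * tight_len c D U) fS).
apply: (@atmost_inj _ _ _ (fun p => p \in l2) _ (fun p => weval a p.2) _ _ fB) => //.
- move=> [w v] /l2P[/TP[_ _ h] /h[sv _]] /=; exact: weval_ball.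
- move=> [w v] [w' v'] /l2P[wW vT] /l2P[wW' vT'] /= e.
  have [_ uT hT] := TP w wW; have [_ _ hT'] := TP w' wW'.
  have [sv lv] := hT v vT; have [sv' lv'] := hT' v' vT'.
  have ew : weval a0 v = weval a0 v'.
    have E0 : weval a0 (winv v ++ v') = 1%g.
      apply: good; last by rewrite weval_cat weval_inv e mulVg.
      by rewrite size_cat size_winv; move: sv sv'; clear; move: (tight_len _ _ _) (size v) (size v') => x y z; lia.
    by rewrite -[LHS]mulg1 -E0 weval_cat weval_inv mulVKg.
  have {ew} ew : w = w'.
    by apply: (map_uniq_inj uW) => //; rewrite -lv -lv'.
  by rewrite -{}ew in vT' *; congr pair; exact: (map_uniq_inj uT).
- apply: allpairs_uniq_dep => //.
    by move=> w /TP[_ uT _]; exact/take_uniq/(map_uniq uT).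
  by move=> [w v] [w' v'] _ _ /= [-> ->].
Qed.

End Tightness.

(** * Axes of elements of a group with a hyperbolic distance *)

Lemma seq_argmax (R : realType) (A : eqType) (f : A -> R) (l : seq A) x0 :
  x0 \in l -> exists2 x, x \in l & forall y, y \in l -> f y <= f x.
Proof.
elim: l x0 => // z l IH x0 _; case: l IH => [|y0 l] IH.
  by exists z; rewrite ?mem_head // => y; rewrite inE => /eqP ->.
have [x xl hx] := IH y0 (mem_head _ _).
have [h|/ltW h] := leP (f z) (f x).
  exists x; first by rewrite inE xl orbT.
  by move=> y; rewrite inE => /predU1P[->|/hx].
exists z; first exact: mem_head.
by move=> y; rewrite inE => /predU1P[->|/hx/le_trans]; last exact.
Qed.

Section Axis.
Context {R : realType} {G : groupType} {d : G -> G -> R}.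
Hypothesis H : hyp_dist 1 d.
Hypothesis dM : forall t g h, d (t * g)%g (t * h)%g = d g h.
Local Notation gp := (gp d).
Local Notation e := (1%g : G).

Lemma mid_move P Q x t r k : d P (t * P)%g <= r -> d Q (t * Q)%g <= r ->
  gp x P Q <= k -> d x (t * x)%g <= r + 2 * k + 2.
Proof.
move=> h1 h2 h3.
have := conv_dist H h3 (dM t P Q) (dM t P x) (dM t Q x) h1 h2.
lra.
Qed.

Lemma swap_end x P P' Q k r : gp x P Q <= k -> d P P' <= r -> k + r + 1 < d x P ->
  gp x P' Q <= k + 1.
Proof.
move=> h1 h2 h3; case: (gp_or H x Q P' P); rewrite ?(gpC H x Q P) ?(gpC H x Q P').
  by move: h1; clear; lra.
have t := hdT H x P' P; have s := hdC H P P'.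
by rewrite {1}/gp; move: h1 h2 h3 t s; clear; lra.
Qed.

Lemma swap_ends x P P' Q Q' k r : gp x P Q <= k -> d P P' <= r -> d Q Q' <= r ->
  k + r + 2 < d x P -> k + r + 2 < d x Q -> gp x P' Q' <= k + 2.
Proof.
move=> h1 h2 h3 h4 h5.
have h : gp x P' Q <= k + 1 by apply: swap_end h1 h2 _; move: h4; clear; lra.
rewrite (gpC H) in h; rewrite (gpC H).
by have := swap_end h h3; move: h5; clear; lra.
Qed.

Context {p : G}.
Hypothesis hp : gp e p^-1%g p <= 15.
Hypothesis lp : 1000 <= d e p.

Lemma axis_gp m n : gp e (p ^- m)%g (p ^+ n)%g <= 17.
Proof.
have h : 2 * 15 + 3 * 1 < d e p by move: (lp : 1000 <= d e p); lra.
by have := gp_pow H dM m n hp h; clear - H dM hp lp; lra.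
Qed.

Lemma axis_mid i n : (i <= n)%N -> gp (p ^+ i)%g e (p ^+ n)%g <= 17.
Proof. exact: (pow_mid dM axis_gp). Qed.

Lemma axis_len n : n%:R * (d e p / 2) <= d e (p ^+ n)%g.
Proof. by apply: (pow_len H dM axis_gp); move: (lp : 1000 <= d e p); lra. Qed.

Lemma axis_lenN n : d e (p ^- n)%g = d e (p ^+ n)%g.
Proof. exact: (dV H dM). Qed.

Lemma axis_far (x : R) : exists K, forall n, (K <= n)%N -> x < d e (p ^+ n)%g.
Proof. by apply: (pow_far H dM axis_gp (r := d e p / 2)); move: (lp : 1000 <= d e p); lra. Qed.

(* The maximal displacement of an element of F on the axis of p is small since
   the square of an element with a large shift would have twice its shift. *)
Lemma finite_normal_bound (F : G -> Prop) k n D : atmost k F ->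
  (forall s t, F s -> F t -> F (s * t)%g) ->
  (forall g t, F t -> F (g^-1 * t * g)%g) ->
  atmost D (fun t => d e t <= 82 /\ d (p ^+ n)%g (t * p ^+ n)%g <= 82) ->
  atmost D F.
Proof.
move=> /atmost_finite[/finite_enum[l [ul Fl _]] _] FM FJ hD.
apply: atmost_sub (leqnn _) _ hD => t0 /[dup] Ft0 /Fl t0l.
have [t tl tmax] := seq_argmax (d e) t0l.
move: tl => /Fl Ft.
suff dt : d e t <= 82.
  split; first by apply: le_trans dt; exact: tmax.
  rewrite -(dM (p ^- n)%g) mulVg mulgA; apply: le_trans dt; apply/tmax/Fl.
  exact: FJ.
have FJ' g s : F s -> d g (s * g)%g <= d e t.
  by move=> Fs; rewrite -(dM g^-1%g) mulVg mulgA; apply/tmax/Fl/FJ.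
have [K /(_ K (leqnn K)) hK] := axis_far (6 * d e t + 100).
set P := (p ^- K)%g; set Q := (p ^+ K)%g.
have eP : d e P = d e Q by exact: axis_lenN.
have hax : gp e P Q <= 17 by exact: axis_gp.
have tt : d t (t * t)%g = d e t by rewrite -{1}[t]mulg1 dM.
have dPe := hdC H P e.
have tr1 := hdT H P t e; have tr2 := hdT H P (t * t)%g t.
have s1 := hdC H t e; have s2 := hdC H (t * t)%g t; have s3 := hdC H (t * t)%g e.
have d0 := hd_ge0 H e t.
have B : `|(d P (t * t)%g - d (t * P)%g (t * t)%g) - (d P t - d (t * P)%g t)| <= 2 * 1.
  apply: (@busemann _ _ _ _ H P (t * P)%g _ _ (d e t)); first exact: FJ'.
  rewrite /gp; move: hK eP dPe tr1 tr2 s1 s2 tt d0; rewrite -/Q; clear - H dM hp lp; lra.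
have e1 : d (t * P)%g t = d P e by rewrite -{2}[t]mulg1 dM.
rewrite dM e1 in B.
have gt : gp t P Q <= 19.
  have h : gp t (t * P)%g (t * Q)%g <= 17 by rewrite -{1}[t]mulg1 gpM.
  have e2 : d t (t * P)%g = d e P by rewrite -{1}[t]mulg1 dM.
  have e3 : d t (t * Q)%g = d e Q by rewrite -{1}[t]mulg1 dM.
  have {}h : gp t P Q <= 17 + 2.
    apply: (swap_ends h (r := d e t)); rewrite ?(hdC H (t * _)%g) ?FJ' ?e2 ?e3 ?eP //.
      by move: hK d0; rewrite -/Q; clear - H dM hp lp; lra.
    by move: hK d0; rewrite -/Q; clear - H dM hp lp; lra.
  by apply: (le_trans h); clear - H dM hp lp; lra.
have ld : d e t <= `|d P e - d P t| + 2 * 19 + 2 * 1.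
  by apply: (line_dist H (Q := Q)) gt; move: hax; clear - H dM hp lp; lra.
have := ler_norm (d P e - d P t); have := ler_norm (- (d P e - d P t)).
have [h|/ltW h] := leP 0 (d P e - d P t).
  rewrite (ger0_norm h) in ld *.
  move: B; rewrite ler_norml => /andP[B1 B2].
  have := hdT H P (t * t)%g e.
  move: ld B1 B2 d0 s3 (tmax _ ((Fl _).1 (FM _ _ Ft Ft))); clear - H dM hp lp; lra.
rewrite (ler0_norm h) in ld *.
move: B; rewrite ler_norml => /andP[B1 B2].
have := hdT H P e (t * t)%g.
move: ld B1 B2 d0 s3 (tmax _ ((Fl _).1 (FM _ _ Ft Ft))); clear - H dM hp lp; lra.
Qed.
End Axis.

Lemma commute_pow (G : groupType) (f a b : G) m : (f * a = b * f)%g -> (f * a ^+ m = b ^+ m * f)%g.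
Proof.
move=> h; elim: m => [|m IH]; first by rewrite !expg0 mulg1 mul1g.
by rewrite expgS mulgA h -mulgA IH mulgA -expgS.
Qed.

Section CyclicSubgroups.
Context {G : groupType}.
Implicit Types (P x y : G).

Lemma cyclic_subgroupP P x : cyclic_subgroup P x <-> exists a b, x = (P ^+ a * P ^- b)%g.
Proof.
split=> [[n [->|->]]|[a [b ->]]].
- by exists n, 0%N; rewrite expg0 invg1 mulg1.
- by exists 0%N, n; rewrite expg0 mul1g.
have [ab|/ltnW ba] := leqP a b; last first.
  by exists (a - b)%N; left; rewrite -{1}(subnK ba) expgnDr mulgK.
exists (b - a)%N; right.
by rewrite -{1}(subnK ab) expgnDr invgM mulVKg.
Qed.

Lemma cyclic_subgroupM P x y : cyclic_subgroup P x -> cyclic_subgroup P y ->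
  cyclic_subgroup P (x * y)%g.
Proof.
move=> /cyclic_subgroupP[a [b ->]] /cyclic_subgroupP[a' [b' ->]].
apply/cyclic_subgroupP; exists (a + a')%N, (b' + b)%N.
have h : (P ^- b * P ^+ a' = P ^+ a' * P ^- b)%g.
  by apply: (mulgI (P ^+ b)%g); rewrite mulVKg mulgA -expgnDr addnC expgnDr mulgK.
by rewrite !expgnDr invgM -!mulgA; congr (_ * _)%g; rewrite !mulgA h.
Qed.

Lemma cyclic_subgroupV P x : cyclic_subgroup P x -> cyclic_subgroup P x^-1%g.
Proof.
by case=> n [->|->]; exists n; [right|left]; rewrite ?invgK.
Qed.

Lemma coset_absorb P x y : cyclic_subgroup P y ->
  [set (x * y * h)%g | h in cyclic_subgroup P] = [set (x * h)%g | h in cyclic_subgroup P].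
Proof.
move=> Py; apply/seteqP; split=> _ [h Ph <-].
  by exists (y * h)%g; [exact: cyclic_subgroupM|rewrite mulgA].
exists (y^-1 * h)%g; last by rewrite mulgA mulgK.
exact/cyclic_subgroupM/Ph/cyclic_subgroupV.
Qed.

End CyclicSubgroups.

(** * Commensurating elements and separation of axes *)

Section Commensuration.
Context {R : realType} {G : groupType} {d : G -> G -> R}.
Hypothesis H : hyp_dist 1 d.
Hypothesis dM : forall t g h, d (t * g)%g (t * h)%g = d g h.
Local Notation gp := (gp d).
Local Notation e := (1%g : G).
Context {p : G}.
Hypothesis hp : gp e p^-1%g p <= 15.
Hypothesis lp : 1000 <= d e p.

Lemma near_power n f b : 17 <= b -> gp f e (p ^+ n)%g <= b ->
  d e f <= d e (p ^+ n)%g -> exists2 k, (k <= n)%N & d (p ^+ k)%g f <= d e p + 2 * b + 2.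
Proof.
move=> hb hf fn.
have ex : exists k, d e f <= d e (p ^+ k)%g by exists n.
have kn := ex_minnP ex; case: kn => k hk kmin.
have le_kn := kmin n fn.
exists k => //; apply: (le_trans (line_dist H (P := e) (Q := (p ^+ n)%g) _ hf)).
  by apply: le_trans hb; exact: (axis_mid H dM hp lp le_kn).
suff : `|d e (p ^+ k)%g - d e f| <= d e p by clear - H dM hp lp; lra.
rewrite ger0_norm ?subr_ge0 //.
case: k hk kmin {le_kn} => [|k] hk kmin.
  by rewrite expg0 (hd0 H); have := hd_ge0 H e f; have := hd_ge0 H e p; lra.
have : d e (p ^+ k)%g < d e f by rewrite ltNge; apply/negP => /kmin; rewrite ltnn.
have := hdT H e (p ^+ k)%g (p ^+ k.+1)%g.
have -> : d (p ^+ k)%g (p ^+ k.+1)%g = d e p.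
  by rewrite expgSr -{1}[(p ^+ k)%g]mulg1 dM.
clear - H dM hp lp; lra.
Qed.

(** For m a multiple of J, f moves p^-m and p^m only by d e f, up to exchanging them. For large m
    this puts f near the segment between them, and [near_power] finds the nearby power after
    translation by p^m. *)
Lemma near_axis f J : (0 < J)%N ->
  (f * p ^+ J = p ^+ J * f)%g \/ (f * p ^+ J = p ^- J * f)%g ->
  exists i j, d (p ^- i * p ^+ j)%g f <= d e p + 40.
Proof.
move=> J0 hf.
have [K hK] := axis_far H dM hp lp (d e f + 40).
pose m := (J * K)%N.
have {hK} hm : d e f + 40 < d e (p ^+ m)%g by apply: hK; rewrite leq_pmull.
have h0 : gp f (f * p ^- m)%g (f * p ^+ m)%g <= 17.
  by rewrite -{1}[f]mulg1 gpM //; exact: axis_gp.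
have hN : d e (p ^- m)%g = d e (p ^+ m)%g := axis_lenN H dM m.
have l1 : d f (f * p ^- m)%g = d e (p ^+ m)%g by rewrite -{1}[f]mulg1 dM.
have l2 : d f (f * p ^+ m)%g = d e (p ^+ m)%g by rewrite -{1}[f]mulg1 dM.
have cl (x y : G) : (f * x = y * f)%g -> d (f * x)%g y <= d e f.
  by move=> ->; rewrite -{2}[y]mulg1 dM (hdC H).
have hg : gp f (p ^- m)%g (p ^+ m)%g <= 17 + 2.
  case: hf => /(@commute_pow _ _ _ _ K); rewrite ?expVgn -?expgnA -/m => hf.
    have hf' : (f * p ^- m = p ^- m * f)%g.
      by apply: (mulgI (p ^+ m)%g); rewrite mulVKg mulgA -hf mulgK.
    by apply: (swap_ends H h0 (cl _ _ hf') (cl _ _ hf)); rewrite ?l1 ?l2;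
      move: hm; clear - H dM hp lp; lra.
  have hf' : (f * p ^- m = p ^+ m * f)%g.
    by apply: (mulgI (p ^- m)%g); rewrite mulKg mulgA -hf mulgK.
  rewrite (gpC H); apply: (swap_ends H h0 (cl _ _ hf') (cl _ _ hf)); rewrite ?l1 ?l2;
      move: hm; clear - H dM hp lp; lra.
have [|||k _ hk] := @near_power (2 * m) (p ^+ m * f)%g 19.
- by clear - H dM hp lp; lra.
- have -> : (p ^+ (2 * m) = p ^+ m * p ^+ m)%g by rewrite mul2n -addnn expgnDr.
  have -> : gp (p ^+ m * f)%g e (p ^+ m * p ^+ m)%g = gp f (p ^- m)%g (p ^+ m)%g.
    by rewrite -{1}(mulgV (p ^+ m)%g) gpM.
  by apply: (le_trans hg); clear - H dM hp lp; lra.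
- have := axis_gp H dM hp lp m m; rewrite /gp hN -(dM (p ^+ m)%g (p ^- m)%g) mulgV -expgnDr addnn -mul2n.
  have := hdT H e (p ^+ m)%g (p ^+ m * f)%g.
  have -> : d (p ^+ m)%g (p ^+ m * f)%g = d e f by rewrite -{1}[(p ^+ m)%g]mulg1 dM.
  by move: hm; clear - H dM hp lp; lra.
exists m, k; rewrite -(dM (p ^+ m)%g) mulVKg; apply: (le_trans hk).
by clear - H dM hp lp; lra.
Qed.

(** Otherwise every letter, hence every element of G, commutes with p^J or inverts it, for J = J0!.
    By [near_axis] each coset of the group of p^J then contains some t p^b with b < J and t of
    bounded displacement. There are finitely many such t, so G would be virtually cyclic. *)
Lemma commensuration (S : set G) (J0 : nat) :
  (forall r, exists N D, forall n, (N <= n)%N ->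
     atmost D (fun t => d e t <= r /\ d (p ^+ n)%g (t * p ^+ n)%g <= r)) ->
  ~ virtually_cyclic G -> (forall g, exists n, word_ball S n g) ->
  exists2 s, S s & forall j, (0 < j <= J0)%N ->
    (s * p ^+ j)%g <> (p ^+ j * s)%g /\ (s * p ^+ j)%g <> (p ^- j * s)%g.
Proof.
move=> hW nvc gen; apply: contrapT => nex; apply: nvc.
pose J := J0`!.
have J_gt0 : (0 < J)%N by exact: fact_gt0.
have hS s : S s -> (s * p ^+ J = p ^+ J * s)%g \/ (s * p ^+ J = p ^- J * s)%g.
  move=> Ss; have [j [hj hs]] : exists j, (0 < j <= J0)%N /\
      ((s * p ^+ j = p ^+ j * s)%g \/ (s * p ^+ j = p ^- j * s)%g).
    apply: contrapT => nj; apply: nex; exists s => // j hj; split=> h; apply: nj; exists j.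
      by split=> //; left.
    by split=> //; right.
  have /dvdnP[q ->] : (j %| J)%N by exact: dvdn_fact.
  rewrite mulnC expgnA -expVgn.
  by case: hs => /(@commute_pow _ _ _ _ q) h; [left|right]; rewrite h ?expVgn.
have hG g : (g * p ^+ J = p ^+ J * g)%g \/ (g * p ^+ J = p ^- J * g)%g.
  have [n [w [_ Sw ->]]] := gen g; elim: w {n} Sw => [|s w IH] Sw.
    by left; rewrite big_nil mul1g mulg1.
  rewrite big_cons; have /IH {IH} : forall s, s \in w -> S s.
    by move=> x xw; apply: Sw; rewrite inE xw orbT.
  have hs := hS s (Sw s (mem_head _ _)); set v := (\prod_(j <- w) j)%g => hv.
  have hs' : (s * p ^- J = p ^- J * s)%g \/ (s * p ^- J = p ^+ J * s)%g.
    case: hs => h; [left|right].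
      by apply: (mulgI (p ^+ J)%g); rewrite mulVKg mulgA -h mulgK.
    by apply: (mulgI (p ^- J)%g); rewrite mulKg mulgA -h mulgK.
  case: hv => hv; rewrite -!mulgA hv !mulgA.
    by case: hs => ->; [left|right].
  by case: hs' => ->; [right|left].
set r := d e p + 40.
pose T t := d e t <= r /\ ((t * p ^+ J = p ^+ J * t)%g \/ (t * p ^+ J = p ^- J * t)%g).
have fT : finite_set T.
  have [N [D hD]] := hW (2 * r).
  have plus : atmost D (fun t => d e t <= 2 * r /\ (t * p ^+ J = p ^+ J * t)%g).
    apply: atmost_sub (leqnn _) _ (hD (J * N)%N _); last by rewrite leq_pmull.
    move=> t [h1 /(@commute_pow _ _ _ _ N)]; rewrite -expgnA => h2; split=> //.
    by rewrite h2 -{1}[(p ^+ _)%g]mulg1 dM.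
  (* Elements that invert p^J differ by the fixed t0 from elements that commute with it, and these
     quotients have displacement at most 2 r; so [plus] counts both kinds. *)
  have [[t0 [[d0 _] h0]]|nt0] := pselect (exists t0, T t0 /\ (t0 * p ^+ J = p ^- J * t0)%g).
    apply: (proj1 (@atmost_finite _ (D + D) _ _)).
    have minus : atmost D (fun t => T t /\ (t * p ^+ J = p ^- J * t)%g).
      apply: (atmost_inj _ _ plus (f := fun t => t0^-1 * t)%g) => [t [[h1 _] h2]|t t' _ _ /mulgI //].
      split.
        rewrite (dVl dM); have := hdT H t0 e t; rewrite (hdC H t0 e).
        by move: h1 d0; clear - H dM hp lp; lra.
      by rewrite -mulgA h2 !mulgA; congr (_ * _)%g; apply: (mulgI t0); rewrite mulVKg mulgA h0 mulgK.
    apply: (atmost_sub (leqnn _) _ (atmost_or plus minus)) => t [h1 [h2|h2]]; [left|right]; split=> //.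
      by have := hd_ge0 H e t; move: h1; clear - H dM hp lp; lra.
  apply: (proj1 (@atmost_finite _ D _ _)).
  apply: atmost_sub (leqnn _) _ plus => t Tt; have [h1 [h2|h2]] := Tt.
    by split=> //; have := hd_ge0 H e t; move: h1; clear - H dM hp lp; lra.
  by case: nt0; exists t.
exists (p ^+ J)%g.
pose f (x : G * nat) := [set (x.1 * p ^+ x.2 * h)%g | h in cyclic_subgroup (p ^+ J)%g].
apply: (@sub_finite_set _ _ (f @` (T `*` `I_J))); last first.
  by apply/finite_image/finite_setX => //; exact: finite_II.
move=> _ [g _ <-].
have [i [j hij]] := near_axis J_gt0 (hG g^-1%g).
pose t := (g * (p ^- i * p ^+ j))%g.
(* Here g = t p^(i - j); adding J j to the exponent makes it non-negative without changing the
   coset. *)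
pose a := (i + j * J.-1)%N.
exists (t, (a %% J)%N) => /=.
  split=> /=; last by rewrite ltn_mod.
  by split; [rewrite /t -(dM g^-1%g) mulg1 mulKg (hdC H)|exact: hG].
rewrite /f /=.
have Pa q : cyclic_subgroup (p ^+ J)%g (p ^+ (J * q))%g by exists q; left; rewrite expgnA.
rewrite -(coset_absorb _ (Pa (a %/ J)%N)) -mulgA -expgnDr.
have -> : (a %% J + J * (a %/ J) = a)%N by rewrite mulnC addnC -divn_eq.
rewrite -(coset_absorb _ (cyclic_subgroupV (Pa j))).
suff -> : (t * p ^+ a * p ^- (J * j))%g = g by [].
have -> : (J * j = j + j * J.-1)%N by rewrite -{1}(prednK J_gt0) mulSn mulnC.
rewrite /t /a -!mulgA; set k := (j * J.-1)%N.
rewrite [(p ^+ j * _)%g]mulgA.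
have -> : (p ^+ j * p ^+ (i + k) = p ^+ i * p ^+ (j + k))%g.
  by rewrite -!expgnDr; congr (_ ^+ _)%g; lia.
by rewrite mulgK mulVg mulg1.
Qed.
End Commensuration.

Section Directions.
Context {R : realType} {G : groupType} {d : G -> G -> R}.
Hypothesis H : hyp_dist 1 d.
Hypothesis dM : forall t g h, d (t * g)%g (t * h)%g = d g h.
Local Notation gp := (gp d).
Local Notation e := (1%g : G).

(* u realizes, up to 1, the distance between the axes of p and of u p u^-1. *)
Definition near_min (p u : G) := forall x y, cyclic_subgroup p x ->
  cyclic_subgroup p y -> d e u <= d x (u * y)%g + 1.

Lemma near_minV p u : near_min p u -> near_min p u^-1%g.
Proof.
move=> h x y hx hy; rewrite (dV H dM); apply: (le_trans (h y x hy hx)).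
by rewrite -(dM u^-1%g) mulKg (hdC H).
Qed.

Lemma cyclic_subgroupVE (p : G) : cyclic_subgroup p^-1%g = cyclic_subgroup p.
Proof.
by apply/seteqP; split=> x [n [->|->]]; exists n; rewrite ?expVgn ?invgK; [right|left|right|left].
Qed.

Section OneAxis.
Context {p : G}.
Hypothesis hp : gp e p^-1%g p <= 15.
Hypothesis lp : 1000 <= d e p.

(** If u followed the axis of p for longer, a power p^k up to which it follows the axis would be
    closer to u than 1 is, against near-minimality. *)
Lemma near_min_gp_pow u n : near_min p u -> gp e (p ^+ n)%g u <= d e p + 37.
Proof.
move=> hu; set g0 := gp e (p ^+ n)%g u.
have hn : g0 <= d e (p ^+ n)%g by exact: gp_lel H _ _ _.
have ex : exists k, g0 <= d e (p ^+ k)%g by exists n.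
have [k hk kmin] := ex_minnP ex; have kn := kmin n hn.
have up : d e (p ^+ k)%g <= g0 + d e p.
  case: k hk kmin {kn} => [|k] hk kmin.
    by rewrite expg0 (hd0 H); have := gp_ge0 H e (p ^+ n)%g u; rewrite -/g0; have := hd_ge0 H e p; lra.
  have h1 : d e (p ^+ k)%g < g0 by rewrite ltNge; apply/negP => /kmin; rewrite ltnn.
  have := hdT H e (p ^+ k)%g (p ^+ k.+1)%g; rewrite expgSr (dist_mulr dM); move: h1; clear - H dM hp lp; lra.
have h1 := axis_mid H dM hp lp kn.
have h2 := gpK H e (p ^+ k)%g (p ^+ n)%g.
have h3 : g0 - 18 <= gp e (p ^+ k)%g u.
  case: (gp_or H e (p ^+ k)%g (p ^+ n)%g u); rewrite -/g0.
    by move: h1 h2 hk; clear - H dM hp lp; lra.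
  by clear - H dM hp lp; lra.
have := hu (p ^+ k)%g e; rewrite mulg1 => /(_ _ _).
have c1 : cyclic_subgroup p (p ^+ k)%g by exists k; left.
have c2 : cyclic_subgroup p e by exists 0%N; left.
move=> /(_ c1 c2); move: h3; rewrite {1}/gp.
by move: up; clear - H dM hp lp; lra.
Qed.

(* If the axes of p and q = u p2 u^-1 fellow travel, then the elements q^-j p^j
   almost fix a long piece of both axes, so two of them coincide. *)
Lemma fellow_axes p2 u a b n D : gp e p2^-1%g p2 <= 15 ->
  (forall i, d e (p2 ^+ i)%g = d e (p ^+ i)%g) ->
  d e u <= 2 * d e p + 77 ->
  (10 + n + D)%:R * d e p < gp e (p ^+ a)%g (u * p2 ^+ b)%g ->
  atmost D (fun t => d e t <= 146 /\ d (p ^+ n)%g (t * p ^+ n)%g <= 146) ->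
  exists j, (0 < j <= D)%N /\ (u * p2 ^+ j = p ^+ j * u)%g.
Proof.
move=> hp2 l2 hu hk hD.
have lp2 : 1000 <= d e p2 by have := l2 1%N; rewrite !expg1 => ->.
set Pt := (p ^+ a)%g; set Qt := (u * p2 ^+ b)%g in hk *; set k := gp e _ _ in hk.
have kp : k <= d e Pt by exact: gp_lel H _ _ _.
have ia : (10 + n + D <= a)%N.
  rewrite -(ler_nat R) leNgt; apply/negP => h; have up := pow_dist_le H dM p a.
  have : a%:R * d e p <= (10 + n + D)%:R * d e p.
    by rewrite ler_wpM2r //; [have := hd_ge0 H e p|exact: ltW].
  by move: up hk kp; rewrite -/Pt; clear - H dM hp lp; lra.
have low i : (10 <= i)%N -> 5 * d e p <= d e (p ^+ i)%g.
  move=> i1; apply: (le_trans _ (axis_len H dM hp lp i)).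
  have i3 : (10 : R) <= i%:R by rewrite ler_nat.
  apply: (@le_trans _ _ (10 * (d e p / 2))); first by clear - H dM hp lp; lra.
  by rewrite ler_wpM2r //; have := hd_ge0 H e p; clear - H dM hp lp; lra.
have y_gp i : (10 <= i <= 10 + n + D)%N -> gp (p ^+ i)%g u Qt <= 19.
  move=> /andP[i1 i2].
  have {}low := low i i1.
  have up : d e (p ^+ i)%g <= k.
    apply: (le_trans (pow_dist_le H dM p i)); apply/ltW/le_lt_trans/hk.
    by rewrite ler_wpM2r ?ler_nat // (hd_ge0 H).
  have h1 := axis_mid H dM hp lp (leq_trans i2 ia).
  have h2 := gpK H e (p ^+ i)%g Pt; have h3 := gpK H e (p ^+ i)%g Qt.
  have h4 : gp (p ^+ i)%g e Qt <= 18.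
    case: (gp_or H e (p ^+ i)%g Pt Qt); rewrite -/k; move: h1 h2 h3 up; rewrite -/Pt; clear - H dM hp lp; lra.
  have : gp (p ^+ i)%g u Qt <= 18 + 1.
    by apply: (swap_end H h4 hu); rewrite (hdC H (p ^+ i)%g); move: low lp; clear - H dM hp lp; lra.
  by clear - H dM hp lp; lra.
pose q := (u * p2 * u^-1)%g.
have qE j x : (q ^+ j * (u * x) = u * p2 ^+ j * x)%g.
  by rewrite mulgA -(@commute_pow _ u p2 q j) // /q mulgVK.
have key j i : (j <= D)%N -> i = 10%N \/ i = (10 + n)%N ->
    d (q ^+ j * p ^+ i)%g (p ^+ (i + j))%g <= 146.
  move=> jD hi.
  have i1 : (10 <= i <= 10 + n + D)%N by clear - jD hi; case: hi => ->; lia.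
  have i2 : (10 <= i + j <= 10 + n + D)%N by clear - jD hi; case: hi => ->; lia.
  set y := (p ^+ i)%g; set w := (p ^+ (i + j))%g; set v := (q ^+ j * y)%g.
  set Z := (u * p2 ^+ (j + b))%g; set x := (u * p2 ^+ j)%g.
  have xE : x = (q ^+ j * u)%g by have := qE j e; rewrite !mulg1.
  have ZE : Z = (q ^+ j * Qt)%g by rewrite /Qt qE /Z expgnDr mulgA.
  have v1 : gp v x Z <= 19 by rewrite xE ZE /v gpM //; exact: y_gp.
  have x1 : gp x u Z <= 17.
    rewrite /x -{2}[u]mulg1 gpM //.
    exact: (axis_mid H dM hp2 lp2 (leq_addr _ _)).
  have w1 : gp w u Qt <= 19 by exact: y_gp.
  have Q1 : gp Qt u Z <= 17.
    rewrite /Qt -{2}[u]mulg1 gpM //.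
    exact: (axis_mid H dM hp2 lp2 (leq_addl _ _)).
  have y1 : gp y u w <= 17 + 1.
    have h1 := axis_mid H dM hp lp (leq_addr j i).
    apply: (swap_end H h1 hu); rewrite (hdC H (p ^+ i)%g).
    have := low i; rewrite -/y; case: hi => ->; move=> /(_ isT) l; move: l lp; clear - H dM hp lp; lra.
  have e1 : d u x = d e (p ^+ j)%g by rewrite (dist_mulr dM) l2.
  have e2 : d x v = d u y.
    by rewrite xE dM.
  have e3 : d y w = d e (p ^+ j)%g by rewrite /w expgnDr (dist_mulr dM).
  have e4 : d Qt Z = d e (p ^+ j)%g.
    by rewrite /Qt /Z addnC expgnDr mulgA (dist_mulr dM) l2.
  have t1 := hdT H u x v; have t2 := hdT H u v Z; have t3 := hdT H v x Z.
  have t4 := hdT H u y w; have t5 := hdT H w Qt Z.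
  have s1 := hdC H x u; have s2 := hdC H v x; have s3 := hdC H w u; have s4 := hdC H Qt u.
  have s5 := hdC H y u; have s6 := hdC H v u.
  rewrite /gp s1 in x1; rewrite /gp s2 in v1; rewrite /gp s3 in w1; rewrite /gp s4 in Q1.
  rewrite /gp s5 in y1.
  have gv : gp v u Z <= 36.
    rewrite /gp s6; move: x1 v1 t1; clear - H dM hp lp; lra.
  have gw : gp w u Z <= 36.
    rewrite /gp s3; move: w1 Q1 t5; clear - H dM hp lp; lra.
  apply: (le_trans (line_dist H gv gw)).
  suff : `|d u v - d u w| <= 72 by clear - H dM hp lp; lra.
  rewrite ler_norml; apply/andP; split; move: x1 v1 t1 t2 t4 y1 e1 e2 e3; clear - H dM hp lp; lra.
apply: contrapT => nex.
pose t j := (p ^- 10 * (q ^- j * p ^+ (j + 10)))%g.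
have tE j x : d (p ^+ 10 * x)%g (q ^- j * p ^+ (j + 10) * x)%g = d x (t j * x)%g.
  by rewrite -(dM (p ^- 10)%g) mulKg /t !mulgA.
suff : uniq (map t (iota 0 D.+1)).
  move=> /hD h; have /h : forall x, x \in map t (iota 0 D.+1) ->
      d e x <= 146 /\ d (p ^+ n)%g (x * p ^+ n)%g <= 146.
    move=> _ /mapP[j + ->]; rewrite mem_iota ltnS => /andP[_ jD].
    have k1 := key j 10%N jD (or_introl erefl).
    have k2 := key j (10 + n)%N jD (or_intror erefl).
    split.
      rewrite -[t j]mulg1 -tE !mulg1 -(dM (q ^+ j)%g) mulVKg.
      by rewrite addnC.
    have E : (q ^- j * p ^+ (j + 10) * p ^+ n = q ^- j * p ^+ (10 + n + j))%g.
      by rewrite -mulgA -expgnDr; congr (_ * _ ^+ _)%g; clear; lia.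
    by rewrite -tE E -expgnDr -(dM (q ^+ j)%g) mulVKg.
  by rewrite size_map size_iota ltnn.
rewrite map_inj_in_uniq ?iota_uniq // => i j.
rewrite !mem_iota !ltnS => /andP[_ iD] /andP[_ jD] tij; apply/eqP; apply: contraT.
wlog ij : i j iD jD tij / (i < j)%N.
  move=> hw /[dup] ne; rewrite neq_ltn => /orP[|] h; first exact: (hw i j).
  by apply: (hw j i) => //; rewrite eq_sym.
move=> _; case: nex; exists (j - i)%N; split; first by rewrite subn_gt0 ij (leq_trans (leq_subr _ _)).
have e1 : (q ^- i * p ^+ i = q ^- j * p ^+ j)%g.
  have E r : (p ^+ (r + 10) = p ^+ r * p ^+ 10)%g by exact: expgnDr.
  by move: tij => /mulgI; rewrite !E [(q ^- i * _)%g]mulgA [(q ^- j * (_ * _))%g]mulgA => /mulIg.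
have e2 : (q ^+ (j - i) = p ^+ (j - i))%g.
  apply: (mulIg (p ^+ i)%g); rewrite -expgnDr subnK 1?ltnW //.
  apply: (mulgI (q ^- j)%g); rewrite -e1 mulgA; congr (_ * _)%g.
  apply: (mulgI (q ^+ j)%g); rewrite mulVKg -{2}(subnK (ltnW ij)) expgnDr mulgK //.
by rewrite -e2 (@commute_pow _ u p2 q) // /q mulgVK.
Qed.

End OneAxis.
Lemma thinV_axis (p : G) n D r :
  atmost D (fun t => d e t <= r /\ d (p ^+ n)%g (t * p ^+ n)%g <= r) ->
  atmost D (fun t => d e t <= r /\ d (p^-1 ^+ n)%g (t * p^-1 ^+ n)%g <= r).
Proof.
apply: (atmost_inj (f := fun t => p ^+ n * t * p ^- n)%g) => [t [h1 h2]|t t' _ _].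
  rewrite expVgn in h2; split; last by rewrite mulgVK (dist_mulr dM).
  by rewrite -mulgA -(dM (p ^- n)%g) mulg1 mulKg.
by move=> /mulIg/mulgI.
Qed.

(** For short u, fellow travelling contradicts the non-commutation hypothesis through [fellow_axes].
    For long u, [near_min_gp_pow] bounds the turns at both ends of u and [local_geodesic] applies;
    77 leaves room for 2 * 37 + 1. Signs of exponents are handled by exchanging p and p^-1. *)
Lemma axes_apart (p u x y : G) n D :
  gp e p^-1%g p <= 15 -> 1000 <= d e p -> near_min p u ->
  atmost D (fun t => d e t <= 146 /\ d (p ^+ n)%g (t * p ^+ n)%g <= 146) ->
  (forall j, (0 < j <= D)%N -> (u * p ^+ j)%g <> (p ^+ j * u)%g /\
     (u * p ^+ j)%g <> (p ^- j * u)%g) ->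
  cyclic_subgroup p x -> cyclic_subgroup p y ->
  gp e x (u * y)%g <= (10 + n + D)%:R * d e p.
Proof.
move=> hp lp hu hD nc Cx Cy.
have root z : cyclic_subgroup p z -> exists2 p1, p1 = p \/ p1 = p^-1%g &
    exists a, z = (p1 ^+ a)%g.
  move=> [a [->|->]]; first by exists p; [left|exists a].
  by exists p^-1%g; [right|exists a; rewrite expVgn].
have good p1 : p1 = p \/ p1 = p^-1%g -> [/\ gp e p1^-1%g p1 <= 15,
    1000 <= d e p1, d e p1 = d e p, (forall i, d e (p1 ^+ i)%g = d e (p ^+ i)%g)
    & near_min p1 u /\ atmost D (fun t => d e t <= 146 /\ d (p1 ^+ n)%g (t * p1 ^+ n)%g <= 146)].
  move=> [->|->]; first by split.
  rewrite invgK (dV H dM) (gpC H); split=> //.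
    by move=> i; rewrite expVgn (dV H dM).
  split.
  - by rewrite /near_min cyclic_subgroupVE.
  - exact: thinV_axis.
have [p1 P1 [a xE]] := root x Cx; have [p2 P2 [b yE]] := root y Cy.
have [hp1 lp1 d1 l1 [nm1 D1]] := good _ P1; have [hp2 lp2 d2 l2 [nm2 D2]] := good _ P2.
rewrite xE yE leNgt; apply/negP => hk.
have [hs|hs] := leP (d e u) (2 * d e p + 77).
  rewrite -d1 in hs hk.
  have l12 i : d e (p2 ^+ i)%g = d e (p1 ^+ i)%g by rewrite l1 l2.
  have [j [hj e1]] := fellow_axes hp1 lp1 hp2 l12 hs hk D1.
  have [n1 n2] := nc j hj.
  have sw : (u * p ^- j = p ^+ j * u)%g -> (u * p ^+ j = p ^- j * u)%g.
    by move=> h; apply: (mulgI (p ^+ j)%g); rewrite mulVKg mulgA -h mulgVK.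
  case: P1 e1 => ->; case: P2 => ->; rewrite ?expVgn //; first by move/sw.
  move=> h; apply: n1; apply: (mulgI (p ^- j)%g); rewrite mulKg mulgA -h mulgVK //.
have h1 := near_min_gp_pow hp1 lp1 a nm1.
have h2 := near_min_gp_pow hp2 lp2 b (near_minV nm2).
rewrite d1 in h1; rewrite d2 in h2.
have h3 : gp u e (u * p2 ^+ b)%g <= d e p + 37 by rewrite (gp_at1 dM) (gpC H).
have [|h4 _] := local_geodesic H h1 h3; first by move: hs; clear; lra.
have : 10 * d e p <= (10 + n + D)%:R * d e p.
  by rewrite ler_wpM2r ?(hd_ge0 H) // ler_nat -addnA leq_addr.
by move: h4 hk lp; clear; lra.
Qed.

End Directions.

(** * Elements with three diverging directions *)

Section Pieces.
Context {R : realType} {G : groupType} {d : G -> G -> R}.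
Hypothesis H : hyp_dist 1 d.
Hypothesis dM : forall t g h, d (t * g)%g (t * h)%g = d g h.
Local Notation gp := (gp d).
Local Notation e := (1%g : G).

(* The powers p^(n i) give the pieces a common direction at both ends, and their
   different lengths separate the pieces from each other. *)
Definition piece (p u : G) (n r i : nat) : G :=
  (p ^+ (n * i) * (u * p ^+ (n * r) * u^-1 * p ^+ (n * i)))%g.

Lemma pieceV p u n r i : piece p^-1%g u n r i = (piece p u n r i)^-1%g.
Proof. by rewrite /piece !expVgn !invgM !invgK !mulgA. Qed.

Definition piece_tail (p u : G) (n r i : nat) : G :=
  (u * p ^+ (n * r) * u^-1 * p ^+ (n * i))%g.

Section OnePiece.
Context {p u : G} {kap : R} {n r N : nat}.
Hypothesis hp : gp e p^-1%g p <= 15.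
Hypothesis lp : 1000 <= d e p.
Hypothesis k_ge : 1000 <= kap.
Hypothesis ap : forall x y, cyclic_subgroup p x -> cyclic_subgroup p y ->
  gp e x (u * y)%g <= kap /\ gp e x (u^-1 * y)%g <= kap.
Hypothesis nk : n%:R * (d e p / 2) = 10 * kap.
Hypothesis r0 : (0 < r)%N.
Hypothesis N0 : (0 < N)%N.
Hypothesis Nk : d e (p ^+ N)%g <= kap.

Lemma cyclic_pow m : cyclic_subgroup p (p ^+ m)%g. Proof. by exists m; left. Qed.
Lemma cyclic_powV m : cyclic_subgroup p (p ^- m)%g. Proof. by exists m; right. Qed.
Ltac slra := clear - H dM hp lp k_ge ap nk r0 N0 Nk; lra.

Lemma piece_step_len m : (0 < m)%N -> 10 * kap <= d e (p ^+ (n * m))%g.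
Proof.
move=> m0; rewrite -nk; apply: (le_trans _ (axis_len H dM hp lp _)).
rewrite natrM -mulrA ler_wpM2l ?ler0n // ler_peMl ?ler1n //.
by have := hd_ge0 H e p; slra.
Qed.

Lemma piece_turn i : gp e (u * p ^+ (n * r))^-1%g (u^-1 * p ^+ (n * i))%g <= kap + 1.
Proof.
have h1 : gp e (u^-1 * p ^+ (n * i))%g (p ^- (n * r))%g <= kap.
  by rewrite (gpC H); exact: (ap (cyclic_powV _) (cyclic_pow _)).2.
have h2 : gp (p ^- (n * r))%g e (p ^- (n * r) * u^-1)%g <= kap.
  rewrite (gp_at1 dM) invgK -[u^-1%g]mulg1; exact: (ap (cyclic_pow _) (cyclic_pow 0)).2.
rewrite invgM (gpC H).
have [|//] := local_geodesic H h1 h2.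
by rewrite (dV H dM); have := piece_step_len r0; move: (k_ge : 1000 <= kap); slra.
Qed.

Lemma piece_head_len : 8 * kap <= d e (u * p ^+ (n * r))%g.
Proof.
have := (ap (cyclic_pow (n * r)) (cyclic_pow 0)).2; rewrite expg0 mulg1 (gpC H) /gp (dV H dM) -(dM u u^-1%g) mulgV.
by have := piece_step_len r0; have := hd_ge0 H e u; slra.
Qed.

Lemma piece_last_len i : (0 < i)%N -> 8 * kap <= d e (u^-1 * p ^+ (n * i))%g.
Proof.
move=> i0.
have := (ap (cyclic_pow (n * i)) (cyclic_pow 0)).1; rewrite expg0 mulg1 (gpC H) /gp -(dM u^-1%g u) mulVg.
by have := piece_step_len i0; have := hd_ge0 H e u; slra.
Qed.

Lemma piece_tail_gp x i : (0 < i)%N -> cyclic_subgroup p x -> gp e x (piece_tail p u n r i) <= kap + 2.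
Proof.
move=> i0 Cx; have -> : piece_tail p u n r i = (\prod_(v <- [:: u * p ^+ (n * r); u^-1 * p ^+ (n * i)]) v)%g.
  by rewrite !big_cons big_nil mulg1 /piece_tail !mulgA.
have a0 : 0 <= kap + 1 by move: (k_ge : 1000 <= kap); slra.
have := @chain_left _ _ _ _ H dM (kap + 1) x^-1%g [:: u * p ^+ (n * r); u^-1 * p ^+ (n * i)]%g.
rewrite invgK /chain /long /= !andbT invgK => h.
apply: le_trans (h _ _ a0) _; last by slra.
  rewrite piece_turn andbT; have := (ap Cx (cyclic_pow (n * r))).1; slra.
have l1 := piece_head_len; have l2 := piece_last_len i0.
by apply/andP; split; move: (k_ge : 1000 <= kap) l1 l2; slra.
Qed.

Lemma piece_gp i : (0 < i)%N -> gp (p ^+ N)%g e (piece p u n r i) <= 18.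
Proof.
move=> i0; set E := piece _ _ _ _ _; set x := (p ^+ (n * i))%g.
have Nn : (N <= n * i)%N.
  rewrite leqNgt; apply/negP => h.
  have := axis_mid H dM hp lp (ltnW h); rewrite /gp (hdC H _ e).
  have := hd_ge0 H (p ^+ (n * i))%g (p ^+ N)%g.
  have := piece_step_len i0; move: (k_ge : 1000 <= kap) (Nk : _ <= kap); slra.
have h1 := axis_mid H dM hp lp Nn; rewrite -/x in h1.
have h2 : gp x e E <= kap + 2.
  rewrite (gp_at1 dM); apply: piece_tail_gp => //; exact: cyclic_powV.
have h3 := gpK H e (p ^+ N)%g x; have h4 := gpK H e x E; have h5 := gpK H e (p ^+ N)%g E.
have := piece_step_len i0; rewrite -/x => h6.
case: (gp_or H e (p ^+ N)%g x E); rewrite ?(gpC H e E x);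
  move: h1 h2 h3 h4 h5 h6 (k_ge : 1000 <= kap) (Nk : _ <= kap); slra.
Qed.

Lemma piece_len i : (0 < i)%N -> (r%:R * 10 - 8) * kap <= d e (piece p u n r i).
Proof.
move=> i0; set E := piece _ _ _ _ _; set x := (p ^+ (n * i))%g.
have h2 : gp x e E <= kap + 2.
  rewrite (gp_at1 dM); apply: piece_tail_gp => //; exact: cyclic_powV.
have h3 : gp (u * p ^+ (n * r))%g e (piece_tail p u n r i) <= kap + 1.
  by rewrite /piece_tail -mulgA (gp_at1 dM); exact: piece_turn.
have h4 := (ap (cyclic_pow (n * r)) (cyclic_pow 0)).2; rewrite expg0 mulg1 (gpC H) in h4.
rewrite /gp (dV H dM) -(dM u u^-1%g) mulgV in h4.
rewrite /gp (hdC H x e) in h2; rewrite /gp (hdC H _ e) in h3.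
have e1 : d x E = d e (piece_tail p u n r i) by rewrite (dist_mulr dM).
have h5 : r%:R * 10 * kap <= d e (p ^+ (n * r))%g.
  by rewrite -mulrA -nk mulrA -natrM mulnC; exact: axis_len.
have := hd_ge0 H e x; have := hd_ge0 H (u * p ^+ (n * r))%g (piece_tail p u n r i).
have := hd_ge0 H e u; rewrite mulrBl.
move: h2 h3 h4 e1 h5 (k_ge : 1000 <= kap); slra.
Qed.

(** The common initial part x = p^(n i) has length at most 40 kap, as i <= 2. After it the longer
    piece continues along the axis while the shorter one leaves it, so at most kap + 3 more is
    shared. *)
Lemma piece_sep i j : (0 < i < j)%N -> (j <= 3)%N ->
  gp e (piece p u n r i) (piece p u n r j) <= 42 * kap.
Proof.
move=> /andP[i0 ij] j3; have j0 := leq_trans i0 (ltnW ij).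
set x := (p ^+ (n * i))%g; set m := (j - i)%N; set y := (p ^+ (n * m))%g.
have m0 : (0 < m)%N by rewrite subn_gt0.
have Ej : piece p u n r j = (x * (y * piece_tail p u n r j))%g.
  by rewrite /piece /x /y [in RHS]mulgA -expgnDr -mulnDr subnKC // ltnW.
have Ei : piece p u n r i = (x * piece_tail p u n r i)%g by [].
have h1 := piece_tail_gp i0 (cyclic_pow (n * m)); rewrite -/y in h1.
have h2 : gp y e (y * piece_tail p u n r j)%g <= kap + 2.
  rewrite (gp_at1 dM); apply: piece_tail_gp => //; exact: cyclic_powV.
have h3 := gpK H e y (y * piece_tail p u n r j)%g; have := piece_step_len m0; rewrite -/y => h4.
have h5 : gp e (piece_tail p u n r i) (y * piece_tail p u n r j)%g <= kap + 3.
  case: (gp_or H e (piece_tail p u n r i) (y * piece_tail p u n r j)%g y); rewrite ?(gpC H e _ y).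
  - by move: h1; slra.
  - by move: h1 h2 h3 h4 (k_ge : 1000 <= kap); slra.
have h6 : d e x <= 40 * kap.
  have -> : 40 * kap = 2 * (n%:R * d e p) by move: (nk : _ = 10 * kap); slra.
  apply: (le_trans (pow_dist_le H dM p _)); rewrite mulnC natrM -mulrA ler_wpM2r //.
    by rewrite mulr_ge0 // (hd_ge0 H).
  by rewrite ler_nat -ltnS (leq_trans ij).
rewrite Ej Ei; apply: (le_trans (gp_lip H e x _ _)); rewrite -{1}[x]mulg1 gpM //.
by move: h5 h6 (k_ge : 1000 <= kap); slra.
Qed.

End OnePiece.
End Pieces.

Section Atoms.
Context {R : realType} {G : groupType} {d : G -> G -> R}.
Hypothesis H : hyp_dist 1 d.
Hypothesis dM : forall t g h, d (t * g)%g (t * h)%g = d g h.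
Local Notation gp := (gp d).
Local Notation e := (1%g : G).

(* The E i begin and end along one axis, of which z is a piece that few elements
   almost fix, but they leave this axis at different times. *)
Record atoms (kap : R) (E : 'I_3 -> G) (z : G) : Prop := Atoms {
  at_in : forall i j, gp e (E i)^-1%g (E j) <= 19;
  at_out : forall i j, i != j -> gp e (E i) (E j) <= kap;
  at_outV : forall i j, i != j -> gp e (E i)^-1%g (E j)^-1%g <= kap;
  at_len : forall i, 2000 * kap <= d e (E i);
  at_base : d e z <= kap;
  at_gp : forall i, gp z e (E i) <= 18 }.

(** The factor 20 gives n * (d e p / 2) = 10 kap, a lower bound for the length of p^n, and 8500
    makes (10 r - 8) kap exceed 2000 * 42 kap. Statements about inverses follow by exchanging p and
    p^-1. *)
Lemma pieces_atoms (p u : G) (K r N : nat) (kap := K%:R * d e p) :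
  gp e p^-1%g p <= 15 -> 1000 <= d e p -> (0 < N <= K)%N -> (8500 <= r)%N ->
  (forall x y, cyclic_subgroup p x -> cyclic_subgroup p y ->
     gp e x (u * y)%g <= kap /\ gp e x (u^-1 * y)%g <= kap) ->
  atoms (42 * kap) (fun i => piece p u (20 * K) r i.+1) (p ^+ N)%g.
Proof.
move=> hp lp /andP[N0 NK] hr ap.
have r0 : (0 < r)%N by exact: leq_trans hr.
have K1 : (1 : R) <= K%:R by rewrite ler1n (leq_trans N0).
have k_ge : 1000 <= kap by apply: (le_trans lp); rewrite /kap ler_peMl // (hd_ge0 H).
have nk : (20 * K)%:R * (d e p / 2) = 10 * kap by rewrite natrM /kap; lra.
have Nk : d e (p ^+ N)%g <= kap.
  by apply: (le_trans (pow_dist_le H dM p _)); rewrite ler_wpM2r ?ler_nat // (hd_ge0 H).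
have hpV : gp e p^-1^-1%g p^-1%g <= 15 by rewrite invgK (gpC H).
have lpV : 1000 <= d e p^-1%g by rewrite (dV H dM).
have apV x y : cyclic_subgroup p^-1%g x -> cyclic_subgroup p^-1%g y ->
    gp e x (u * y)%g <= kap /\ gp e x (u^-1 * y)%g <= kap.
  by rewrite cyclic_subgroupVE; exact: ap.
have nkV : (20 * K)%:R * (d e p^-1%g / 2) = 10 * kap by rewrite (dV H dM).
have NkV : d e (p^-1 ^+ N)%g <= kap by rewrite expVgn (dV H dM).
have pg i := @piece_gp _ _ _ H dM p u kap (20 * K) r N hp lp k_ge ap nk r0 Nk i.+1 isT.
have pgV i := @piece_gp _ _ _ H dM _ u kap (20 * K) r N hpV lpV k_ge apV nkV r0 NkV i.+1 isT.
have P0 : 500 <= d e (p ^+ N)%g.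
  apply: le_trans (axis_len H dM hp lp N).
  have : (1 : R) <= N%:R by rewrite ler1n.
  by move: lp; clear; nra.
have P0V := axis_lenN H dM (p := p) N.
have ax := axis_gp H dM hp lp N N.
have sepE (i j : 'I_3) : i != j -> gp e (piece p u (20 * K) r i.+1) (piece p u (20 * K) r j.+1) <= 42 * kap
   /\ gp e (piece p^-1 u (20 * K) r i.+1) (piece p^-1 u (20 * K) r j.+1) <= 42 * kap.
  wlog ij : i j / (i < j)%N => [hw|_].
    move=> ne; have := ne; rewrite -(inj_eq val_inj) neq_ltn => /orP[ij|ji]; first exact: hw.
    by rewrite !(gpC H e _ (piece _ _ _ _ j.+1)); apply: hw; rewrite // eq_sym.
  have j3 : (j.+1 <= 3)%N by exact: ltn_ord.
  split; first exact: (@piece_sep _ _ _ H dM p u kap (20 * K) r hp lp k_ge ap nk r0).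
  exact: (@piece_sep _ _ _ H dM _ u kap (20 * K) r hpV lpV k_ge apV nkV r0).
split.
- move=> i j; have := pgV i; have := pg j; rewrite expVgn pieceV.
  set Ei := piece _ _ _ _ i.+1; set Ej := piece _ _ _ _ j.+1 => h1 h2.
  have h3 := gpK H e (p ^+ N)%g Ej; have h4 := gpK H e (p ^- N)%g Ei^-1%g.
  case: (gp_or H e (p ^- N)%g Ei^-1%g (p ^+ N)%g).
    by move: h2 h4 P0 P0V ax; clear; lra.
  case: (gp_or H e Ei^-1%g Ej (p ^+ N)%g); rewrite ?(gpC H e Ej (p ^+ N)%g).
    by move: ax; clear; lra.
  by move: h1 h3 P0 ax; clear; lra.
- by move=> i j /sepE[].
- by move=> i j /sepE[_]; rewrite !pieceV.
- move=> i; apply: le_trans (@piece_len _ _ _ H dM p u kap (20 * K) r hp lp k_ge ap nk r0 i.+1 isT).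
  have : (8500 : R) <= r%:R by rewrite ler_nat.
  by move: k_ge; clear; nra.
- by move: Nk k_ge; clear; lra.
- exact: pg.
Qed.
End Atoms.

(** * An axis at the scale of the letters *)

Section Carrier.
Context {R : realType} {G : groupType} {d : G -> G -> R}.
Hypothesis H : hyp_dist 1 d.
Hypothesis dM : forall t g h, d (t * g)%g (t * h)%g = d g h.
Local Notation gp := (gp d).
Local Notation e := (1%g : G).
Context {kap : R} {E : 'I_3 -> G} {z0 : G}.
Hypothesis at_E : atoms (d := d) kap E z0.
Hypothesis k_ge : 1000 <= kap.

Ltac slra0 := clear - H dM at_E k_ge; lra.

(* Two letters E_a, E_b among the first two can be chosen so that E_a s E_b
   has little cancellation, even if s is short. *)
Lemma choose_ends (s : G) : exists a b : 'I_3, [/\ a != inord 2, b != inord 2,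
  gp e (E a)^-1%g (s * E b)%g <= 3 * kap + 4, gp e (E b) s^-1%g <= 2 * kap + 3 &
  gp e (E b) (s^-1 * (E a)^-1)%g <= kap + 2].
Proof.
have n01 : inord 0 != inord 1 :> 'I_3 by apply/eqP => /(congr1 val); rewrite /= !inordK.
have n02 : inord 0 != inord 2 :> 'I_3 by apply/eqP => /(congr1 val); rewrite /= !inordK.
have n12 : inord 1 != inord 2 :> 'I_3 by apply/eqP => /(congr1 val); rewrite /= !inordK.
have avoid x : exists2 b : 'I_3, b != inord 2 & gp e (E b) x <= kap + 1.
  have := at_out at_E n01.
  case: (gp_or H e (E (inord 0)) x (E (inord 1))) => h1 h2.
    by exists (inord 0) => //; move: h1 h2; slra0.
  by exists (inord 1) => //; rewrite (gpC H); move: h1 h2; slra0.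
have avoidV x : exists2 a : 'I_3, a != inord 2 & gp e (E a)^-1%g x <= kap + 1.
  have := at_outV at_E n01.
  case: (gp_or H e (E (inord 0))^-1%g x (E (inord 1))^-1%g) => h1 h2.
    by exists (inord 0) => //; move: h1 h2; slra0.
  by exists (inord 1) => //; rewrite (gpC H); move: h1 h2; slra0.
have [hs|hs] := leP (d e s) (2 * kap + 3).
  have [b b2 hb] := avoid (s^-1 * (E (inord 0))^-1)%g.
  exists (inord 0), b; split=> //.
  - have -> : gp e (E (inord 0))^-1%g (s * E b)%g =
        gp s^-1%g (s^-1 * (E (inord 0))^-1)%g (E b) by rewrite -[RHS](gpM dM s) mulgV mulVKg.
    apply: le_trans (gp_lip H _ e _ _) _; rewrite (gpC H) (hdC H) (dV H dM).
    by move: hs hb; slra0.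
  - by apply: le_trans (gp_ler H _ _ _) _; rewrite (dV H dM).
  - by move: hb; slra0.
have [b b2 hb] := avoid s^-1%g; have [a a2 ha] := avoidV s.
exists a, b; split=> //.
- have h : gp s e (s * E b)%g <= kap + 1 by rewrite (gp_at1 dM) (gpC H).
  have [|h1 _] := local_geodesic H ha h; first by move: hs; slra0.
  by move: h1 (k_ge : 1000 <= kap); slra0.
- by move: hb (k_ge : 1000 <= kap); slra0.
- have h : gp s^-1%g e (s^-1 * (E a)^-1)%g <= kap + 1 by rewrite (gp_at1 dM) invgK (gpC H).
  have [|h1 _] := local_geodesic H hb h; first by rewrite (dV H dM); move: hs; slra0.
  by move: h1; slra0.
Qed.

(** Meant for h = E a * s * E b with s a longest letter and tau = d e s. [ca_len] makes h longer, by
    a margin, than any displacement by a letter. By [ca_dir] h starts along some E a with a other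
    than 2, which keeps E 2 free for a detour off the axis. *)
Record carrier (tau : R) (h : G) : Prop := Carrier {
  ca_h : gp e h^-1%g h <= 21;
  ca_r : forall i, gp e h^-1%g (E i) <= 21;
  ca_l : forall i, gp e (E i)^-1%g h <= 21;
  ca_len : tau + 2000 * kap <= d e h;
  ca_dir : exists2 a, a != inord 2 & d e (E a) - 3 * kap - 4 <= gp e (E a) h }.

Lemma carrier_exists (s : G) : exists a b, carrier (d e s) (E a * s * E b)%g.
Proof.
have [a [b [a2 b2 h1 h2 h3]]] := choose_ends s; exists a, b.
set h := (_ * _)%g; have Ka := at_len at_E a; have Kb := at_len at_E b.
have h1' : gp (E a) e h <= 3 * kap + 4 by rewrite /h -mulgA (gp_at1 dM).
have start := gpK H e (E a) h.
have h3' : gp (E b)^-1%g e h^-1%g <= kap + 2.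
  by rewrite /h !invgM (gp_at1 dM) invgK.
have fin := gpK H e (E b)^-1%g h^-1%g; rewrite (dV H dM) in fin.
have lsb : d e s + d e (E b) - 2 * (2 * kap + 3) <= d e (s * E b)%g.
  have : gp s e (s * E b)%g <= 2 * kap + 3 by rewrite (gp_at1 dM) (gpC H).
  by rewrite /gp (dist_mulr dM) (hdC H s e); slra0.
have lh : d e (E a) + d e (s * E b)%g - 2 * (3 * kap + 4) <= d e h.
  by move: h1'; rewrite /gp /h -mulgA (dist_mulr dM) (hdC H _ e); slra0.
have hl i : gp e (E i)^-1%g h <= 20.
  case: (gp_or H e (E i)^-1%g h (E a)); rewrite ?(gpC H e h); have := at_in at_E i a; first by slra0.
  by move: h1' start Ka (k_ge : 1000 <= kap); slra0.
have hr i : gp e h^-1%g (E i) <= 20.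
  rewrite (gpC H); case: (gp_or H e (E i) h^-1%g (E b)^-1%g); rewrite ?(gpC H e _ (E b)^-1%g);
    have := at_in at_E b i; first by slra0.
  by move: h3' fin Kb (k_ge : 1000 <= kap); slra0.
split.
- case: (gp_or H e h^-1%g h (E a)); rewrite ?(gpC H e h (E a)); have := hr a.
    by slra0.
  by move: h1' start Ka (k_ge : 1000 <= kap); slra0.
- by move=> i; have := hr i; slra0.
- by move=> i; have := hl i; slra0.
- by move: lsb lh Ka Kb (k_ge : 1000 <= kap); slra0.
- by exists a => //; move: h1' start; slra0.
Qed.

Context {tau : R} {h : G}.
Hypothesis ca : carrier tau h.
Hypothesis tau0 : 0 <= tau.
Ltac slra := clear - H dM at_E k_ge ca tau0; lra.

Lemma carrier_long : 2000 * kap <= d e h.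
Proof. by have := ca_len ca; move: (tau0 : 0 <= tau); slra. Qed.

Lemma carrier_word_gp (us vs : seq G) : {subset us ++ vs <= h :: codom E} ->
  gp e (\prod_(g <- us) g)^-1%g (\prod_(g <- vs) g)%g <= 23.
Proof.
move=> sub; have : 0 <= (21 : R) by slra.
have at21 x y : x \in h :: codom E -> y \in h :: codom E -> gp e x^-1%g y <= 21.
  rewrite !inE => /predU1P[->|/codomP[i ->]] /predU1P[->|/codomP[j ->]].
  - exact: ca_h ca.
  - exact: ca_r ca j.
  - exact: ca_l ca i.
  - by have := at_in at_E i j; slra.
have lg : long (d := d) (dl := 1) 21 (us ++ vs).
  apply/allP => x /sub; rewrite inE => /predU1P[->|/codomP[i ->]].
    by have := carrier_long; move: (k_ge : 1000 <= kap); slra.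
  by have := at_len at_E i; move: (k_ge : 1000 <= kap); slra.
have ch : chain (d := d) 21 (us ++ vs).
  move: sub; rewrite /chain; clear lg; case: (us ++ vs) => // x w.
  elim: w x => //= y w IH x sub; rewrite at21 ?sub ?mem_head ?inE ?eqxx ?orbT //=.
    by apply: IH => z zw; apply: sub; rewrite inE zw orbT.
by move=> a0; have := chain_cat H dM ch lg a0; slra.
Qed.
Lemma gp_extend w x P Q : gp w P Q <= gp w x Q + gp x P Q.
Proof.
have := hdT H P x w; rewrite /gp (hdC H w P) (hdC H w x) (hdC H x P).
by slra.
Qed.

Let subh k (vs : seq G) : {subset vs <= h :: codom E} ->
  {subset nseq k h ++ vs <= h :: codom E}.
Proof.
move=> sub g; rewrite mem_cat => /orP[|/sub //].
by rewrite mem_nseq => /andP[_ /eqP ->]; rewrite mem_head.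
Qed.

Lemma carrier_gp m k : gp e (h ^- m)%g (h ^+ k)%g <= 23.
Proof.
rewrite !expg_prod; apply: carrier_word_gp; apply: subh => g.
by rewrite mem_nseq => /andP[_ /eqP ->]; rewrite mem_head.
Qed.

Lemma carrier_mid i n : (i <= n)%N -> gp (h ^+ i)%g e (h ^+ n)%g <= 23.
Proof. exact: (pow_mid dM carrier_gp). Qed.

Lemma carrier_pow n : n%:R * (d e h / 2) <= d e (h ^+ n)%g.
Proof.
by apply: (pow_len H dM carrier_gp); move: carrier_long (k_ge : 1000 <= kap); slra.
Qed.

Lemma carrier_base_gp k : (0 < k)%N -> gp z0 e (h ^+ k)%g <= 19.
Proof.
move=> k0; have [a _ ha] := ca_dir ca.
have h1 := carrier_mid k0; have h2 := gpK H e (h ^+ 1)%g (h ^+ k)%g.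
rewrite expg1 in h1 h2.
have Ka := at_len at_E a; have lh := carrier_long.
have h3 : 1000 * kap <= gp e (E a) (h ^+ k)%g.
  by case: (gp_or H e (E a) h (h ^+ k)%g); move: h1 h2 Ka lh ha (k_ge : 1000 <= kap); slra.
have h4 := gpK H e z0 (E a); have h5 := gpK H e z0 (h ^+ k)%g.
by case: (gp_or H e z0 (E a) (h ^+ k)%g); move: h3 h4 h5 (at_gp at_E a) (at_base at_E) (k_ge : 1000 <= kap); slra.
Qed.

Section Commuting.
Context {D : nat} {t : G}.
Hypothesis t1 : d e t <= d e h.
Hypothesis t2 : d (h ^+ (D + 30))%g (t * h ^+ (D + 30))%g <= d e h.
Ltac tlra := clear - H dM at_E k_ge ca tau0 t1 t2; lra.

(** Near the axis of h, t acts as a shift: by [busemann] it has the same shift at z = h^8 w and at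
    h^j z. So t h^j z and h^j t z lie near the axis at the same place. The exponent D + 30 leaves at
    least 22 periods beyond the points considered, which lie within D + 8. *)
Lemma almost_commute w j : d e w <= kap -> (forall k, (0 < k)%N -> gp w e (h ^+ k)%g <= 19) ->
  (j <= D)%N ->
  d (t * (h ^+ j * (h ^+ 8 * w)))%g (h ^+ j * (t * (h ^+ 8 * w)))%g <= 190.
Proof.
move=> wk wg jD; pose n := (D + 30)%N; pose Q := (h ^+ n)%g.
have T1 : d e t <= d e h := t1; have T2 : d Q (t * Q)%g <= d e h := t2.
pose z := (h ^+ 8 * w)%g; pose z' := (h ^+ j * z)%g.
have lh := carrier_long; have k0 := (k_ge : 1000 <= kap).
have jn : (j <= n)%N by apply: leq_trans jD _; rewrite leq_addr.
have line k : (k < n)%N -> gp (h ^+ k * w)%g e Q <= 42.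
  move=> kn.
  have -> : gp (h ^+ k * w)%g e Q = gp w (h ^- k)%g (h ^+ (n - k))%g.
    by rewrite -[RHS](gpM dM (h ^+ k)%g) mulgV -expgnDr subnKC // ltnW.
  have := gp_extend w e (h ^- k)%g (h ^+ (n - k))%g; have := carrier_gp k (n - k).
  by have := wg (n - k)%N; rewrite subn_gt0 => /(_ kn); tlra.
have far k : (8 <= k)%N -> 3 * d e h <= d e (h ^+ k * w)%g.
  move=> k8; have := carrier_pow k; have := hdT H e (h ^+ k * w)%g (h ^+ k)%g.
  rewrite (hdC H (h ^+ k * w)%g) (dist_mulr dM).
  have : 8 * (d e h / 2) <= k%:R * (d e h / 2).
    by rewrite ler_wpM2r ?ler_nat //; move: lh k0; tlra.
  by move: wk lh k0; tlra.
have farQ k : (k <= D + 8)%N -> 10 * d e h <= d (h ^+ k * w)%g Q.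
  move=> k8.
  have kn : (22 <= n - k)%N by rewrite /n; clear - k8; lia.
  have e1 : d (h ^+ k)%g Q = d e (h ^+ (n - k))%g.
    rewrite -(dist_mulr dM (h ^+ k)%g) -expgnDr subnKC //.
    by apply: leq_trans k8 _; rewrite leq_add2l.
  have := carrier_pow (n - k); have := hdT H (h ^+ k)%g (h ^+ k * w)%g Q.
  rewrite e1 (dist_mulr dM).
  have : 22 * (d e h / 2) <= (n - k)%:R * (d e h / 2).
    by rewrite ler_wpM2r ?ler_nat //; move: lh k0; tlra.
  by move: wk lh k0; tlra.
have z'E : z' = (h ^+ (j + 8) * w)%g by rewrite expgnDr -mulgA.
have zl : gp z e Q <= 42 by apply: line; rewrite ltn_addl.
have z'l : gp z' e Q <= 42 by rewrite z'E; apply: line; rewrite -addnS leq_add.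
have zf : 3 * d e h <= d e z by exact: far.
have z'f : 3 * d e h <= d e z' by rewrite z'E; apply: far; rewrite leq_addl.
have zQ : 10 * d e h <= d z Q by apply: farQ; rewrite leq_addl.
have z'Q : 10 * d e h <= d z' Q by rewrite z'E; apply: farQ; rewrite leq_add2r.
have zu : d e z <= 9 * d e h.
  have := hdT H e (h ^+ 8)%g z; rewrite (dist_mulr dM); have := pow_dist_le H dM h 8.
  by move: wk lh k0; tlra.
have tz x : gp x e Q <= 42 -> 3 * d e h <= d e x -> 10 * d e h <= d x Q ->
    gp (t * x)%g e Q <= 44 /\ 2 * d e h - 44 <= gp e (t * x)%g Q.
  move=> h1 h2 h3.
  have h4 : gp (t * x)%g (t * e)%g (t * Q)%g <= 42 by rewrite gpM.
  have h5 : gp (t * x)%g e Q <= 42 + 2.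
    apply: (swap_ends H h4 (r := d e h)).
    - by rewrite mulg1 (hdC H).
    - by rewrite (hdC H).
    - by rewrite dM (hdC H x); move: h2 lh k0; tlra.
    - by rewrite dM; move: h3 lh k0; tlra.
  have h6 := gpK H e (t * x)%g Q; have h7 := hdT H t e (t * x)%g.
  rewrite (dist_mulr dM) (hdC H t e) in h7.
  by split; move: h5 h6 h7 h2 T1; tlra.
have [tzl tzq] := tz z zl zf zQ; have [tz'l tz'q] := tz z' z'l z'f z'Q.
have B : `|(d e (t * z')%g - d t (t * z')%g) - (d e (t * z)%g - d t (t * z)%g)| <= 2 * 1.
  apply: (busemann H T1).
  case: (gp_or H e (t * z')%g Q (t * z)%g); rewrite ?(gpC H e Q).
    by move: tz'q lh k0; tlra.
  by move: tzq lh k0; tlra.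
rewrite !(dist_mulr dM) in B.
have back x : 42 <= gp e x Q -> gp e (h ^- j)%g x <= 24.
  move=> h1; have := carrier_gp j n; rewrite -/Q.
  by case: (gp_or H e (h ^- j)%g x Q); move: h1; tlra.
have bz : gp e (h ^- j)%g z <= 24.
  by apply: back; have := gpK H e z Q; move: zl zf lh k0; tlra.
have btz : gp e (h ^- j)%g (t * z)%g <= 24.
  by apply: back; move: tzq lh k0; tlra.
have hj x : d (h ^- j)%g x = d e (h ^+ j * x)%g.
  by rewrite -(dM (h ^+ j)%g) mulgV.
rewrite /gp (dV H dM) hj -/z' in bz.
rewrite /gp (dV H dM) hj in btz.
have u1 := hdT H e (h ^+ j)%g z'; rewrite (dist_mulr dM) in u1.
have u2 := hdT H e (h ^+ j)%g (h ^+ j * (t * z))%g; rewrite (dist_mulr dM) in u2.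
have v2l : gp (h ^+ j * (t * z))%g e Q <= 68.
  have -> : gp (h ^+ j * (t * z))%g e Q = gp (t * z)%g (h ^- j)%g (h ^+ (n - j))%g.
    by rewrite -[RHS](gpM dM (h ^+ j)%g) mulgV -expgnDr subnKC.
  apply: (le_trans (gp_extend _ e _ _)).
  suff : gp (t * z)%g e (h ^+ (n - j))%g <= 45.
    by have := carrier_gp j (n - j); tlra.
  have m1 := carrier_mid (leq_subr j n); rewrite -/Q /gp (hdC H _ e) in m1.
  have m2 := hdT H e (t * z)%g Q; have m3 := hdT H e (t * z)%g (h ^+ (n - j))%g.
  have m4 := hdT H e t (t * z)%g; rewrite (dist_mulr dM) in m4.
  have m5 : 15 * d e h <= d e (h ^+ (n - j))%g.
    apply: le_trans (carrier_pow _).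
    have nj : (30 <= n - j)%N by rewrite /n; clear - jD; lia.
    have : 30 * (d e h / 2) <= (n - j)%:R * (d e h / 2).
      by rewrite ler_wpM2r ?ler_nat //; move: lh k0; tlra.
    by tlra.
  case: (gp_or H (t * z)%g e (h ^+ (n - j))%g Q); first by move: tzl; tlra.
  by move: tzl; rewrite /gp; move: m1 m2 m3 m4 m5 zu lh k0 T1; tlra.
have tz'l' : gp (t * z')%g e Q <= 68 by move: tz'l; tlra.
apply: (le_trans (line_dist H tz'l' v2l)).
suff : `|d e (t * z')%g - d e (h ^+ j * (t * z))%g| <= 50 by tlra.
move: B; rewrite !ler_norml => /andP[B1 B2].
by apply/andP; split; move: B1 B2 bz btz u1 u2; tlra.
Qed.
(* Pigeonhole on the elements t^-1 h^-j t h^j, which almost fix a piece of the axis. *)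
Lemma commute_carrier : atmost D (fun t => d e t <= 190 /\ d z0 (t * z0)%g <= 190) ->
  exists j, (0 < j <= D)%N /\ (t * h ^+ j = h ^+ j * t)%g.
Proof.
move=> hD; apply: contrapT => nex.
have base1 k : (0 < k)%N -> gp e e (h ^+ k)%g <= 19 by move=> _; rewrite (gp_base H); tlra.
have e0 : d e e <= kap by rewrite (hd0 H); move: (k_ge : 1000 <= kap); tlra.
pose v j := (h ^- 8 * (t^-1 * (h ^- j * (t * (h ^+ j * h ^+ 8)))))%g.
have vE j w : d w (v j * w)%g = d (t * (h ^+ j * (h ^+ 8 * w)))%g (h ^+ j * (t * (h ^+ 8 * w)))%g.
  have E1 (g : G) : (g * (g^-1 * (t^-1 * (h ^- j * (t * (h ^+ j * g)))) * w) =
      t^-1 * (h ^- j * (t * (h ^+ j * (g * w)))))%g by rewrite -!mulgA mulVKg.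
  by rewrite -(dM (h ^+ 8)%g) E1 -(dM t) mulVKg -(dM (h ^+ j)%g) mulVKg (hdC H).
suff : uniq (map v (iota 0 D.+1)).
  move=> /hD h1; have /h1 : forall x, x \in map v (iota 0 D.+1) ->
      d e x <= 190 /\ d z0 (x * z0)%g <= 190.
    move=> _ /mapP[j + ->]; rewrite mem_iota ltnS => /andP[_ jD]; split.
      by rewrite -[v j]mulg1 vE; exact: almost_commute.
    by rewrite vE; apply: almost_commute => //; [exact: at_base at_E|exact: carrier_base_gp].
  by rewrite size_map size_iota ltnn.
rewrite map_inj_in_uniq ?iota_uniq // => i j.
rewrite !mem_iota !ltnS => /andP[_ iD] /andP[_ jD] vij; apply/eqP; apply: contraT.
wlog ij : i j iD jD vij / (i < j)%N.
  move=> hw ne; have := ne; rewrite neq_ltn => /orP[|] ij; first exact: (hw i j).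
  by apply: (hw j i); rewrite // eq_sym.
move=> _; case: nex; exists (j - i)%N; split.
  by rewrite subn_gt0 ij (leq_trans (leq_subr _ _)).
have {vij} : (h ^- i * (t * h ^+ i) = h ^- j * (t * h ^+ j))%g.
  move: vij => /mulgI.
  have E1 (g : G) k : (t^-1 * (h ^- k * (t * (h ^+ k * g))) =
      t^-1 * (h ^- k * (t * h ^+ k)) * g)%g by rewrite -!mulgA.
  by rewrite !E1 => /mulIg/mulgI.
have : j = (j - i + i)%N by rewrite subnK // ltnW.
move: (j - i)%N => k ->; rewrite expgnDr invgM -!mulgA => /mulgI e1.
apply: (mulIg (h ^+ i)%g); rewrite -!mulgA; apply: (mulgI (h ^- k)%g).
by rewrite -e1 mulKg.
Qed.

(* The element t, commuting with h^j, translates the axis of h. As f is far from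
   this axis and almost fixed by t, the translation is short. *)
Lemma centralizer_thin j : (0 < j)%N -> (t * h ^+ j = h ^+ j * t)%g ->
  let f := (h ^+ (D + 30) * (E (inord 2) * h))%g in
  d f (t * f)%g <= d e h -> d e t <= 190 /\ d z0 (t * z0)%g <= 190.
Proof.
move=> j0 tj; set n := (D + 30)%N; set y := (_ * h)%g; set f := (_ * y)%g => /= fh.
have T1 : d e t <= d e h := t1.
have lh := carrier_long; have k0 := (k_ge : 1000 <= kap).
have fb := hd_ge0 H e f.
have /andP[_ Mf] := truncn_itv fb; set M := (Num.trunc (d e f)).+1 in Mf.
pose K := (n + (20 + M))%N.
pose m := (j * K)%N.
have mn : (n <= m)%N by rewrite /m /K; apply: leq_trans (leq_addr _ _) (leq_pmull _ j0).
have mK : (20 + M <= m)%N.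
  by rewrite /m /K; apply: leq_trans (leq_addl _ _) (leq_pmull _ j0).
pose P := (h ^- m)%g; pose Q := (h ^+ m)%g.
have tQ : (t * Q = Q * t)%g by rewrite /Q /m expgnA; apply: commute_pow.
have tP : (t * P = P * t)%g.
  by apply: (mulgI Q); rewrite /P mulVKg mulgA -tQ -mulgA mulgV mulg1.
have mv (X : G) : (t * X = X * t)%g -> d X (t * X)%g = d e t by move=> ->; rewrite (dist_mulr dM).
have eP : d e P = d e Q by rewrite (dV H dM).
have fQ : 10 * d e h + d e f <= d e Q.
  apply: le_trans (carrier_pow m).
  have : (20 + M)%:R * (d e h / 2) <= m%:R * (d e h / 2).
    by rewrite ler_wpM2r ?ler_nat //; move: lh k0; tlra.
  have : M%:R * 1 <= M%:R * (d e h / 2).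
    by rewrite ler_wpM2l ?ler0n //; move: lh k0; tlra.
  by rewrite natrD mulr1 mulrDl; move: Mf; tlra.
have ax : gp e P Q <= 23 by exact: carrier_gp.
have tax x c : gp x P Q <= c -> c <= 50 -> d e x <= d e h -> gp (t * x)%g P Q <= c + 2.
  move=> h1 h2 h3.
  have h4 : gp (t * x)%g (t * P)%g (t * Q)%g <= c by rewrite gpM.
  have h5 := hdT H e x P; have h6 := hdT H e x Q.
  apply: (swap_ends H h4 (r := d e h)).
  - by rewrite (hdC H) mv.
  - by rewrite (hdC H) mv.
  - by rewrite dM; move: h2 h3 h5 eP fQ fb lh k0; tlra.
  - by rewrite dM; move: h2 h3 h6 fQ fb lh k0; tlra.
have tt := tax e 23 ax _ _; rewrite mulg1 in tt.
have {}tt : gp t P Q <= 25.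
  have := tt; rewrite (hd0 H) => h1; suff : gp t P Q <= 23 + 2 by tlra.
  by apply: h1; move: lh k0; tlra.
have shift X x : (t * X = X * t)%g -> d e X = d e Q -> d e x <= d e f + d e h ->
    `|(d X (t * x)%g - d X x) - (d X t - d X e)| <= 2.
  move=> tX eX xf.
  have := @busemann _ _ _ _ H X (t * X)%g (t * x)%g t (d e h).
  rewrite mv // dM.
  have -> : d (t * X)%g t = d X e by rewrite -{2}[t]mulg1 dM.
  have g1 := hdT H X (t * x)%g e; have g2 := hdT H X t e.
  have g3 := hdT H (t * x)%g t e; have g4 : d (t * x)%g t = d e x.
    by rewrite (hdC H) (dist_mulr dM).
  have g5 := hdC H t e; have g6 := hdC H X e.
  move=> /(_ T1) h1; have {}h1 := h1 _; apply: le_trans (h1 _) _; last by tlra.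
  by rewrite /gp; move: xf g1 g2 g3 g4 g5 g6 eX fQ T1 lh k0; tlra.
(* The factor E 2 takes f off the axis by more than half the length of h. If t shifted the axis
   noticeably, a path from f to t f would have to go down to the axis and back, which is longer than
   d e h. *)
have gf : d e h + 100 <= 2 * gp f P Q.
  have [a a2 ha] := ca_dir ca.
  have K2 := at_len at_E (inord 2); have Ka := at_len at_E a.
  pose P' := (h ^- (n + m))%g; pose Q' := (h ^+ (m - n))%g.
  have -> : gp f P Q = gp y P' Q'.
    rewrite -[RHS](gpM dM (h ^+ n)%g); congr (gp _ _ _).
      by rewrite /P' addnC (expgnDr h m n) invgM mulVKg.
    by rewrite /Q' -(expgnDr h n (m - n)) subnKC.
  have g1 : gp e P' y <= 23.
    rewrite /P' expg_prod.
    have -> : y = (\prod_(g <- [:: E (inord 2); h]) g)%g by rewrite !big_cons big_nil mulg1.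
    apply: carrier_word_gp; apply: subh => g; rewrite !inE => /orP[/eqP->|/eqP->]; last by rewrite eqxx.
    by rewrite codom_f orbT.
  have m1 : (1 <= m - n)%N.
    rewrite subn_gt0; apply: (@leq_trans K); last by rewrite /m leq_pmull.
    by rewrite /K -[n.+1]addn1 leq_add2l.
  have g2 := carrier_mid m1; rewrite expg1 -/Q' in g2; have g3 := gpK H e h Q'.
  have g4 : gp (E (inord 2)) e y <= 21.
    by rewrite /y (gp_at1 dM); exact: (ca_l ca).
  have g5 := gpK H e (E (inord 2)) y.
  have g6 := at_out at_E a2.
  have g7 : 1000 * kap <= gp e (E a) Q'.
    by case: (gp_or H e (E a) h Q'); move: ha Ka g2 g3 lh k0; tlra.
  have g8 : gp e Q' (E (inord 2)) <= kap + 1.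
    by case: (gp_or H e (E a) Q' (E (inord 2))); move: g6 g7 k0; tlra.
  have g9 : gp e Q' y <= kap + 2.
    case: (gp_or H e Q' y (E (inord 2))); rewrite ?(gpC H e y (E _)).
      by move: g8; tlra.
    by move: g4 g5 g8 K2 k0; tlra.
  have g10 : d e (E (inord 2)) + d e h - 42 <= d e y.
    by move: g4; rewrite /gp (hdC H _ e) /y (dist_mulr dM); tlra.
  have g11 := hdT H P' e Q'.
  move: g1 g9; rewrite /gp (hdC H y P') (hdC H y Q'); rewrite (hdC H P' e) in g11.
  by move: g10 g11 K2 lh k0; tlra.
have t_near : d e t <= 80 /\ `|d P t - d P e| <= 28.
  have S1 := shift P f tP eP _; have S2 := shift Q f tQ erefl _.
  have lf : d e f <= d e f + d e h by move: lh k0; tlra.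
  have {}S1 := S1 lf; have {}S2 := S2 lf.
  have q1 := hdT H P e Q; have q2 := hdT H P t Q; have q3 := hdC H e P; have q4 := hdC H e Q.
  have q5 := hdC H t P; have q6 := hdC H t Q; have q7 := hdC H f P; have q8 := hdC H f Q.
  have q9 := hdC H f (t * f)%g; have q10 := hdC H Q (t * f)%g.
  have n1 := hd4 H P (t * f)%g Q f; have n2 := hd4 H P f Q (t * f)%g.
  have sg : `|d P t - d P e| <= 28.
    move: S1 S2 gf ax tt fh; rewrite /gp !ler_norml => /andP[S1 S1'] /andP[S2 S2'] gf' ax' tt' fh'.
    apply/andP; split.
      case: n2 => n2; move: S1 S1' S2 S2' gf' ax' tt' fh' n2 q1 q2 q3 q4 q5 q6 q7 q8 q9 q10; tlra.
    case: n1 => n1; move: S1 S1' S2 S2' gf' ax' tt' fh' n1 q1 q2 q3 q4 q5 q6 q7 q8 q9 q10; tlra.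
  split=> //.
  have ax' : gp e P Q <= 25 by move: ax; tlra.
  have := line_dist H ax' tt; rewrite distrC; move: sg; tlra.
have [tn sg] := t_near; split; first by move: tn; tlra.
have zk := at_base at_E.
have z1 : gp z0 P Q <= 42.
  have := gp_extend z0 e P Q; have := carrier_base_gp (leq_trans _ mK : 0 < m)%N; move: ax; rewrite -/Q.
  by move=> h1 /(_ isT); move: h1; tlra.
have zh : d e z0 <= d e h by move: zk lh k0; tlra.
have z2 := tax z0 42 z1 _ zh.
have z3 := shift P z0 tP eP _; have {}z3 := z3 _.
have lz : d e z0 <= d e f + d e h by move: zh fb; tlra.
have {}z3 := z3 lz.
have {}z2 : gp (t * z0)%g P Q <= 44 by apply: le_trans (z2 _) _; tlra.
have z1' : gp z0 P Q <= 44 by move: z1; tlra.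
have := line_dist H z1' z2; move: z3 sg; rewrite (distrC (d P z0)).
set X := _ - d P z0; set Y := _ - d P e => h1 h2 h3.
have := ler_normD (X - Y) Y; rewrite subrK; move: h1 h2 h3; tlra.
Qed.
End Commuting.
End Carrier.

Lemma hyp_dist_scale (R : realType) (T : Type) (dl dl' r : R) (d : T -> T -> R) :
  hyp_dist dl d -> 0 < r -> dl / r <= dl' -> hyp_dist dl' (fun x y => d x y / r).
Proof.
move=> H r0 hr; have ri : 0 < r^-1 by rewrite invr_gt0.
split=> [x|x y|x y z|a b c f].
- by rewrite (hd0 H) mul0r.
- by rewrite (hdC H).
- by rewrite -mulrDl ler_wpM2r ?(ltW ri) // (hdT H).
- have u (x y : R) : x <= y + 2 * dl -> x / r <= y / r + 2 * dl'.
    move=> h; have : x / r <= (y + 2 * dl) / r by rewrite ler_wpM2r // ltW.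
    by rewrite mulrDl -mulrA; move: hr; clear; lra.
  by rewrite -!mulrDl; case: (hd4 H a b c f) => /u; [left|right].
Qed.

Lemma gp_scale (R : realType) (T : Type) (d : T -> T -> R) (r : R) w x y :
  gp (fun x y => d x y / r) w x y = gp d w x y / r.
Proof. rewrite /gp; lra. Qed.

Section FromAtoms.
Context {R : realType} {G : groupType} {d : G -> G -> R}.
Hypothesis H : hyp_dist 1 d.
Hypothesis dM : forall t g h, d (t * g)%g (t * h)%g = d g h.
Local Notation gp := (gp d).
Local Notation e := (1%g : G).
Context {kap : R} {E : 'I_3 -> G} {z0 : G} {D c : nat} {S : set G} {s : G}.
Hypothesis at_E : atoms (d := d) kap E z0.
Hypothesis k_ge : 1000 <= kap.
Hypothesis thin0 : atmost D (fun t => d e t <= 190 /\ d z0 (t * z0)%g <= 190).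
Hypothesis Ss : S s.
Hypothesis smax : forall s', S s' -> d e s' <= d e s.
Hypothesis bE : forall i, word_ball S c (E i).

Ltac slra := clear - H dM at_E k_ge thin0 Ss smax bE; lra.

Lemma separators_of_atoms : exists (d' : G -> G -> R) A, separators ((D + 33) * (2 * c + 1)) D S d' A.
Proof.
have [a [b ca]] := carrier_exists H dM at_E k_ge s.
set h := (_ * _)%g in ca; set tau := d e s in ca.
have tau0 : 0 <= tau := hd_ge0 H _ _.
have lh' := ca_len ca.
(* The new unit of length. It exceeds tau, so letters have displacement at most 1, and 1000 (kap +
   2), so directions share at most 1/1000. It stays below the length of h by enough for
   [commute_carrier] to apply to elements that move points by rho. *)
pose rho := tau + 1100 * kap.
pose n := (D + 30)%N.
pose f := (h ^+ n * (E (inord 2) * h))%g.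
(* The outer factors E_i determine the six directions; the middle factor f carries the thinness. *)
pose A i := (E i * f * E i)%g.
pose fl := nseq n h ++ [:: E (inord 2); h].
have flE : f = (\prod_(g <- fl) g)%g.
  by rewrite /f /fl big_cat /= expg_prod !big_cons big_nil mulg1.
have fs : {subset fl <= h :: codom E}.
  move=> g; rewrite mem_cat mem_nseq !inE => /orP[/andP[_ ->//]|/orP[/eqP->|->//]].
  by rewrite codom_f orbT.
have Es i : {subset [:: E i] <= h :: codom E}.
  by move=> g; rewrite !inE => /eqP ->; rewrite codom_f orbT.
have wgp us vs : {subset us <= h :: codom E} -> {subset vs <= h :: codom E} ->
    gp (\prod_(g <- us) g)%g e ((\prod_(g <- us) g) * (\prod_(g <- vs) g))%g <= 23.
  move=> hu hv; rewrite (gp_at1 dM); apply: (carrier_word_gp H dM at_E k_ge ca tau0) => g.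
  by rewrite mem_cat => /orP[/hu|/hv].
have w1 i : gp (E i) e (A i) <= 23.
  have := wgp [:: E i] (fl ++ [:: E i]) (Es i); rewrite big_cat /= -flE !big_cons !big_nil !mulg1 mulgA.
  by apply=> g; rewrite mem_cat => /orP[/fs|/Es].
have w2 i : gp (E i * f)%g e (A i) <= 23.
  have := wgp (E i :: fl) [:: E i]; rewrite !big_cons -flE big_nil mulg1; apply; last exact: Es.
  by move=> g; rewrite inE => /predU1P[->|/fs //]; by apply: (Es i); rewrite inE.
have w3 i : gp (E i)^-1%g e (A i)^-1%g <= 23.
  have -> : ((A i)^-1 = (E i)^-1 * (E i * f)^-1)%g by exact: invgM.
  by rewrite (gp_at1 dM) invgK (gpC H) -(gp_at1 dM); exact: w2.
have w4 : gp (h ^+ n)%g e f <= 23.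
  have := wgp (nseq n h) [:: E (inord 2); h].
  rewrite !big_cons big_nil mulg1 -expg_prod; apply=> g.
    by rewrite mem_nseq => /andP[_ /eqP ->]; rewrite inE eqxx.
  by rewrite !inE => /orP[/eqP ->|->//]; rewrite codom_f orbT.
have thA i t : d e t <= rho -> d (A i) (t * A i)%g <= rho ->
    d e ((E i)^-1 * t * E i)%g <= 190 /\ d z0 ((E i)^-1 * t * E i * z0)%g <= 190.
  move=> h1 h2; set t' := (_ * _)%g.
  have h0 : d e (t * e)%g <= rho by rewrite mulg1.
  have u1 : d e t' <= rho + 48.
    have := mid_move H dM h0 h2 (w1 i); rewrite -(dM (E i)^-1%g) mulVg !mulgA -/t'.
    by slra.
  have u2 : d f (t' * f)%g <= rho + 48.
    have := mid_move H dM h0 h2 (w2 i); rewrite -(dM (E i)^-1%g) mulKg !mulgA -/t'.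
    by slra.
  have u1' : d e (t' * e)%g <= rho + 48 by rewrite mulg1.
  have u3 := mid_move H dM u1' u2 w4.
  have k0 : 1000 <= kap := k_ge.
  have v1 : d e t' <= d e h by apply: le_trans u1 _; move: lh' k0; rewrite /rho -/tau; slra.
  have v2 : d f (t' * f)%g <= d e h.
    by apply: le_trans u2 _; move: lh' k0; rewrite /rho -/tau; slra.
  have v3 : d (h ^+ n)%g (t' * h ^+ n)%g <= d e h.
    by apply: le_trans u3 _; move: lh' k0; rewrite /rho -/tau; slra.
  have [j [/andP[j0 _] tj]] := commute_carrier H dM at_E k_ge ca tau0 v1 v3 thin0.
  exact: (centralizer_thin H dM at_E k_ge ca tau0 v1 j0 tj v2).
have r0 : 0 < rho by move: tau0 (k_ge : 1000 <= kap); rewrite /rho; slra.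
exists (fun x y => d x y / rho), A; split.
- by apply: (hyp_dist_scale H r0); rewrite ler_pdivrMr //; move: tau0 (k_ge : 1000 <= kap); rewrite /rho; slra.
- by move=> t g g'; rewrite dM.
- move=> g Sg; rewrite ler_pdivrMr // mul1r; apply: le_trans (smax Sg) _.
  by move: (k_ge : 1000 <= kap); rewrite /rho -/tau; slra.
- move=> i; have bh : word_ball S (2 * c + 1) h.
    apply: (@word_ballW _ _ (c + 1 + c)%N); first by rewrite mul2n -addnn addnAC.
    by apply: word_ballM => //; apply: word_ballM => //; exact: word_ball_gen.
  apply: (@word_ballW _ _ (c + (n * (2 * c + 1) + (c + (2 * c + 1))) + c)%N).
    by rewrite /n; clear; nia.
  apply: word_ballM => //; apply: word_ballM => //; apply: word_ballM; first exact: word_ballX.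
  exact: word_ballM.
- move=> i; rewrite ler_pdivlMr // mul1r.
  have k0 : 1000 <= kap := k_ge; have := w1 i; have := at_len at_E i.
  have := hd_ge0 H (E i) e.
  have lf : d e h - 46 <= d e (f * E i)%g.
    have := wgp [:: h] (nseq (n.-1) h ++ [:: E (inord 2); h; E i]).
    rewrite big_cat /= !big_cons !big_nil !mulg1 -expg_prod.
    have -> : (h * (h ^+ n.-1 * (E (inord 2) * (h * E i))) = f * E i)%g.
      by rewrite /f !mulgA -expgS prednK // /n addnS.
    rewrite /gp (hdC H h e) => h1; have := hd_ge0 H h (f * E i)%g.
    suff : d e h + d h (f * E i)%g - d e (f * E i)%g <= 46 by slra.
    have {}h1 := h1 _ _; suff : (d e h + d h (f * E i)%g - d e (f * E i)%g) / 2 <= 23 by slra.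
    apply: h1 => g.
      by rewrite !inE => ->.
    rewrite mem_cat mem_nseq !inE => /orP[/andP[_ ->//]|/or3P[/eqP ->|->//|/eqP ->]].
      by rewrite codom_f orbT.
    by rewrite codom_f orbT.
  rewrite /gp (hdC H (E i) e) /A -mulgA (dist_mulr dM).
  by move: lf lh' k0; rewrite /rho -/tau; slra.
- have k0 : 1000 <= kap := k_ge.
  pose B x := if x.2 then E x.1 else (E x.1)^-1%g.
  have Bl x : 2000 * kap - 23 <= gp e (B x) (signed_direction A x).
    rewrite /B /signed_direction; case: x => i [] /=.
      by have := gpK H e (E i) (A i); have := w1 i; have := at_len at_E i; slra.
    have := gpK H e (E i)^-1%g (A i)^-1%g; have := w3 i; have := at_len at_E i.
    by rewrite (dV H dM); slra.
  have Bs x y : x != y -> gp e (B x) (B y) <= kap.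
    rewrite /B; case: x => i []; case: y => j [] /= xy.
    - by apply: (at_out at_E); apply: contraNneq xy => ->.
    - by rewrite (gpC H); have := at_in at_E j i; move: k0; slra.
    - by have := at_in at_E i j; move: k0; slra.
    - by apply: (at_outV at_E); apply: contraNneq xy => ->.
  move=> x y xy; have h1 := Bs x y xy; have h2 := Bl x; have h3 := Bl y.
  rewrite gp_scale ler_pdivrMr //.
  have h4 : gp e (signed_direction A x) (B y) <= kap + 1.
    case: (gp_or H e (B x) (signed_direction A x) (B y)) => h4; first by move: h1 h2 h4 k0; slra.
    by move: h1 h4; slra.
  have h5 : gp e (signed_direction A x) (signed_direction A y) <= kap + 2.
    case: (gp_or H e (signed_direction A x) (signed_direction A y) (B y)); first by move: h4; slra.
    by rewrite (gpC H e (signed_direction A y)); move: h3 h4 k0; slra.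
  by move: h5 k0 tau0; rewrite /rho; slra.
- move=> i; apply: (atmost_inj _ _ thin0 (f := fun t => (E i)^-1 * t * E i)%g).
    by move=> t []; rewrite !ler_pdivrMr // !mul1r; exact: thA.
  by move=> t t' _ _ /mulIg/mulgI.
Qed.
End FromAtoms.

Lemma hyp_dist_comp (R : realType) (T U : Type) (dl : R) (d : U -> U -> R) (f : T -> U) :
  hyp_dist dl d -> hyp_dist dl (fun x y => d (f x) (f y)).
Proof.
move=> H; split=> *; [exact: hd0 H _|exact: hdC H _ _|exact: hdT H _ _ _|exact: hd4 H _ _ _ _].
Qed.

Lemma cyclic_subgroup_comm (G : groupType) (p x y : G) : cyclic_subgroup p x ->
  cyclic_subgroup p y -> (x * y = y * x)%g.
Proof.
have pm a b : (p ^+ a * p ^+ b = p ^+ b * p ^+ a)%g by rewrite -!expgnDr addnC.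
have pn a b : (p ^+ a * p ^- b = p ^- b * p ^+ a)%g.
  by apply: (mulgI (p ^+ b)%g); rewrite mulVKg mulgA pm mulgK.
move=> [a [->|->]] [b [->|->]].
- exact: pm.
- exact: pn.
- by rewrite -pn.
- by rewrite -[LHS]invgM -[RHS]invgM pm.
Qed.

Definition axis_len_bound (r c N D : nat) : nat :=
  (20 * (10 + N + D) * (6 + r) * c + 2)%N.

Lemma separators_of_axis (R : realType) (G : groupType) (d : G -> G -> R)
    (p : G) (S : set G) (r0 c N D : nat) :
  (8500 <= r0)%N ->
  hyp_dist 1 d -> (forall t g h, d (t * g)%g (t * h)%g = d g h) ->
  gp d 1%g p^-1%g p <= 15 -> 1000 <= d 1%g p -> (0 < N)%N ->
  (forall r, exists N D, forall n, (N <= n)%N ->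
     atmost D (fun t => d 1%g t <= r /\ d (p ^+ n)%g (t * p ^+ n)%g <= r)) ->
  atmost D (fun t => d 1%g t <= 190 /\ d (p ^+ N)%g (t * p ^+ N)%g <= 190) ->
  ~ virtually_cyclic G -> fin_gen_set S -> word_ball S c p ->
  exists (d' : G -> G -> R) A,
    separators ((D + 33) * (2 * axis_len_bound r0 c N D + 1)) D S d' A.
Proof.
move=> hr0 H dM hp lp N0 hW hD nvc [fS SV gen] Sp.
have [s Ss ns] := commensuration H dM hp lp D hW nvc gen.
pose C := cyclic_subgroup p.
have C1 : C 1%g by exists 0%N; left.
(* The distance between the two axes need not be attained; minimizing its integer part realizes it
   up to 1, which is what [near_min] asks for. *)
have [x0 [y0 [Cx0 Cy0 hmin]]] : exists x0 y0, [/\ C x0, C y0 &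
    forall x y, C x -> C y -> d x0 (s * y0)%g <= d x (s * y)%g + 1].
  pose Q k := `[< exists x y, [/\ C x, C y & Num.trunc (d x (s * y)%g) = k] >].
  have exQ : exists k, Q k.
    by exists (Num.trunc (d 1%g (s * 1)%g)); apply/asboolP; exists 1%g, 1%g.
  case: (ex_minnP exQ) => k /asboolP[x0 [y0 [Cx Cy xy]]] kmin.
  exists x0, y0; split=> // x y Cx' Cy'.
  have /kmin h : Q (Num.trunc (d x (s * y)%g)) by apply/asboolP; exists x, y.
  have /andP[_ h1] := truncn_itv (hd_ge0 H x0 (s * y0)%g).
  have /andP[h2 _] := truncn_itv (hd_ge0 H x (s * y)%g).
  move: h1; rewrite xy -[k.+1%:R]natr1 => h1; move: h; rewrite -(ler_nat R) => h3.
  by move: h1 h2 h3; clear; lra.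
have CM x y : C x -> C y -> (x * y = y * x)%g by exact: cyclic_subgroup_comm.
have Cp n : C (p ^+ n)%g by exists n; left.
(* Moving the base point to x0 turns s y0 x0^-1 into a near-minimal element. Powers of p commute
   with x0, so the distances between them do not change. *)
pose d' g h := d (g * x0)%g (h * x0)%g.
have H' : hyp_dist 1 d' by exact: hyp_dist_comp.
have dM' t g h : d' (t * g)%g (t * h)%g = d' g h by rewrite /d' -!mulgA dM.
have dC x y : C x -> C y -> d' x y = d x y.
  by move=> Cx Cy; rewrite /d' (CM x) // (CM y) // dM.
have Cp1 : C p := Cp 1%N.
have CpV : C p^-1%g by exists 1%N; right.
have hp' : gp d' 1%g p^-1%g p <= 15 by rewrite /gp !dC.
have lp' : 1000 <= d' 1%g p by rewrite dC.
pose u := (s * y0 * x0^-1)%g.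
have um : near_min (d := d') p u.
  move=> x y Cx Cy; rewrite /d' mul1g /u mulgVK.
  have -> : (s * y0 * x0^-1 * y * x0 = s * (y0 * y))%g.
    by rewrite -!mulgA -(CM x0) // mulKg.
  by apply: hmin; exact: cyclic_subgroupM.
have conj r n : atmost D (fun t => d 1%g t <= r /\ d (p ^+ n)%g (t * p ^+ n)%g <= r) ->
    atmost D (fun t => d' 1%g t <= r /\ d' (p ^+ n)%g (t * p ^+ n)%g <= r).
  apply: (atmost_inj (f := fun t => x0^-1 * t * x0)%g) => [t [h1 h2]|t t' _ _ /mulIg/mulgI //].
  split; first by rewrite -(dM x0) mulg1 -!mulgA mulVKg -[X in d X]mul1g.
  by rewrite -(dM x0) -!mulgA mulVKg (CM x0) //; move: h2; rewrite /d' -!mulgA.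
have hD' := conj _ _ hD.
have uC X Y : C X -> (u * X = Y * u)%g -> (s * X = Y * s)%g.
  move=> CX; have Cv : C (y0 * x0^-1)%g by apply: cyclic_subgroupM => //; exact: cyclic_subgroupV.
  have -> : u = (s * (y0 * x0^-1))%g by rewrite mulgA.
  by rewrite -mulgA (CM _ _ Cv CX) !mulgA => /mulIg/mulIg.
have nu j : (0 < j <= D)%N -> (u * p ^+ j)%g <> (p ^+ j * u)%g /\
    (u * p ^+ j)%g <> (p ^- j * u)%g.
  by move=> /ns[n1 n2]; split=> /(uC _ _ (Cp j)).
have nuV j : (0 < j <= D)%N -> (u^-1 * p ^+ j)%g <> (p ^+ j * u^-1)%g /\
    (u^-1 * p ^+ j)%g <> (p ^- j * u^-1)%g.
  move=> /nu[n1 n2]; split=> h.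
    by apply: n1; apply: (mulgI u^-1%g); rewrite mulKg mulgA h mulgVK.
  by apply: n2; move: (congr1 (fun x => x^-1)%g h); rewrite !invgM !invgK => ->.
have hD146 : atmost D (fun t => d' 1%g t <= 146 /\ d' (p ^+ N)%g (t * p ^+ N)%g <= 146).
  by apply: atmost_sub (leqnn _) _ hD' => t []; split; lra.
have ap x y : C x -> C y ->
    gp d' 1%g x (u * y)%g <= (10 + N + D)%:R * d' 1%g p /\
    gp d' 1%g x (u^-1 * y)%g <= (10 + N + D)%:R * d' 1%g p.
  move=> Cx Cy; split.
    exact: (axes_apart H' dM' hp' lp' um hD146 nu).
  exact: (axes_apart H' dM' hp' lp' (near_minV H' dM' um) hD146 nuV).
have at_E := @pieces_atoms _ _ _ H' dM' p u (10 + N + D) r0 N hp' lp' _ hr0 ap.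
have K0 : (0 < N <= 10 + N + D)%N by rewrite N0 -addnA addnCA leq_addr.
have {}at_E := at_E K0.
have k_ge : 1000 <= 42 * ((10 + N + D)%:R * d' 1%g p).
  have : (1 : R) <= (10 + N + D)%:R by rewrite ler1n.
  by move: lp'; clear; nra.
have [l [_ lS _]] := finite_enum fS.
have [sm sml smax] := seq_argmax (d' 1%g) ((lS s).1 Ss).
have bE (i : 'I_3) : word_ball S (axis_len_bound r0 c N D) (piece p u (20 * (10 + N + D)) r0 i.+1).
  set n := (20 * (10 + N + D))%N; have i3 := ltn_ord i.
  have uu m : (u * p ^+ m * u^-1 = s * p ^+ m * s^-1)%g.
    have Cv : C (y0 * x0^-1)%g by apply: cyclic_subgroupM => //; exact: cyclic_subgroupV.
    have -> : u = (s * (y0 * x0^-1))%g by rewrite mulgA.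
    move: (y0 * x0^-1)%g Cv => v Cv.
    by rewrite -(mulgA s) (CM _ _ Cv (Cp m)) invgM !mulgA mulgK.
  apply: (@word_ballW _ _ ((n * i.+1) * c + ((1 + (n * r0) * c + 1) + (n * i.+1) * c))%N).
    rewrite /axis_len_bound -/n; have : (n * i.+1 * c <= n * 3 * c)%N.
      by rewrite leq_mul2r leq_mul2l i3 !orbT.
    by clear; lia.
  rewrite /piece uu; apply: word_ballM; first exact: word_ballX.
  apply: word_ballM; last exact: word_ballX.
  apply: word_ballM; last by apply/word_ball_gen/SV.
  by apply: word_ballM; [exact: word_ball_gen|exact: word_ballX].
apply: (separators_of_atoms H' dM' at_E k_ge hD' _ _ bE (s := sm)).
  exact/lS.
by move=> s' /lS/smax.
Qed.

(** * Axes of WPD elements *)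

Section Action.
Context {R : realType} {G : groupType} {X : metricType R}.
Context {act : G -> X -> X} {delta : R}.
Hypothesis dl0 : 0 < delta.
Hypothesis hX : hyperbolic_space X delta.
Hypothesis hA : isometric_action act.

Definition ndist (x y : X) : R := mdist x y / delta.

Lemma hyp_ndist : hyp_dist 1 ndist.
Proof.
have [_ h4] := hX.
have H0 : hyp_dist delta (fun x y : X => mdist x y).
  split; [exact: mdistxx|exact: metric_sym|by move=> *; exact: metric_triangle|].
  move=> a b c f; have := h4 a c b f; rewrite /gromov_product (metric_sym b c) minEle.
  by case: ifP => _; [left|right]; lra.
by apply: (hyp_dist_scale H0 dl0); rewrite divff ?gt_eqF.
Qed.

Lemma act_dist g x y : ndist (act g x) (act g y) = ndist x y.
Proof. by have [_ _ h] := hA; rewrite /ndist h. Qed.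

Lemma actM g k x : act (g * k)%g x = act g (act k x).
Proof. by have [_ h _] := hA. Qed.

Lemma act1 x : act 1%g x = x.
Proof. by have [h _ _] := hA. Qed.

Lemma translation_length_le g x n : hyperbolic_element act g -> (0 < n)%N ->
  n%:R * translation_length act g <= mdist x (act (g ^+ n)%g x).
Proof.
rewrite /hyperbolic_element /translation_length => h n0.
set A := (X in get X) in h *.
(* If no limit existed, [get] would return its default value 0, against hyperbolicity. *)
have /getPex/(_ x) : exists l, A l.
  apply: contrapT => nA; move: h; rewrite getPN ?ltxx // => l Al.
  by apply: nA; exists l.
set l := get A => cv.
rewrite leNgt; apply/negP => lt.
have sub m : mdist x (act (g ^+ (m * n))%g x) <= m%:R * mdist x (act (g ^+ n)%g x).
  elim: m => [|m IH]; first by rewrite mul0n expg0 act1 mdistxx mul0r.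
  have := metric_triangle x (act (g ^+ n)%g x) (act (g ^+ (m.+1 * n))%g x).
  have [_ _ isoA] := hA; rewrite mulSn expgnDr actM isoA.
  by rewrite -[m.+1%:R]natr1; move: IH; clear; lra.
have h1 : mdist x (act (g ^+ n)%g x) / n%:R < l.
  by rewrite ltr_pdivrMr ?ltr0n // mulrC.
have [N _ hN] := cvgr_gt _ cv _ h1.
have := hN (N.+1 * n)%N; rewrite /= => /(_ _).
have le : (N <= N.+1 * n)%N by apply: leq_trans (leqnSn _) _; rewrite leq_pmulr.
move=> /(_ le); rewrite ltNge => /negP; apply.
rewrite ler_pdivrMr ?ltr0n ?muln_gt0 ?n0 //; apply: le_trans (sub _) _.
have n1 : (n%:R : R) != 0 by rewrite pnatr_eq0 -lt0n.
rewrite natrM; set M := mdist _ _; set k : R := N.+1%:R.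
by have -> : M / n%:R * (k * n%:R) = k * M by field.
Qed.
Definition odist (x : X) (g k : G) : R := ndist (act g x) (act k x).

Lemma hyp_odist x : hyp_dist 1 (odist x).
Proof. exact: hyp_dist_comp hyp_ndist. Qed.

Lemma odistM x t g k : odist x (t * g)%g (t * k)%g = odist x g k.
Proof. by rewrite /odist !actM act_dist. Qed.

Section Translates.
Context {h : G} {x : X} {sigma : set X}.
Hypothesis hL : 10 * delta <= min_displacement act h.
Hypothesis hx : mdist x (act h x) = min_displacement act h.
Hypothesis hs : geodesic_segment sigma x (act h x).
Local Notation d := (odist x).
Let H := hyp_odist x.
Let dM := odistM x.
Let Hn := hyp_ndist.

Lemma min_axis_step : 10 <= d 1%g h.
Proof. by rewrite /odist act1 /ndist ler_pdivlMr // hx. Qed.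

Lemma geodesic_point (r : R) : 0 <= r <= d 1%g h -> exists y, [/\ sigma y,
  ndist x y = r & ndist y (act h x) = d 1%g h - r].
Proof.
rewrite /odist act1 => /andP[r0 rl].
have [c [c0 c1 iso ->]] := hs.
have rd : 0 <= r * delta <= mdist x (act h x).
  by rewrite mulr_ge0 ?(ltW dl0) //=; move: rl; rewrite /ndist ler_pdivlMr.
have l0 : 0 <= mdist x (act h x) by exact: mdist_ge0.
exists (c (r * delta)); split.
- by exists (r * delta).
- rewrite /ndist -{1}c0 iso ?lexx //=.
  by rewrite sub0r normrN ger0_norm ?mulfK ?gt_eqF //; move: rd => /andP[].
- rewrite /ndist -{1}c1 iso ?lexx ?l0 //.
  move: rd => /andP[_ rd]; rewrite ler0_norm ?subr_le0 // opprB.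
  by rewrite mulrBl mulfK ?gt_eqF.
Qed.

(** The midpoint m of the geodesic from x to h x is moved by at least the minimal displacement. If
    the path through x, h x and h^2 x folded at h x, then h m would be too close to m. *)
Lemma min_axis_gp : gp d 1%g h^-1%g h <= 2.
Proof.
have l10 := min_axis_step; have HX := Hn.
have [|m [_ m1 m2]] := @geodesic_point (d 1%g h / 2).
  by apply/andP; split; move: l10; lra.
have le : d 1%g h <= ndist m (act h m).
  rewrite /odist act1 /ndist ler_pM2r ?invr_gt0 // hx.
  by apply: ge_inf; [exists 0 => _ [y _ <-]; exact: mdist_ge0|exists m].
have e1 : ndist (act h x) (act h m) = d 1%g h / 2 by rewrite act_dist.
have e2 : ndist (act h m) (act h (act h x)) = d 1%g h / 2.
  by rewrite act_dist m2; lra.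
have e3 : ndist x (act h x) = d 1%g h by rewrite /odist act1.
have e4 : ndist (act h x) (act h (act h x)) = d 1%g h by rewrite act_dist.
have goalE : gp d 1%g h^-1%g h = gp ndist (act h x) x (act h (act h x)).
  rewrite -(gpM dM h) mulgV mulg1 /gp /odist act1 actM //.
rewrite goalE.
have g1 : gp ndist (act h x) m (act h m) <= 0.
  by rewrite /gp (hdC HX (act h x) m) m2 e1; lra.
have g2 : gp ndist (act h x) x m = d 1%g h / 2.
  by rewrite /gp (hdC HX (act h x) x) (hdC HX (act h x) m) e3 m1 m2; lra.
have g3 : gp ndist (act h x) (act h m) (act h (act h x)) = d 1%g h / 2.
  by rewrite /gp e1 e2 e4; lra.
have g4 : gp ndist (act h x) x (act h m) <= 1.
  case: (gp_or HX (act h x) m x (act h m)); rewrite ?(gpC HX _ m x); lra.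
case: (gp_or HX (act h x) x (act h (act h x)) (act h m)).
  by move: g4; lra.
by rewrite (gpC HX _ (act h (act h x))); lra.
Qed.
Lemma min_axis_pow m n : gp d 1%g (h ^- m)%g (h ^+ n)%g <= 4.
Proof.
have l : 2 * 2 + 3 * 1 < d 1%g h by have := min_axis_step; lra.
by have := gp_pow H dM m n min_axis_gp l; lra.
Qed.

Lemma min_axis_mid i n : (i <= n)%N -> gp d (h ^+ i)%g 1%g (h ^+ n)%g <= 4.
Proof. exact: (pow_mid dM min_axis_pow). Qed.

Lemma min_axis_far (r : R) : exists K, forall n, (K <= n)%N -> r < d 1%g (h ^+ n)%g.
Proof. by apply: (pow_far H dM min_axis_pow (r := 2)); have := min_axis_step; lra. Qed.

(** Commuting with h, p moves the far points h^-K and h^K by its own displacement only, so it acts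
    as a shift along the axis of h, and p^-1 and p lie on opposite sides of 1. It serves for powers
    of g, of which only h is known to have a minimal axis. *)
Lemma commuting_gp p : (p * h = h * p)%g -> 1000 <= d 1%g p -> gp d 1%g p^-1%g p <= 15.
Proof.
move=> ph lp.
have [K /(_ K (leqnn K)) hK] := min_axis_far (3 * d 1%g p + 100).
pose P := (h ^- K)%g; pose Q := (h ^+ K)%g.
have pQ : (p * Q = Q * p)%g by exact: commute_pow.
have pP : (p * P = P * p)%g.
  by apply: (mulgI Q); rewrite /P mulVKg mulgA -pQ -mulgA mulgV mulg1.
have eP : d 1%g P = d 1%g Q by exact: (dV H dM).
have ax : gp d 1%g P Q <= 4 by exact: min_axis_pow.
have Pp : d (p * P)%g P = d 1%g p.
  by rewrite pP (hdC H) -{1}[P]mulg1 dM.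
have Qp : d (p * Q)%g Q = d 1%g p.
  by rewrite pQ (hdC H) -{1}[Q]mulg1 dM.
have pl w : d p (p * w)%g = d 1%g w by rewrite -{1}[p]mulg1 dM.
have hK' : 3 * d 1%g p + 100 < d 1%g Q := hK.
have gpp : gp d p P Q <= 4 + 2.
  have h4 : gp d p (p * P)%g (p * Q)%g <= 4 by rewrite -{1}[p]mulg1 gpM.
  by apply: (swap_ends H h4 (r := d 1%g p)); rewrite ?Pp ?Qp ?pl ?eP //; move: hK'; lra.
have t1 := hdT H P p 1%g; have t2 := hdT H P 1%g p; have s1 := hdC H p 1%g; have s2 := hdC H P 1%g.
have B : `|(d P p - d (p * P)%g p) - (d P 1%g - d (p * P)%g 1%g)| <= 2 * 1.
  apply: (busemann H (r := d 1%g p)); first by rewrite (hdC H) Pp.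
  by rewrite /gp s1; move: hK' t1 t2 s2 eP; lra.
rewrite (hdC H (p * P)%g p) pl in B.
have e1 : d (p * P)%g 1%g = d P p^-1%g by rewrite -(dM p^-1%g) mulKg mulg1.
rewrite e1 in B.
have ax' : gp d 1%g P Q <= 6 by move: ax; lra.
have gpp' : gp d p P Q <= 6 by move: gpp; lra.
have ld := line_dist H gpp' ax'; rewrite s1 in ld.
have t3 := hdT H P p^-1%g p; have t4 := hdT H P p p^-1%g; have s3 := hdC H p p^-1%g.
rewrite /gp (dV H dM).
move: B ld; rewrite ler_norml => /andP[B1 B2].
have [h1|/ltW h1] := leP 0 (d P p - d P 1%g).
  by rewrite ger0_norm // => ld; move: B1 B2 ld t3 t4 s2 s3 eP lp; lra.
by rewrite ler0_norm // => ld; move: B1 B2 ld t3 t4 s2 s3 eP lp; lra.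
Qed.

(** The power of g that h stands for is not bounded, so the points h^k x may be too sparse. A point
    inside a translate of [sigma] lies at distance r up to an error independent of h. *)
Lemma axis_point (r : R) : 0 < r -> exists i k y, [/\ sigma y,
  r - 8 <= ndist x (act (h ^+ k)%g y) <= r &
  forall K, (i <= K)%N -> gp ndist (act (h ^+ k)%g y) x (act (h ^+ K)%g x) <= 8].
Proof.
move=> r0.
have ex : exists i, r <= d 1%g (h ^+ i)%g.
  by have [K /(_ K (leqnn K))/ltW] := min_axis_far r; exists K.
have [i hi imin] := ex_minnP ex.
case: i hi imin => [|i] hi imin; first by move: hi; rewrite (hd0 H) leNgt r0.
have lt : d 1%g (h ^+ i)%g < r by rewrite ltNge; apply/negP => /imin; rewrite ltnn.
have st : d (h ^+ i)%g (h ^+ i.+1)%g = d 1%g h.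
  by rewrite expgSr -{1}[(h ^+ i)%g]mulg1 dM.
have tr := hdT H 1%g (h ^+ i)%g (h ^+ i.+1)%g.
have [|y [sy y1 y2]] := @geodesic_point (r - d 1%g (h ^+ i)%g).
  by apply/andP; split; move: lt hi tr st; lra.
have d1 u : d 1%g u = ndist x (act u x) by rewrite /odist act1.
set z := act (h ^+ i)%g y.
have z1 : ndist (act (h ^+ i)%g x) z = r - d 1%g (h ^+ i)%g by rewrite act_dist.
have z2 : ndist z (act (h ^+ i.+1)%g x) = d 1%g h - (r - d 1%g (h ^+ i)%g).
  by rewrite expgSr actM act_dist.
have m1 := min_axis_mid (leqnSn i); rewrite /gp st (hdC H _ 1%g) in m1.
have tz := hdT Hn x (act (h ^+ i)%g x) z; rewrite -d1 z1 in tz.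
have tz2 := hdT Hn x z (act (h ^+ i.+1)%g x); rewrite -d1 z2 in tz2.
exists i.+1, i, y; split=> //.
  by rewrite -/z; apply/andP; split; move: m1 tz tz2; lra.
move=> K iK; rewrite -/z.
have m2 := min_axis_mid iK; rewrite /gp (hdC H _ 1%g) in m2.
have e2 : d (h ^+ i.+1)%g (h ^+ K)%g = ndist (act (h ^+ i.+1)%g x) (act (h ^+ K)%g x) by [].
have tz3 := hdT Hn z (act (h ^+ i.+1)%g x) (act (h ^+ K)%g x); rewrite -e2 z2 in tz3.
by rewrite /gp (hdC Hn z x) -d1; move: m1 m2 tz tz3; lra.
Qed.

End Translates.
End Action.

Section AxisOfWPD.
Context {R : realType} {G : groupType} {X : metricType R}.
Context {act : G -> X -> X} {delta : R} {D : R -> R}.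
Hypothesis dl0 : 0 < delta.
Hypothesis hX : hyperbolic_space X delta.
Hypothesis hA : isometric_action act.
Hypothesis hD : WPD_function delta D.

(** 106 is 2 * 52 + 2, the loss in [conv_dist] when a displacement r at x and at p^n x is
    transferred to a point of the axis between them. *)
Definition wpd_bound (r : R) : nat := Num.trunc (D ((`|r| + 106) * delta)).

(** Powers of g commute with h, so those that move x little also move the far point h^K x little,
    and WPD bounds their number; hence some g^j with j bounded in terms of D moves x by 1000 units.
    As lambda(g) is at most the displacement of p = g^j, a number of periods depending only on D
    covers the length D(eps) lambda(g). *)
Lemma axis_of_WPD g : WPD_element act delta D g -> exists (x : X) (j : nat),
  let p := (g ^+ j)%g in let d := odist (act := act) (delta := delta) x in
  [/\ (j <= (Num.trunc (D (1000 * delta))).+1)%N,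
    gp d 1%g p^-1%g p <= 15, 1000 <= d 1%g p &
    forall r n, (2 * wpd_bound r + 3 <= n)%N ->
      atmost (wpd_bound r) (fun t => d 1%g t <= r /\ d (p ^+ n)%g (t * p ^+ n)%g <= r)].
Proof.
move=> [hyp [gamma ax wpd]]; set lam := translation_length act g in wpd.
have [D0 DM _] := hD.
have l0 : 0 < lam := hyp.
have [n0 [n0_gt0 hL [x [sigma [hx hs gE]]]]] : exists n0, [/\ (0 < n0)%N,
    10 * delta <= min_displacement act (g ^+ n0)%g & translates_axis act (g ^+ n0)%g gamma].
  case: ax => [[h1 h2]|[_ [n [h0 h1 h2]]]]; last by exists n.
  by exists 1%N; rewrite expg1.
set h := (g ^+ n0)%g in hL hx hs gE.
pose d := odist (act := act) (delta := delta) x.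
have H : hyp_dist 1 d := hyp_odist dl0 hX x.
have dM : forall t g h, d (t * g)%g (t * h)%g = d g h := odistM hA x.
have Hn := hyp_ndist dl0 hX.
have d1 u : d 1%g u = ndist (delta := delta) x (act u x) by rewrite /d /odist (act1 hA).
have lenX u v : mdist u v = ndist (delta := delta) u v * delta.
  by rewrite /ndist divfK // gt_eqF.
have gam k y : sigma y -> gamma (act (h ^+ k)%g y).
  by move=> sy; rewrite gE; exists (h ^+ k)%g; [exists k; left|exists y].
have sx : sigma x.
  have [c [c0 _ _ ->]] := hs; exists 0; rewrite //= lexx mdist_ge0 //.
have gx k : gamma (act (h ^+ k)%g x) by exact: gam.
have low n : (0 < n)%N -> n%:R * lam <= d 1%g (g ^+ n)%g * delta.
  by move=> n1; rewrite d1 -lenX; exact: (translation_length_le hA x hyp n1).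
have ginj : injective (fun n => g ^+ n)%g.
  move=> m n /= mn; apply/eqP; apply: contraT.
  wlog lt : m n mn / (m < n)%N.
    move=> hw ne; have := ne; rewrite neq_ltn => /orP[|] lt; first exact: (hw m n).
    by apply: (hw n m); rewrite // eq_sym.
  move=> _; have nm : (0 < n - m)%N by rewrite subn_gt0.
  have E : (g ^+ (n - m) = 1)%g.
    by apply: (mulIg (g ^+ m)%g); rewrite -expgnDr subnK 1?ltnW // mul1g.
  have := low _ nm; rewrite E (hd0 H) mul0r leNgt mulr_gt0 // ltr0n //.
have [j [j1 jJ lj]] : exists j, [/\ (0 < j)%N, (j <= (Num.trunc (D (1000 * delta))).+1)%N &
    1000 <= d 1%g (g ^+ j)%g].
  apply: contrapT => nex; pose J := (Num.trunc (D (1000 * delta))).+1.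
  pose eps := 1000 * delta.
  have e0 : 0 < eps by move: (dl0 : 0 < delta); rewrite /eps; lra.
  have [K /(_ K (leqnn K)) hK] := min_axis_far dl0 hX hA hL hx hs (D eps * lam / delta).
  have gx0 : gamma x by have := gx 0%N; rewrite expg0 (act1 hA).
  have := wpd eps e0 x (act (h ^+ K)%g x) gx0 (gx K).
  rewrite lenX -d1 -ler_pdivrMr // (ltW hK) => /(_ isT) /= [fA cA].
  have small t : d 1%g t <= 1000 -> mdist (act t x) x <= eps.
    by move=> ht; rewrite lenX (hdC Hn) -d1 ler_pM2r.
  have := finite_atmost fA => /(_ (map (fun j => g ^+ j)%g (iota 0 J.+1))).
  rewrite map_inj_uniq // iota_uniq size_map size_iota => /(_ isT) h1.
  have {}h1 := h1 _.
  suff h2 : forall t, t \in map (fun j => g ^+ j)%g (iota 0 J.+1) ->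
      mdist (act t x) x <= eps /\
      mdist (act t (act (h ^+ K)%g x)) (act (h ^+ K)%g x) <= eps.
    have := h1 h2; rewrite -(ler_nat R) => /le_trans/(_ cA).
    have /andP[_ h3] := truncn_itv (ltW (D0 _ e0)).
    have {}h3 : D eps < J%:R := h3.
    by apply/negP; rewrite -ltNge; apply: (lt_trans h3); rewrite ltr_nat.
  move=> _ /mapP[i + ->]; rewrite mem_iota ltnS => /andP[_ iJ].
  have li : d 1%g (g ^+ i)%g <= 1000.
    case: i iJ => [|i] iJ; first by rewrite expg0 (hd0 H); lra.
    by apply/ltW; rewrite ltNge; apply/negP => h2; apply: nex; exists i.+1.
  split; first exact: small.
  have -> : act (g ^+ i)%g (act (h ^+ K)%g x) = act (h ^+ K)%g (act (g ^+ i)%g x).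
    by rewrite -!(actM hA) /h -expgnA -!expgnDr addnC.
  by have [_ _ ->] := hA; exact: small.
set p := (g ^+ j)%g in lj.
have ph : (p * h = h * p)%g by rewrite /p /h -!expgnDr addnC.
have hp : gp d 1%g p^-1%g p <= 15 by exact: (commuting_gp dl0 hX hA hL hx hs ph lj).
have lp : lam <= d 1%g p * delta.
  apply: le_trans (low j j1); rewrite ler_peMl ?(ltW l0) // ler1n //.
exists x, j; split=> // r n hn; rewrite -/p -/d.
pose eps := (`|r| + 106) * delta.
have e0 : 0 < eps by rewrite mulr_gt0 // ltr_wpDl.
have Dl : 0 <= D eps * lam / delta.
  by rewrite mulr_ge0 ?invr_ge0 ?mulr_ge0 // ltW // D0.
pose r0 := D eps * lam / delta + 8.
have r0_gt0 : 0 < r0 by rewrite /r0; lra.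
have [i [k [y [sy /andP[y1 y2] yK]]]] := axis_point dl0 hX hA hL hx hs r0_gt0.
set z := act (h ^+ k)%g y in y1 y2 yK.
have long_n : r0 <= d 1%g (p ^+ n)%g.
  apply: le_trans (axis_len H dM hp lj n).
  have e1 : D eps * lam / delta <= D eps * d 1%g p.
    by rewrite -mulrA ler_pM2l ?D0 // ler_pdivrMr.
  have /andP[_ e2] := truncn_itv (ltW (D0 _ e0)).
  have e3 : 2 * (wpd_bound r)%:R + 3 <= n%:R :> R by rewrite -natrM -natrD ler_nat.
  have e4 : 2 * D eps + 1 <= n%:R.
    by move: e2; rewrite -[_.+1%:R]natr1 -/(wpd_bound r); move: e3; lra.
  have lj' : 1000 <= d 1%g p := lj.
  have : (2 * D eps + 1) * (d 1%g p / 2) <= n%:R * (d 1%g p / 2).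
    by rewrite ler_wpM2r //; lra.
  by rewrite /r0; lra.
pose K := (j * (n + i))%N.
have QE : (p ^+ (n0 * (n + i)) = h ^+ K)%g by rewrite /p /h /K -!expgnA mulnCA.
have iK : (i <= K)%N by apply: leq_trans (leq_addl n i) (leq_pmull _ j1).
have nK : (n <= n0 * (n + i))%N by apply: leq_trans (leq_addr i n) (leq_pmull _ n0_gt0).
have ga := yK K iK.
set Q := act (h ^+ K)%g x in ga; set zp := act (p ^+ n)%g x.
have gb : gp (ndist (delta := delta)) zp x Q <= 17.
  by have := axis_mid H dM hp lj nK; rewrite QE /gp /d /odist (act1 hA).
have xz : ndist (delta := delta) x z <= ndist (delta := delta) x zp.
  by rewrite -[X in _ <= X]d1; apply: (le_trans y2).
have gc : gp (ndist (delta := delta)) z x zp <= 52.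
  case: (gp_or Hn z x zp Q) => h1; first by move: ga h1; clear; lra.
  apply: (le_trans (gp_ler Hn _ _ _)); have tr := hdT Hn x z Q.
  by move: ga h1 gb tr xz; rewrite /gp (hdC Hn zp x) (hdC Hn z x); clear; lra.
have gx0 : gamma x by have := gx 0%N; rewrite expg0 (act1 hA).
have gz : gamma z by exact: gam.
have Dz : D eps * lam <= mdist x z.
  by rewrite lenX -ler_pdivrMr //; move: y1; rewrite /r0; clear; lra.
have [fA cA] := wpd eps e0 x z gx0 gz Dz.
pose Z := [set t | mdist (act t x) x <= eps /\ mdist (act t z) z <= eps].
have cA' : (#|` fset_set Z| <= wpd_bound r)%N.
  rewrite -ltnS -(ltr_nat R); apply: (le_lt_trans cA).
  by have /andP[_] := truncn_itv (ltW (D0 _ e0)).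
apply: (atmost_sub cA' _ (finite_atmost fA)) => t [t1 t2].
have u1 : ndist (delta := delta) x (act t x) <= r by rewrite -d1.
have u2 : ndist (delta := delta) zp (act t zp) <= r.
  by rewrite /zp -(actM hA); exact: t2.
have u3 := conv_dist Hn gc (act_dist hA t x zp) (act_dist hA t x z) (act_dist hA t zp z) u1 u2.
have rr := ler_norm r.
split; rewrite lenX ler_pM2r // (hdC Hn); first by move: u1 rr; clear - dl0 hX hA hD; lra.
by move: u3 rr; clear - dl0 hX hA hD; lra.
Qed.
End AxisOfWPD.

Section Uniformity.
Context {R : realType} {G : groupType} {X : metricType R}.
Context {act : G -> X -> X} {delta : R} {D : R -> R} {M : nat}.
Hypothesis dl0 : 0 < delta.
Hypothesis hX : hyperbolic_space X delta.
Hypothesis hA : isometric_action act.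
Hypothesis hD : WPD_function delta D.
Hypothesis hM : forall S : set G, fin_gen_set S ->
  exists g, [/\ word_ball S M g, hyperbolic_element act g & WPD_element act delta D g].

Lemma uniform_separators : ~ virtually_cyclic G -> exists c D' : nat,
  forall S, fin_gen_set S -> exists (d : G -> G -> R) A, separators c D' S d A.
Proof.
move=> nvc; have [r0 hr0] : exists r0, (8500 <= r0)%N by exists 8500%N.
pose N := (2 * wpd_bound (delta := delta) (D := D) 190 + 3)%N.
pose D' := wpd_bound (delta := delta) (D := D) 190.
pose J := (Num.trunc (D (1000 * delta))).+1.
exists ((D' + 33) * (2 * axis_len_bound r0 (J * M) N D' + 1))%N, D' => S hS.
have [g [Sg _ /(axis_of_WPD dl0 hX hA hD)[x [j [jJ hp lp hW]]]]] := hM hS.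
have H := hyp_odist dl0 hX (act := act) x.
have dM := odistM hA x (delta := delta).
apply: (separators_of_axis hr0 H dM hp lp _ _ _ nvc hS).
- by rewrite /N addnS.
- move=> r; exists (2 * wpd_bound (delta := delta) (D := D) r + 3)%N.
  by exists (wpd_bound (delta := delta) (D := D) r); exact: hW.
- exact: hW.
- by apply: word_ballW (word_ballX j Sg); rewrite leq_mul2r jJ orbT.
Qed.

Lemma uniform_finite_normal : finitely_generated G -> exists k, forall (F : G -> Prop) n,
  atmost n F -> (forall s t, F s -> F t -> F (s * t)%g) ->
  (forall g t, F t -> F (g^-1 * t * g)%g) -> atmost k F.
Proof.
move=> [S hS]; have [g [Sg _ /(axis_of_WPD dl0 hX hA hD)[x [j [jJ hp lp hW]]]]] := hM hS.
have H := hyp_odist dl0 hX (act := act) x.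
have dM := odistM hA x (delta := delta).
exists (wpd_bound (delta := delta) (D := D) 82) => F n Fn FM FJ.
exact: (finite_normal_bound H dM hp lp Fn FM FJ (hW 82 _ (leqnn _))).
Qed.

End Uniformity.

(** * Limits of markings *)

Section Reduction.
Context {l : nat}.
Local Notation word := (seq ('I_l * bool)).

Definition word_cons (p : 'I_l * bool) (w : word) : word :=
  if w is q :: w' then if (p.1 == q.1) && (p.2 != q.2) then w' else p :: w else [:: p].

Lemma weval_cons (G : groupType) (a : 'I_l -> G) p w :
  weval a (p :: w) = ((if p.2 then a p.1 else (a p.1)^-1) * weval a w)%g.
Proof. by rewrite /weval big_cons. Qed.

Lemma reduced_form (w : word) : exists2 v : word, reduced v &
  forall (G : groupType) (a : 'I_l -> G), weval a v = weval a w.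
Proof.
elim: w => [|p w [v rv vE]]; first by exists [::].
exists (word_cons p v); last first.
  move=> G a; rewrite weval_cons -vE; case: v {rv vE} => [|q v] /=.
    by rewrite weval_cons.
  case: ifP => [/andP[/eqP e1 e2]|_]; last by rewrite !weval_cons.
  rewrite weval_cons -e1; case: p.2 e2; case: q.2 => // _; by rewrite ?mulKg ?mulVKg.
case: v rv {vE} => // q v rv /=; case: ifP => [_|h]; first exact: path_sorted rv.
by rewrite /reduced /= h.
Qed.

End Reduction.

Section Kernels.
Context {G : groupType} {l : nat}.
Local Notation word := (seq ('I_l * bool)).
Implicit Types a b : 'I_l -> G.

Lemma gen_weval (S : set G) a : (forall g, exists n, word_ball S n g) -> S = range a ->
  forall g, exists w, weval a w = g.
Proof. by move=> + SE; rewrite SE => gen g; have [n /ball_weval[w [_ ww]]] := gen g; exists w. Qed.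

Lemma same_kernel_orbit a b :
  (forall g, exists w : word, weval a w = g) -> (forall g, exists w : word, weval b w = g) ->
  (forall w : word, weval a w = 1%g <-> weval b w = 1%g) ->
  aut_orbit (range a) = aut_orbit (range b).
Proof.
move=> ga gb ab.
have key v w : weval a v = weval a w <-> weval b v = weval b w.
  have E (c : 'I_l -> G) : weval c v = weval c w <-> weval c (v ++ winv w) = 1%g.
    rewrite weval_cat weval_inv; split=> [->|h]; first by rewrite mulgV.
    by rewrite -[LHS](mulgVK (weval c w)) h mul1g.
  by split=> /E/ab/E.
have /choice[wa waE] := ga; have /choice[wb wbE] := gb.
pose phi g := weval b (wa g); pose psi g := weval a (wb g).
have phiE w : phi (weval a w) = weval b w by apply/key; rewrite waE.
have psiE w : psi (weval b w) = weval a w by apply/key; rewrite wbE.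
have phiK : cancel phi psi by move=> g; rewrite /phi psiE waE.
have psiK : cancel psi phi by move=> g; rewrite /psi phiE wbE.
have phiM g h : phi (g * h)%g = (phi g * phi h)%g.
  by rewrite -{1}(waE g) -{1}(waE h) -weval_cat phiE weval_cat.
have psiM g h : psi (g * h)%g = (psi g * psi h)%g.
  by rewrite -{1}(wbE g) -{1}(wbE h) -weval_cat psiE weval_cat.
have phia i : phi (a i) = b i.
  have E (c : 'I_l -> G) : c i = weval c [:: (i, true)] by rewrite /weval big_cons big_nil mulg1.
  by rewrite (E a) phiE -E.
have im : range b = phi @` range a.
  apply/seteqP; split=> [_ [i _ <-]|_ [_ [i _ <-] <-]]; last by exists i.
  by exists (a i) => //; exists i.
have comp (f1 f2 : G -> G) : automorphism f1 -> automorphism f2 -> automorphism (f1 \o f2).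
  move=> [b1 m1] [b2 m2]; split; first exact: bij_comp.
  by move=> g h /=; rewrite m2 m1.
have phi_aut : automorphism phi by split=> //; exists psi.
have psi_aut : automorphism psi by split=> //; exists phi.
rewrite im; apply/seteqP; split=> T [f fa ->].
  exists (f \o psi); first exact: comp.
  by rewrite [RHS]image_comp (_ : (f \o psi) \o phi = f) //; apply/funext => g /=; rewrite phiK.
exists (f \o phi); first exact: comp.
by rewrite [LHS]image_comp.
Qed.

Lemma geodesic_word a g : (exists w : word, weval a w = g) ->
  exists w : word, [/\ weval a w = g, (forall v, weval a v = g -> size w <= size v)%N &
    forall i j, (i <= size w)%N -> (j <= size w)%N ->
      weval a (take i w) = weval a (take j w) -> i = j].
Proof.
move=> ex; pose Q k := `[< exists w : word, weval a w = g /\ size w = k >].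
have exQ : exists k, Q k by have [w wg] := ex; exists (size w); apply/asboolP; exists w.
have [k /asboolP[w [wg wk]] kmin] := ex_minnP exQ.
have wmin v : weval a v = g -> (size w <= size v)%N.
  by move=> vg; rewrite wk; apply: kmin; apply/asboolP; exists v.
exists w; split=> // i j iw jw.
wlog ij : i j iw jw / (i <= j)%N.
  by move=> hw e; case/orP: (leq_total i j) => h; [apply: hw|apply/esym/hw].
move=> e; apply/eqP; rewrite eqn_leq ij leqNgt; apply/negP => lt.
have := wmin (take i w ++ drop j w).
rewrite weval_cat e -weval_cat cat_take_drop => /(_ wg).
rewrite size_cat size_take_min size_drop (minn_idPl iw).
by move: lt jw; clear; lia.
Qed.

End Kernels.

Lemma square_gt_linear (R : realType) (A B : R) : exists q0 : nat, forall q, (q0 <= q)%N ->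
  A * q%:R + B < q%:R * q%:R.
Proof.
exists (Num.trunc (`|A| + `|B|)).+1 => q; rewrite -(ler_nat R) => hq.
have s0 : 0 <= `|A| + `|B| by rewrite addr_ge0.
have /andP[_ h1] := truncn_itv s0.
have q1 : (1 : R) <= q%:R.
  by apply: le_trans hq; rewrite ler1n.
have hA := ler_norm A; have hB := ler_norm B.
have A0 := normr_ge0 A; have B0 := normr_ge0 B.
have {h1}hq : `|A| + `|B| < q%:R by exact: lt_le_trans h1 hq.
have e1 : A * q%:R <= `|A| * q%:R by rewrite ler_wpM2r // ler0n.
have e2 : `|B| * 1 <= `|B| * q%:R by rewrite ler_wpM2l.
have e3 : (`|A| + `|B|) * q%:R < q%:R * q%:R by rewrite ltr_pM2r // (lt_le_trans ltr01).
by move: e1 e2 e3 hB; rewrite mulr1 mulrDl; clear; lra.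
Qed.

(** * Geodesic words in annuli *)

Section Annuli.
Context {R : realType} {G : groupType} {l : nat}.
Local Notation word := (seq ('I_l * bool)).

(** Of being a shortest word only the distinctness of prefixes is kept, which is all that
    [insertion_words] asks for. *)
Definition geodesic_in (a : 'I_l -> G) (k m : nat) (w : word) : Prop :=
  (k <= size w <= m)%N /\ forall i j, (i <= size w)%N -> (j <= size w)%N ->
    weval a (take i w) = weval a (take j w) -> i = j.

Context {S : set G} {a : 'I_l -> G}.
Hypothesis fgS : fin_gen_set S.
Hypothesis Sa : S = range a.

Let SV : forall s, S s -> S s^-1%g. Proof. by case: fgS. Qed.
Let fS : finite_set S. Proof. by case: fgS. Qed.
Let Si i : S (a i). Proof. by rewrite Sa; exists i. Qed.

Lemma annulus k m : exists Ws : seq word, [/\ uniq (map (weval a) Ws),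
  forall w, w \in Ws -> geodesic_in a k.+1 m w &
  (ball_size S m <= size Ws + ball_size S k)%N].
Proof.
have gen g : exists w : word, weval a w = g by apply: gen_weval Sa g; case: fgS.
have /choice[W WP] : forall g, exists w : word, [/\ weval a w = g,
    (forall v, weval a v = g -> size w <= size v)%N &
    forall i j, (i <= size w)%N -> (j <= size w)%N ->
      weval a (take i w) = weval a (take j w) -> i = j].
  by move=> g; exact: geodesic_word.
have [L [uL LP sL]] := finite_enum (word_ball_finite m fS).
pose L1 := [seq g <- L | ~~ `[< word_ball S k g >]].
have WE g : weval a (W g) = g by case: (WP g).
exists (map W L1); split.
- by rewrite -map_comp (eq_map (g := id)) // map_id filter_uniq.
- move=> _ /mapP[g + ->]; rewrite mem_filter => /andP[/asboolP nk /LP gm].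
  have [e1 e2 e3] := WP g; split=> //; apply/andP; split.
    rewrite ltnNge; apply/negP => h; apply: nk; rewrite -e1.
    exact: weval_ball.
  move: gm; rewrite Sa => /ball_weval[v [vm /e2 h]]; exact: leq_trans vm.
- rewrite size_map {1}/ball_size -sL.
  rewrite -[size L](count_predC (fun g => `[< word_ball S k g >])) addnC.
  apply: leq_add; first by rewrite /L1 size_filter.
  rewrite -size_filter.
  apply: (finite_atmost (word_ball_finite k fS)); first exact: filter_uniq.
  by move=> g; rewrite mem_filter => /andP[/asboolP].
Qed.

Lemma long_geodesic k m : (k < m)%N -> ~ virtually_cyclic G ->
  exists w : word, geodesic_in a k.+1 m w.
Proof.
move=> km nvc.
have gen g : exists w : word, weval a w = g by apply: gen_weval Sa g; case: fgS.
have [g gk] : exists g, ~ word_ball S k g.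
  apply: contrapT => h; apply: nvc; exists 1%g.
  apply: sub_finite_set (finite_image _ (word_ball_finite k fS)) => _ [g _ <-].
  by exists g => //; apply: contrapT => ng; apply: h; exists g.
have [w [wg _ winj]] := geodesic_word (gen g).
have kw : (k < size w)%N.
  by rewrite ltnNge; apply/negP => h; apply: gk; rewrite -wg; exact: weval_ball.
have sz : size (take k.+1 w) = k.+1 by rewrite size_take_min; apply/minn_idPl.
exists (take k.+1 w); split; first by rewrite sz leqnn.
rewrite sz => i j ik jk; rewrite !take_takel //.
by apply: winj; exact: leq_trans kw.
Qed.

Definition ball_bound (c D : nat) (be : R) (n : nat) : R :=
  (24 * D * (n + c + 1))%:R * expR ((n + c)%:R * be).

Context {c D : nat} {be : R}.
Hypothesis be0 : 0 <= be.
Hypothesis nvc : ~ virtually_cyclic G.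
Hypothesis lower : forall n, expR (n%:R * be) <= (ball_size S n)%:R.
Hypothesis upper : forall n, (ball_size S n)%:R <= ball_bound c D be n.

(** For be > 0 the ball of radius k is negligible against that of radius 2 k, since expR (k be)
    beats the linear factor of [ball_bound]. For be = 0 this fails, but a single long geodesic word
    is enough. *)
Lemma large_annulus : exists k0, forall k, (k0 < k)%N -> exists Ws : seq word,
  [/\ uniq (map (weval a) Ws), forall w, w \in Ws -> geodesic_in a k.+1 (2 * k) w &
  expR ((2 * k)%:R * be) / 2 <= (size Ws)%:R].
Proof.
have [be1|be1] := leP be 0.
  have {be1}be1 : be = 0 by apply/eqP; rewrite eq_le be1 be0.
  exists 1%N => k k1; have km : (k < 2 * k)%N by clear - k1; lia.
  have [w wg] := long_geodesic km nvc; exists [:: w]; split=> //.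
    by move=> v; rewrite inE => /eqP ->.
  rewrite be1 mulr0 expR0 /=; lra.
pose A := 2 * (24 * D)%:R * expR (c%:R * be) : R.
pose b2 := (be / 2) ^+ 2.
have b2_gt0 : 0 < b2 by rewrite exprn_gt0 // divr_gt0.
have [k0 hk0] := square_gt_linear (A / b2) (A * (c + 1)%:R / b2).
exists k0 => k kk; have [Ws [uW hW sW]] := annulus k (2 * k)%N.
exists Ws; split=> //.
have h1 : expR ((2 * k)%:R * be) <= (size Ws)%:R + ball_bound c D be k.
  apply: le_trans (lower _) _; apply: le_trans (_ : (size Ws + ball_size S k)%:R <= _).
    by rewrite ler_nat.
  by rewrite natrD lerD2l.
suff h2 : 2 * ball_bound c D be k <= expR ((2 * k)%:R * be) by move: h1 h2; lra.
have E2 : expR ((2 * k)%:R * be) = expR (k%:R * be) * expR (k%:R * be).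
  by rewrite -expRD; congr expR; rewrite natrM; lra.
have E1 : 2 * ball_bound c D be k = A * (k + c + 1)%:R * expR (k%:R * be).
  have -> : ball_bound c D be k =
      (24 * D)%:R * (k + c + 1)%:R * (expR (k%:R * be) * expR (c%:R * be)).
    by rewrite /ball_bound natrM [(k + c)%:R]natrD [_ * be]mulrDl expRD.
  by rewrite /A; move: (expR (k%:R * be)) (expR (c%:R * be)) => x y; ring.
rewrite E1 E2 ler_wpM2r ?expR_ge0 //.
have h3 := hk0 k (ltnW kk).
have h4 : A * (k + c + 1)%:R <= b2 * (k%:R * k%:R).
  have e1 : (k + c + 1)%:R = k%:R + (c + 1)%:R :> R by rewrite -natrD addnA.
  rewrite -ler_pdivrMl //; apply: le_trans (ltW h3).
  by rewrite e1 le_eqVlt; apply/orP; left; apply/eqP; move: (b2^-1) => z; ring.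
apply: (le_trans h4).
have E3 : expR (k%:R * be) = expR (k%:R * (be / 2)) ^+ 2.
  by rewrite expr2 -expRD; congr expR; lra.
have h5 := expR_ge1Dx (k%:R * (be / 2)).
have h6 : 0 <= k%:R * (be / 2) by rewrite mulr_ge0 ?ler0n //; lra.
rewrite E3 /b2 !expr2.
have : (k%:R * (be / 2)) * (k%:R * (be / 2)) <=
   expR (k%:R * (be / 2)) * expR (k%:R * (be / 2)) by rewrite ler_pM //; lra.
by move: (expR _) => Z; nra.
Qed.

(** The q^2 insertions per word outgrow the factor in front of the exponential in [ball_bound],
    which is linear in q. *)
Lemma growth_gap (t rate : nat) : (0 < rate)%N -> exists q (Ws : seq word),
  [/\ uniq (map (weval a) Ws),
    forall w, w \in Ws -> geodesic_in a (rate * q).+1 (2 * (rate * q)) w &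
    ball_bound c D be (2 * (rate * q) + t) < (size Ws * (q * q))%:R].
Proof.
move=> r0; have [k0 hk0] := large_annulus.
pose A := 2 * (24 * D)%:R * expR ((t + c)%:R * be) : R.
have [q0 hq0] := square_gt_linear (A * (2 * rate)%:R) (A * (t + c + 1)%:R).
pose q := (q0 + k0.+1)%N.
have [|Ws [uW hW sW]] := hk0 (rate * q)%N.
  by apply: leq_trans (leq_pmull _ r0); rewrite /q leq_addl.
exists q, Ws; split=> //; set m := (2 * (rate * q))%N in sW *.
have h1 := hq0 q (leq_addr _ _).
have E : 2 * ball_bound c D be (m + t) =
    (A * (2 * rate)%:R * q%:R + A * (t + c + 1)%:R) * expR (m%:R * be).
  have e1 : (m + t + c + 1)%:R = (2 * rate)%:R * q%:R + (t + c + 1)%:R :> R.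
    by rewrite /m -natrM -natrD; congr (_%:R); lia.
  have e2 : expR ((m + t + c)%:R * be) = expR (m%:R * be) * expR ((t + c)%:R * be).
    by rewrite -addnA natrD mulrDl expRD.
  rewrite /ball_bound natrM e1 e2 /A.
  by move: (expR (m%:R * be)) (expR ((t + c)%:R * be)) => x y; ring.
have h2 : 0 < expR (m%:R * be) by exact: expR_gt0.
have h3 : 2 * ball_bound c D be (m + t) < q%:R * q%:R * expR (m%:R * be).
  by rewrite E ltr_pM2r.
rewrite !natrM.
have : q%:R * q%:R * (expR (m%:R * be) / 2) <= q%:R * q%:R * (size Ws)%:R :> R.
  by rewrite ler_wpM2l // mulr_ge0 ?ler0n.
by move: h3; rewrite [(size Ws)%:R * _]mulrC; lra.
Qed.

End Annuli.

Lemma ultra_all (T : Type) (U : set_system T) (A : eqType) (s : seq A) (P : A -> T -> Prop) :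
  Filter U -> (forall x, x \in s -> U [set n | P x n]) -> U [set n | forall x, x \in s -> P x n].
Proof.
move=> UF; elim: s => [|x s IH] h; first by apply: filterS filterT.
have h1 : U [set n | P x n] by apply: h; rewrite mem_head.
have h2 : U [set n | forall y, y \in s -> P y n].
  by apply: IH => y ys; apply: h; rewrite inE ys orbT.
by apply: filterS (filterI h1 h2) => n [p1 p2] y; rewrite inE => /predU1P[->|/p2].
Qed.

(** * The limit kernel along an ultrafilter *)

Section LimitKernel.
Context {R : realType} {G : groupType} {l : nat}.
Local Notation word := (seq ('I_l * bool)).
Context {a_ : nat -> 'I_l -> G} {U : set_system nat} {UF : UltraFilter U}.

Let PF : ProperFilter U := @ultra_proper _ _ UF.

Definition limit_kernel (w : word) : Prop := U [set n | weval (a_ n) w = 1%g].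

Lemma limit_kernelN w : ~ limit_kernel w -> U [set n | weval (a_ n) w <> 1%g].
Proof.
by move=> h; have [//|] := in_ultra_setVsetC [set n | weval (a_ n) w = 1%g] UF.
Qed.

(** Finitely many relations of the limit have the same solutions as all of them. They hold together
    for almost all n, and such n satisfy every relation of the limit. *)
Lemma limit_kernel_sub : (0 < l)%N -> equationally_noetherian G ->
  U [set n | forall w, limit_kernel w -> weval (a_ n) w = 1%g].
Proof.
move=> l0 noeth.
have [S0 [fS0 S0S S0E]] := noeth l l0 [set w : free_group l | limit_kernel (sval w)].
have [s sE] := (@finite_seqP {w : word | reduced w} S0).1 fS0.
have h : U [set n | forall w, w \in s -> weval (a_ n) (sval w) = 1%g].
  apply: ultra_all => w ws; apply: S0S; rewrite sE; exact: ws.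
apply: filterS h => n hn w Nw.
have [v rv vE] := reduced_form w.
have : solution_set S0 (a_ n) by move=> u; rewrite sE => /hn.
rewrite S0E => /(_ (exist _ v rv)).
rewrite -(vE G (a_ n)); apply => /=.
by rewrite /limit_kernel; under eq_set do rewrite vE.
Qed.

(** If all inclusions in kernels were equalities, two different markings would have the same kernel
    and lie in one orbit. *)
Lemma strict_kernel : (forall n, fin_gen_set (range (a_ n))) ->
  (forall n m, aut_orbit (range (a_ n)) = aut_orbit (range (a_ m)) -> n = m) ->
  (forall m, U [set n | n <> m]) -> (0 < l)%N -> equationally_noetherian G ->
  exists n0 w0, [/\ forall w, limit_kernel w -> weval (a_ n0) w = 1%g,
    weval (a_ n0) w0 = 1%g & ~ limit_kernel w0].
Proof.
move=> fg inj cof l0 noeth; have E0 := limit_kernel_sub l0 noeth.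
apply: contrapT => nex.
have eqN n : (forall w, limit_kernel w -> weval (a_ n) w = 1%g) ->
    forall w, limit_kernel w <-> weval (a_ n) w = 1%g.
  move=> h w; split; first exact: h.
  by move=> w1; apply: contrapT => nw; apply: nex; exists n, w.
have [m /eqN hm] := filter_ex E0.
have [n [/eqN hn nm]] := filter_ex (filterI E0 (cof m)).
apply: nm; apply: inj.
have gen k g : exists w : word, weval (a_ k) w = g.
  by apply: (@gen_weval _ _ (range (a_ k))) => //; case: (fg k).
by apply: same_kernel_orbit => // w; rewrite -hn hm.
Qed.

Lemma limit_kernel_ext v w : (forall n, weval (a_ n) v = weval (a_ n) w) ->
  limit_kernel v -> limit_kernel w.
Proof. by move=> h; apply: filterS => n /=; rewrite h. Qed.

Lemma limit_kernel_distinct (ws : seq word) : uniq ws ->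
  {in ws &, forall v w, v != w -> ~ limit_kernel (v ++ winv w)} ->
  U [set n | uniq (map (weval (a_ n)) ws)].
Proof.
move=> uws hws.
pose P (x : word * word) n := x.1 != x.2 -> weval (a_ n) x.1 <> weval (a_ n) x.2.
have h : U [set n | forall x, x \in [seq (v, w) | v <- ws, w <- ws] -> P x n].
  apply: ultra_all => _ /allpairsP[[v w] [/= vs ws' ->]].
  have [->|vw] := eqVneq v w; first by apply: filterS filterT => n _; rewrite /P eqxx.
  apply: filterS (limit_kernelN (hws _ _ vs ws' vw)) => n /= h _ e; apply: h.
  by rewrite weval_cat weval_inv e mulgV.
apply: filterS h => n hn; rewrite /= map_inj_in_uniq // => v w vs ws' e.
apply/eqP; apply: contraT => vw; case: (hn (v, w) _ vw) => //.
by apply/allpairsP; exists (v, w).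
Qed.

(* Otherwise the image under a_ n of the preimage under a_ n0 of a largest finite
   normal subgroup would be a larger finite normal subgroup, for almost all n. *)
Lemma infinite_index k n0 w0 : (forall n g, exists w : word, weval (a_ n) w = g) ->
  (forall (F : G -> Prop) n, atmost n F ->
     (forall s t, F s -> F t -> F (s * t)%g) ->
     (forall g t, F t -> F (g^-1 * t * g)%g) -> atmost k F) ->
  (0 < l)%N -> equationally_noetherian G ->
  (forall w, limit_kernel w -> weval (a_ n0) w = 1%g) ->
  weval (a_ n0) w0 = 1%g -> ~ limit_kernel w0 ->
  forall K, exists s : seq word, [/\ uniq s, (K < size s)%N,
    forall w, w \in s -> weval (a_ n0) w = 1%g &
    {in s &, forall v w, v != w -> ~ limit_kernel (v ++ winv w)}].
Proof.
move=> gen FN l0 noeth hn0 w01 nw0 K; apply: contrapT => nex.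
pose Q f := `[< exists (F : G -> Prop) (L : seq G), [/\ F 1%g /\ (exists n, atmost n F),
  (forall s t, F s -> F t -> F (s * t)%g), (forall g t, F t -> F (g^-1 * t * g)%g),
  uniq L /\ size L = f & forall x, x \in L -> F x] >].
have exQ : exists f, Q f.
  exists 0%N; apply/asboolP; exists (fun g => g = 1%g), [::]; split=> //.
  - split=> //; exists 1%N => L uL hL; apply: (@uniq_leq_size _ L [:: 1%g]) => // x /hL ->.
    exact: mem_head.
  - by move=> s t -> ->; rewrite mulg1.
  - by move=> g t ->; rewrite mulg1 mulVg.
have ubQ f : Q f -> (f <= k)%N.
  by move=> /asboolP[F [L [[_ [n Fn]] FM FJ [uL <-] LF]]]; exact: (FN F n Fn FM FJ L uL LF).
case: (ex_maxnP exQ ubQ) => f /asboolP[F0 [L0 [[F1 [nF Fn]] FM FJ [uL fL] LF]]] fmax.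
have L1 : 1%g \in L0.
  apply: contraT => nL; have : Q f.+1.
    apply/asboolP; exists F0, (1%g :: L0); split=> //.
    - by split=> //; exists nF.
    - by rewrite /= nL uL fL.
    - by move=> x; rewrite inE => /predU1P[->|/LF].
  by move=> /fmax; rewrite ltnn.
have /choice[W WE] := gen n0.
(* v0 and W 1 agree under a_ n0 but not in the limit. So under a_ n the lifts of L0 together with v0
   give one element more than L0 has. *)
pose v0 := w0 ++ W 1%g.
pose ws := v0 :: map W L0.
have v0W x : x \in L0 -> ~ limit_kernel (v0 ++ winv (W x)).
  move=> xL; have [->|x1] := eqVneq x 1%g.
    move=> h; apply: nw0; apply: limit_kernel_ext h => n.
    by rewrite !weval_cat weval_inv mulgK.
  move=> /hn0; rewrite !weval_cat weval_inv !WE w01 !mul1g => /eqP.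
  by rewrite invg_eq1 (negPf x1).
have triv v : limit_kernel (v ++ winv v).
  by apply: filterS filterT => n _; rewrite /= weval_cat weval_inv mulgV.
have limV v w : limit_kernel (v ++ winv w) -> limit_kernel (w ++ winv v).
  apply: filterS => n /=; rewrite !weval_cat !weval_inv => h.
  by apply: invg_inj; rewrite invg1 invgM invgK.
have uws : uniq ws.
  rewrite /= (map_inj_in_uniq (in2W (can_inj WE))) uL andbT.
  by apply/mapP => -[x xL E]; apply: (v0W x xL); rewrite -E.
have dws : {in ws &, forall v w, v != w -> ~ limit_kernel (v ++ winv w)}.
  move=> v w; rewrite !inE => /predU1P[->|/mapP[x xL ->]] /predU1P[->|/mapP[y yL ->]] vw.
  - by rewrite eqxx in vw.
  - exact: v0W.
  - by move=> /limV; apply: v0W.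
  - move=> /hn0; rewrite weval_cat weval_inv !WE => h.
    case/negP: vw; apply/eqP; congr (W _).
    by rewrite -[LHS](mulgVK y) h mul1g.
have [n [hn un]] := filter_ex (filterI (limit_kernel_sub l0 noeth) (limit_kernel_distinct uws dws)).
(* F lies over F0 with fibres of at most K elements: a larger fibre would give lifts whose quotients
   are relations of a_ n0 that stay distinct in the limit, which [nex] forbids. *)
pose F x := exists w, F0 (weval (a_ n0) w) /\ weval (a_ n) w = x.
have : Q f.+1.
  apply/asboolP; exists F, (map (weval (a_ n)) ws); split.
  - split; first by exists [::]; rewrite /weval !big_nil.
    exists (K * nF)%N.
    have /choice[V VE] : forall x, exists v, F x ->
        F0 (weval (a_ n0) v) /\ weval (a_ n) v = x.
      move=> x; have [[v vE]|nF'] := pselect (F x); first by exists v.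
      by exists [::].
    apply: (@atmost_fiber _ _ _ _ _ _ (fun x => weval (a_ n0) (V x)) _ Fn) => [x /VE[]//|b].
    case=> [|x0 L] // uL' hL; set L' := x0 :: L in uL' hL *.
    rewrite leqNgt; apply/negP => big; apply: nex.
    have VF x : x \in L' -> weval (a_ n0) (V x) = b /\ weval (a_ n) (V x) = x.
      by move=> /hL[/VE[_ ?] ?].
    have inj : {in L' &, injective (fun x => V x ++ winv (V x0))}.
      move=> x y xL yL /(congr1 (weval (a_ n))); rewrite !weval_cat => /mulIg.
      by rewrite (VF x xL).2 (VF y yL).2.
    exists (map (fun x => V x ++ winv (V x0)) L'); split.
    + by rewrite map_inj_in_uniq.
    + by rewrite size_map.
    + move=> _ /mapP[x xL ->]; rewrite weval_cat weval_inv (VF x xL).1.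
      by rewrite (VF x0 (mem_head _ _)).1 mulgV.
    + move=> _ _ /mapP[x xL ->] /mapP[y yL ->] ne /hn.
      rewrite weval_cat weval_inv !weval_cat weval_inv invgM invgK.
      rewrite (VF x xL).2 (VF y yL).2 (VF x0 (mem_head _ _)).2 mulgA mulgVK => h.
      case/negP: ne; apply/eqP; congr (V _ ++ _).
      by rewrite -[LHS](mulgVK y) h mul1g.
  - move=> _ _ [v [v1 <-]] [w [w1 <-]]; exists (v ++ w).
    by rewrite !weval_cat; split=> //; exact: FM.
  - move=> g _ [v [v1 <-]]; have [w <-] := gen n g; exists (winv w ++ v ++ w).
    by rewrite !weval_cat !weval_inv !mulgA; split=> //; exact: FJ.
  - by split=> //; rewrite size_map /= size_map fL.
  - move=> _ /mapP[w ww ->]; exists w; split=> //.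
    move: ww; rewrite inE => /predU1P[->|/mapP[x xL ->]]; last by rewrite WE; exact: LF.
    by rewrite weval_cat w01 mul1g WE.
by move=> /fmax; rewrite ltnn.
Qed.

End LimitKernel.

Lemma short_words (A : finType) (L : nat) : exists s : seq (seq A),
  forall v : seq A, (size v <= L)%N -> v \in s.
Proof.
exists (flatten [seq [seq val t | t <- enum {: i.-tuple A}] | i <- iota 0 L.+1]) => v vL.
apply/flattenP; exists [seq val t | t <- enum {: (size v).-tuple A}].
  by apply/mapP; exists (size v) => //; rewrite mem_iota add0n ltnS.
by apply/mapP; exists (in_tuple v) => //; rewrite mem_enum.
Qed.

Lemma set_range (T : choiceType) (S : set T) (l : nat) (x0 : T) : S x0 ->
  atmost l S -> exists a : 'I_l -> T, S = range a.
Proof.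
move=> Sx0 Sl; have [/finite_enum[s [us sS ss]] hs] := atmost_finite Sl.
have sl : (size s <= l)%N by rewrite ss.
exists (fun i : 'I_l => nth x0 s i); apply/seteqP; split=> [x /sS xs|_ [i _ <-]].
  have il : (index x s < l)%N by apply: leq_trans sl; rewrite index_mem.
  by exists (Ordinal il) => //=; rewrite nth_index.
have [h|h] := ltnP i (size s); first by apply/sS/mem_nth.
by rewrite nth_default.
Qed.

(** The order of choices matters: n0 and more than 6 D relations s, then the constants t and rate
    from their lengths, then q, m and the words Ws, and only then n, for which the finitely many
    conditions on words of length 16 (m + t) hold together. By [tame_atmost] one of the relations is
    not tame under a_ n. *)
Lemma no_sequence (R : realType) (G : groupType) (l c D k : nat) (be : R)
    (a_ : nat -> 'I_l -> G) :
  (0 < l)%N -> equationally_noetherian G -> ~ virtually_cyclic G ->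
  (forall (F : G -> Prop) n, atmost n F ->
     (forall s t, F s -> F t -> F (s * t)%g) ->
     (forall g t, F t -> F (g^-1 * t * g)%g) -> atmost k F) ->
  0 <= be -> (forall n, fin_gen_set (range (a_ n))) ->
  (forall n, exists (d : G -> G -> R) A, separators c D (range (a_ n)) d A) ->
  (forall n m, expR (m%:R * be) <= (ball_size (range (a_ n)) m)%:R) ->
  (forall n m, (ball_size (range (a_ n)) m)%:R <= ball_bound c D be m) ->
  (forall n m, aut_orbit (range (a_ n)) = aut_orbit (range (a_ m)) -> n = m) -> False.
Proof.
move=> l0 noeth nvc FN be0 fg hsep lower upper inj.
have [U [UU cofU]] := ultraFilterLemma (_ : ProperFilter (\oo : set_system nat)).
have PF := @ultra_proper _ _ UU.
have cof m : U [set n | n <> m].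
  apply: cofU; exists m.+1 => // n /= mn nm; by rewrite nm ltnn in mn.
have [n0 [w0 [hn0 w01 nw0]]] := strict_kernel fg inj cof l0 noeth.
have gen n g : exists w : seq ('I_l * bool), weval (a_ n) w = g.
  by apply: (@gen_weval _ _ (range (a_ n))) => //; case: (fg n).
have [s [us Ks s1 sd]] := infinite_index gen FN l0 noeth hn0 w01 nw0 (6 * D).
pose M := \max_(u <- s) size u.
set t := @tight_len R c D M; set rate := @tight_rate R c D M.
have rate0 : (0 < rate)%N by rewrite /rate /tight_rate muln_gt0.
have [q [Ws [uW hW gap]]] := growth_gap (fg n0) erefl be0 nvc (lower n0) (upper n0) (2 * t) rate0.
set m := (2 * (rate * q))%N in hW gap.
have [vs vsP] := short_words ('I_l * bool)%type (16 * (m + t)).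
have hgood : U [set n | forall v, v \in vs -> weval (a_ n) v = 1%g -> weval (a_ n0) v = 1%g].
  apply: ultra_all => v _; have [lv|/limit_kernelN] := pselect (limit_kernel (a_ := a_) (U := U) v).
    by apply: filterS filterT => n _ _; exact: hn0.
  by apply: filterS => n h /h.
have [n [good un]] := filter_ex (filterI hgood (limit_kernel_distinct us sd)).
have [d [A sep]] := hsep n.
have [u us' ut] : exists2 u, u \in s & ~ tame (A := A) (d := d) (weval (a_ n) u).
  apply: contrapT => nt.
  have : (size (map (weval (a_ n)) s) <= 6 * D)%N.
    apply: (tame_atmost sep un) => _ /mapP[u us' ->]; apply: contrapT => h.
    by apply: nt; exists u.
  by rewrite size_map leqNgt Ks.
have uM : (size u <= M)%N by rewrite /M; apply: (leq_bigmax_seq (F := size) (P := xpredT)).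
have := @tight_ball _ _ _ _ _ _ _ _ _ (a_ n) (a_ n0) u sep _ _ _ uM (s1 u us') ut m (rate * q).+1 q Ws.
rewrite -/t -/rate => h.
have {}h : (size Ws * (q * q) <= ball_size (range (a_ n)) (m + 2 * t))%N.
  apply: h.
  - by move=> i; exists i.
  - by case: (fg n).
  - by move=> i g; exact: ball_weval.
  - by move=> v vL; apply: good; exact: vsP.
  - exact: uW.
  - by move=> w /hW.
  - by clear; lia.
  - by case: (fg n).
have := lt_le_trans gap (_ : _ <= (ball_size (range (a_ n)) (m + 2 * t))%:R).
rewrite ler_nat => /(_ h); rewrite ltNge => /negP; apply; exact: upper.
Qed.

Section SeparatedSets.
Context {R : realType} {G : groupType} {c D : nat} {S : set G}
  {d : G -> G -> R} {A : 'I_3 -> G}.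
Hypothesis sep : separators c D S d A.

Lemma separators_inhabited : exists s, S s.
Proof.
have [[|s w] [_ Sw As]] := sep_ball sep ord0; last by exists s; apply: Sw; rewrite mem_head.
by have := sep_long sep ord0; rewrite As big_nil (hd0 (sep_hyp sep)) ler10.
Qed.

Lemma ball_le_bound (be : R) n : finite_set S -> 0 <= be ->
  (forall eps, 0 < eps -> exists N : nat, forall n, (N <= n)%N ->
    ln (ball_size S n)%:R <= n%:R * (be + eps)) ->
  (ball_size S n)%:R <= ball_bound c D be n.
Proof.
move=> fS be0 ub; have h := ball_upper n fS sep be0 ub.
have D0 : (0 < D)%N.
  apply: (sep_thin sep ord0 [:: 1%g]) => // t; rewrite inE => /eqP->.
  by rewrite mul1g !(hd0 (sep_hyp sep)).
have X0 : 0 < (24 * D * (n + c + 1))%:R :> R by rewrite ltr0n !muln_gt0 D0 addn1.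
have b0 : 0 < (ball_size S n)%:R :> R by rewrite ltr0n ball_size_gt0.
by rewrite -(lnK b0) /ball_bound -(lnK X0) -expRD ler_expR.
Qed.

End SeparatedSets.

Theorem theorem7p1 (R : realType) (G : groupType) (X : metricType R)
  (V : set X) (E : Type) (edge : E -> R -> X) (act : G -> X -> X)
  (delta : R) (D : R -> R) :
  0 < delta ->
  unit_metric_graph V edge ->
  hyperbolic_space X delta ->
  isometric_action act ->
  acts_by_graph_automorphisms act V edge ->
  finitely_generated G ->
  ~ virtually_cyclic G ->
  WPD_function delta D ->
  (exists M : nat, forall S : set G, fin_gen_set S ->
     exists g, [/\ word_ball S M g, hyperbolic_element act g
                 & WPD_element act delta D g]) ->
  equationally_noetherian G ->
  forall rho : R, growth_spectrum R G rho ->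
    finite_set [set aut_orbit S | S in
      [set S : set G | fin_gen_set S /\ growth_rate R S = rho]].
Proof.
move=> dl0 _ hX hA _ hfg nvc hD [M hM] noeth rho _.
have [c [D' hsep]] := uniform_separators dl0 hX hA hD hM nvc.
have [k FN] := uniform_finite_normal dl0 hX hA hD hM hfg.
apply: contrapT => /infiniteP/pcard_leP[f].
have /choice[S_ SP] : forall n, exists S, (fin_gen_set S /\ growth_rate R S = rho) /\
    aut_orbit S = f n.
  by move=> n; have [S Sr Sf] := @funS _ _ _ _ f n I; exists S.
have S_inj n m : aut_orbit (S_ n) = aut_orbit (S_ m) -> n = m.
  by rewrite (SP n).2 (SP m).2; apply: (@inj _ _ _ f); rewrite inE.
pose be := ln rho.
have fS n : finite_set (S_ n) by case: (SP n) => [[[]]].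
have spec n : [/\ 0 <= be, forall m, expR (m%:R * be) <= (ball_size (S_ n) m)%:R &
    forall m, (ball_size (S_ n) m)%:R <= ball_bound c D' be m].
  have [b [b0 bE low up]] := growth_rate_spec (R := R) (fS n).
  have {}bE : b = be by rewrite /be -(SP n).1.2 bE expRK.
  rewrite -bE; have [d [A sep]] := hsep _ (SP n).1.1; split=> // m.
    have p : 0 < (ball_size (S_ n) m)%:R :> R by rewrite ltr0n ball_size_gt0.
    by rewrite -(lnK p) ler_expR.
  exact: (ball_le_bound sep).
(* The upper bound at n = 1 bounds |S|, so all S_ are images of markings with one common number l of
   letters, repetitions allowed. *)
pose l := (Num.trunc (ball_bound c D' be 1)).+1.
have /choice[a_ aE] : forall n, exists a : 'I_l -> G, S_ n = range a.
  move=> n; have [d [A sep]] := hsep _ (SP n).1.1.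
  have [s Ss] := separators_inhabited sep; apply: (set_range Ss).
  apply: atmost_sub _ _ (finite_atmost (word_ball_finite 1 (fS n))); last first.
    by move=> g; exact: word_ball_gen.
  have [be0 _ up] := spec n.
  rewrite -/(ball_size _ _) ltnW // -(ltr_nat R); apply: (le_lt_trans (up 1%N)).
  have b0 : 0 <= ball_bound c D' be 1 by rewrite mulr_ge0 ?ler0n ?expR_ge0.
  by have /andP[] := truncn_itv b0.
apply: (@no_sequence R G l c D' k be a_) => // [|n|n|n|n|n m].
- by case: (spec 0%N).
- by rewrite -aE; exact: (SP n).1.1.
- by rewrite -aE; exact: hsep (SP n).1.1.
- by rewrite -aE; case: (spec n).
- by rewrite -aE; case: (spec n).
- by rewrite -!aE; exact: S_inj.
Qed.
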